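(* Let $k$ be a field of characteristic $0$, let $p(t)$ be the Hilbert polynomial of some closed subscheme of $\mathbb{P}^n=\mathbb{P}^n_k$, and let $r,p,N$ be as in the context. The subscheme of $\mathbf{Gr}_p^N$ representing the Hilbert functor $\underline{\mathbf{Hilb}}^n_{p(t)}$ can be defined by an ideal generated by homogeneous elements of degree $\leq n+1$ in the ring $k[\Delta]$ of the Plücker coordinates.
   Context: The Gotzmann number $r$ of $p(t)$ is the number of summands in the unique expression $p(t)=\sum_{i=1}^{r}\binom{t+a_i-i+1}{a_i}$ with $a_1\ge\dots\ge a_r\ge 0$. Put $N=\binom{n+r}{n}$, $p=p(r)$. The Hilbert functor $\underline{\mathbf{Hilb}}^n_{p(t)}$ sends a noetherian $k$-algebra $A$ to the set of closed subschemes $X\subset\mathbb{P}^n_A$ flat over $\operatorname{Spec}A$ whose fibers have Hilbert polynomial $p(t)$. The Grassmannian $\mathbf{Gr}_p^N$ represents the functor sending $A$ to the set of submodules $L\subseteq A^N$ with $A^N/L$ locally free of rank $p$. Identifying $A^N$ with $H^0(\mathcal{O}_{\mathbb{P}^n_A}(r))$ via the basis of monomials of degree $r$, the Hilbert functor embeds in the Grassmann functor by $X\mapsto H^0(\mathcal{I}_X(r))$, and it is represented by a closed subscheme of $\mathbf{Gr}_p^N$ through this embedding. $k[\Delta]$ is the homogeneous coordinate ring of $\mathbf{Gr}_p^N$ in its Plücker embedding in $\mathbb{P}^E$, $E+1=\binom{N}{p}$ (polynomial ring in the Plücker variables modulo the Plücker relations), graded with the Plücker coordinates in degree $1$. *)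

(* Defs.v *)
From mathcomp Require Import all_boot all_order all_algebra.
From mathcomp Require Import mpoly.

Set Implicit Arguments.
Unset Strict Implicit.
Unset Printing Implicit Defensive.

Import GRing.Theory.
Local Open Scope ring_scope.

(* Submodules and ideals are predicates in Prop, compared extensionally. *)
Definition same (T : Type) (X Y : T -> Prop) : Prop := forall x, X x <-> Y x.

Record is_submodule (A : comNzRingType) (M : lmodType A) (W : M -> Prop) :
    Prop := IsSubmodule {
  submodule0 : W 0;
  submoduleD : forall u v, W u -> W v -> W (u + v);
  submoduleZ : forall a v, W v -> W (a *: v) }.

Definition span (A : comNzRingType) (M : lmodType A) (G : M -> Prop) (v : M) :
    Prop :=
  exists s : seq (A * M),
    (forall t, t \in s -> G t.2) /\ v = \sum_(t <- s) t.1 *: t.2.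

Record is_ideal (S : comNzRingType) (J : S -> Prop) : Prop := IsIdeal {
  ideal0 : J 0;
  idealD : forall x y, J x -> J y -> J (x + y);
  idealM : forall a x, J x -> J (a * x) }.

Definition ideal_gen (S : comNzRingType) (G : S -> Prop) (x : S) : Prop :=
  exists s : seq (S * S),
    (forall t, t \in s -> G t.2) /\ x = \sum_(t <- s) t.1 * t.2.

Definition noetherian (S : comNzRingType) : Prop :=
  forall J : S -> Prop, is_ideal J ->
    exists s : seq S, same J (ideal_gen (fun x => x \in s)).

(* [B], with its map from [A], is the localization A_f.  Only f that are not
   nilpotent have one here, since [B] is not the zero ring. *)
Definition is_localization (A B : comNzRingType) (phi : {rmorphism A -> B})
    (f : A) : Prop :=
  [/\ exists g, phi f * g = 1,
      forall b, exists a m, phi (f ^+ m) * b = phi a &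
      forall a, phi a = 0 -> exists m, f ^+ m * a = 0].

(* [K] is the residue field of [A] at the prime ideal ker phi. *)
Definition is_residue_field (A : comNzRingType) (K : fieldType)
    (phi : {rmorphism A -> K}) : Prop :=
  forall z, exists a b, phi b != 0 /\ z = phi a / phi b.

(* An [A]-bilinear map from N x (M/W) to P, as a map on N x M. *)
Definition bilinear_mod (A : comNzRingType) (M : lmodType A) (W : M -> Prop)
    (N P : lmodType A) (b : N -> M -> P) : Prop :=
  [/\ forall a x y m, b (a *: x + y) m = a *: b x m + b y m,
      forall a x m m', b x (a *: m + m') = a *: b x m + b x m' &
      forall x m, W m -> b x m = 0].

(* The element sum_(t <- s) t.1 (x) [t.2] of the tensor product N (x) (M/W)
   is zero: by the universal property, every bilinear map kills it. *)
Definition tensor_eq0 (A : comNzRingType) (M : lmodType A) (W : M -> Prop)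
    (N : lmodType A) (s : seq (N * M)) : Prop :=
  forall (P : lmodType A) (b : N -> M -> P), bilinear_mod W b ->
    \sum_(t <- s) b t.1 t.2 = 0.

(* The [A]-module M/W is flat: - (x) M/W preserves injective maps. *)
Definition flat_quotient (A : comNzRingType) (M : lmodType A) (W : M -> Prop) :
    Prop :=
  forall (N' N : lmodType A) (f : {linear N' -> N}), injective f ->
  forall s : seq (N' * M),
    tensor_eq0 W [seq (f t.1, t.2) | t <- s] -> tensor_eq0 W s.

(* A quasi-coherent sheaf of ideals on P^n_A, given on the standard charts.
   The coordinate ring A[x_0/x_i, .., x_n/x_i] of D_+(x_i) is
   A[x_0, .., x_n] / (x_i - 1), and an ideal of it is recorded by its preimage
   [J i].  For f homogeneous of degree a + b, the function f/(x_i^a x_j^b) on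
   D_+(x_i x_j) lies in the localization of the i-th ideal iff
   x_j^m f \in J i for some m, and in that of the j-th iff x_i^m f \in J j
   for some m. *)
Definition chart_ideals (A : comNzRingType) (n : nat) : Type :=
  'I_n.+1 -> {mpoly A[n.+1]} -> Prop.

Record is_closed_subscheme (A : comNzRingType) (n : nat)
    (J : chart_ideals A n) : Prop := IsClosedSubscheme {
  chart_is_ideal : forall i, is_ideal (J i);
  chart_dehomog : forall i, J i ('X_i - 1);
  chart_glue : forall i j d (f : {mpoly A[n.+1]}), f \is d.-homog ->
    (exists m, J i ('X_j ^+ m * f)) <-> (exists m, J j ('X_i ^+ m * f)) }.

Definition same_subscheme (A : comNzRingType) (n : nat)
    (J J' : chart_ideals A n) : Prop := forall i, same (J i) (J' i).

Definition flat_subscheme (A : comNzRingType) (n : nat) (J : chart_ideals A n) :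
    Prop := forall i, flat_quotient (J i).

Definition base_change (A B : comNzRingType) (phi : {rmorphism A -> B})
    (n : nat) (J : chart_ideals A n) : chart_ideals B n :=
  fun i => ideal_gen (fun g => exists2 f, J i f & g = map_mpoly phi f).

(* H^0(I_X(d)) inside H^0(O(d)) = A[x_0, .., x_n]_d: on D_+(x_i) the section
   f of O(d) is f/x_i^d times the generator x_i^d. *)
Definition sections (A : comNzRingType) (n : nat) (J : chart_ideals A n)
    (d : nat) (f : {mpoly A[n.+1]}) : Prop :=
  f \is d.-homog /\ forall i, J i f.

(* K[x_0, .., x_n]_d / W has dimension q: it has a basis of q elements. *)
Definition quotient_dim (K : fieldType) (n d : nat)
    (W : {mpoly K[n.+1]} -> Prop) (q : nat) : Prop :=
  exists b : 'I_q -> {mpoly K[n.+1]},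
    (forall i, b i \is d.-homog) /\
    (forall f : {mpoly K[n.+1]}, f \is d.-homog ->
       exists! c : 'rV[K]_q, W (f - \sum_i c 0 i *: b i)).

Definition hilbert_polynomial (K : fieldType) (n : nat) (J : chart_ideals K n)
    (P : {poly rat}) : Prop :=
  exists d0, forall d, (d0 <= d)%N ->
    exists q, P.[d%:R] = q%:R /\ quotient_dim d (sections J d) q.

(* The polynomial 'C(t + s, a) in t. *)
Definition binomial_poly (s : rat) (a : nat) : {poly rat} :=
  (a`!%:R)^-1 *: \prod_(j < a) ('X + (s - j%:R)%:P).

(* The index i starts from 0, hence a_i - i and not a_i - i + 1. *)
Definition gotzmann_number (P : {poly rat}) (r : nat) : Prop :=
  exists a : seq nat,
    [/\ size a = r, sorted geq a &
        P = \sum_(i < r) binomial_poly ((nth 0%N a i)%:R - i%:R) (nth 0%N a i)].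

(* The functors below are taken on nonzero algebras, as MathComp's rings with
   polynomials are nonzero; over the zero ring the Hilbert functor, the
   Grassmann functor and its closed subfunctors all have exactly one point. *)

Definition in_Hilb (A : comNzRingType) (n : nat) (P : {poly rat})
    (J : chart_ideals A n) : Prop :=
  [/\ is_closed_subscheme J, flat_subscheme J &
      forall (K : fieldType) (phi : {rmorphism A -> K}),
        is_residue_field phi -> hilbert_polynomial (base_change phi J) P].

Definition base_change_submodule (A B : comNzRingType)
    (phi : {rmorphism A -> B}) (N : nat) (L : 'rV[A]_N -> Prop) :
    'rV[B]_N -> Prop :=
  span (fun w => exists2 v, L v & w = map_mx phi v).

(* [M] induces an isomorphism from B^N / (L B) onto B^q. *)
Definition trivializes (A B : comNzRingType) (phi : {rmorphism A -> B})
    (N q : nat) (L : 'rV[A]_N -> Prop) (M : 'M[B]_(N, q)) : Prop :=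
  (forall w : 'rV[B]_q, exists v, v *m M = w) /\
  (forall v, v *m M = 0 <-> base_change_submodule phi L v).

Definition quotient_locally_free (A : comNzRingType) (N q : nat)
    (L : 'rV[A]_N -> Prop) : Prop :=
  exists s : seq A, ideal_gen (fun f => f \in s) 1 /\
    forall f, f \in s ->
      exists (B : comNzRingType) (phi : {rmorphism A -> B}) (M : 'M[B]_(N, q)),
        is_localization phi f /\ trivializes phi L M.

Definition in_Gr (A : comNzRingType) (N q : nat) (L : 'rV[A]_N -> Prop) :
    Prop :=
  is_submodule L /\ quotient_locally_free q L.

(* Number of monomials of degree r in n + 1 variables. *)
Definition Nmon (n r : nat) : nat := 'C(n + r, n).

Definition monomial (n r : nat) (i : 'I_(Nmon n r)) : 'X_{1..n.+1} :=
  nth 0%MM [seq s2m (val t) | t <- enum (basis n.+1 r)] i.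

Definition form_of_row (A : comNzRingType) (n r : nat)
    (v : 'rV[A]_(Nmon n r)) : {mpoly A[n.+1]} :=
  \sum_i v 0 i *: 'X_[monomial i].

(* X |-> H^0(I_X(r)), as a submodule of A^N *)
Definition to_Gr (A : comNzRingType) (n r : nat) (J : chart_ideals A n) :
    'rV[A]_(Nmon n r) -> Prop :=
  fun v => sections J r (form_of_row v).

Definition psubset (N q : nat) : finType := {S : {set 'I_N} | #|S| == q}.

Definition plucker_ring (k : fieldType) (N q : nat) :=
  {mpoly k[#|psubset N q|]}.

Fixpoint inversions (N : nat) (s : seq 'I_N) : nat :=
  if s is x :: s' then (count (fun y : 'I_N => y < x)%N s' + inversions s')%N
  else 0%N.

(* The Plücker variable Delta_s of a sequence s of q indices, alternating
   in s; it is 0 if s has a repetition, for then s has less than q elements. *)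
Definition plucker_var (k : fieldType) (N q : nat) (s : seq 'I_N) :
    plucker_ring k N q :=
  if (insub [set x in s] : option (psubset N q)) is Some T then
    (-1) ^+ inversions s * 'X_(enum_rank T)
  else 0.

Definition plucker_relation (k : fieldType) (N q : nat)
    (F : plucker_ring k N q) : Prop :=
  exists (u : seq 'I_N) (w : q.+1.-tuple 'I_N), (size u).+1 = q /\
    F = \sum_(l < q.+1) (-1) ^+ l * plucker_var k q (rcons u (tnth w l))
                        * plucker_var k q (take l w ++ drop l.+1 w).

(* The ideals of k[Delta] are those ideals of the polynomial ring in the
   Plücker variables that contain the Plücker relations; this one is generated
   in k[Delta] by the classes of the elements of [G]. *)
Definition ideal_of_kDelta (k : fieldType) (N q : nat)
    (G : plucker_ring k N q -> Prop) : plucker_ring k N q -> Prop :=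
  ideal_gen (fun F => plucker_relation F \/ G F).

(* The maximal minor of [M] on the rows in [S], in increasing order. *)
Definition minor (B : comNzRingType) (N q : nat) (M : 'M[B]_(N, q))
    (S : psubset N q) : B :=
  \det (\matrix_(i < q, j < q)
          M (enum_val (cast_ord (esym (eqP (valP S))) i)) j).

Definition eval_minors (k : fieldType) (A : comAlgType k) (B : comNzRingType)
    (phi : {rmorphism A -> B}) (N q : nat) (M : 'M[B]_(N, q))
    (F : plucker_ring k N q) : B :=
  mmap (fun c : k => phi (c%:A)) (fun i => minor M (enum_val i)) F.

(* The A-points of the closed subscheme of Gr defined by the ideal [b] of
   k[Delta]: on every open set D(f) of Spec A over which A^N/L is free, the
   elements of [b] vanish at the Plücker coordinates of L. *)
Definition in_subscheme (k : fieldType) (N q : nat)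
    (b : plucker_ring k N q -> Prop) (A : comAlgType k)
    (L : 'rV[A]_N -> Prop) : Prop :=
  in_Gr q L /\
  forall (f : A) (B : comNzRingType) (phi : {rmorphism A -> B})
         (M : 'M[B]_(N, q)),
    is_localization phi f -> trivializes phi L M ->
    forall F, b F -> eval_minors phi M F = 0.

(* The closed subscheme of Gr defined by [b] represents the Hilbert functor
   through X |-> H^0(I_X(r)): this map is a bijection from the A-points of the
   one to those of the other, natural in A. *)
Record represents_Hilb (k : fieldType) (n : nat) (P : {poly rat}) (r q : nat)
    (b : plucker_ring k (Nmon n r) q -> Prop) : Prop := RepresentsHilb {
  Hilb_sub : forall (A : comAlgType k) (J : chart_ideals A n),
    noetherian A -> in_Hilb P J -> in_subscheme b (to_Gr (r := r) J);
  Hilb_inj : forall (A : comAlgType k) (J J' : chart_ideals A n),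
    noetherian A -> in_Hilb P J -> in_Hilb P J' ->
    same (to_Gr (r := r) J) (to_Gr (r := r) J') -> same_subscheme J J';
  Hilb_surj : forall (A : comAlgType k) (L : 'rV[A]_(Nmon n r) -> Prop),
    noetherian A -> in_subscheme b L ->
    exists2 J : chart_ideals A n, in_Hilb P J & same (to_Gr J) L;
  Hilb_natural : forall (A B : comAlgType k) (phi : {lrmorphism A -> B})
      (J : chart_ideals A n),
    noetherian A -> noetherian B -> in_Hilb P J ->
    same (to_Gr (r := r) (base_change phi J))
         (base_change_submodule phi (to_Gr J)) }.

(* Main.v *)
From HB Require Import structures.
From mathcomp Require Import fingroup perm.
From mathcomp Require Import all_boot all_order all_algebra.
From mathcomp Require Import boolp.
From mathcomp Require classical_sets functions.
From mathcomp Require Import mpoly zify ring.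
Require Import Defs.

(* The equations say that x_0 L + .. + x_n L has at least the expected codimension
   P(r + 1) in degree r + 1 (Bayer), for a point L of the Grassmannian of
   subspaces of codimension P(r) in degree r.  When L is the kernel of a matrix M
   with P(r) columns, this is the vanishing of the maximal minors of the matrix
   with rows (lam(x_l m), (0, .., M m, .., 0)), for all choices of sufficiently
   many functionals lam in degree r + 1; each is a form of degree n + 1 in the
   maximal minors of M, with one factor for each of the n + 1 blocks of columns.

   All the rest is done over local rings R.  In generic coordinates (a field of
   characteristic 0) the initial monomials of the fibre of L form a Borel-fixed
   set T, and L is a graph over T.  The combinatorial bound of Macaulay for
   Borel-fixed sets and the equations make the multiples of L of degree r + 1 a
   graph over the shift of T, and rewriting propagates this to all degrees
   (Gotzmann persistence).  An L with this property generates an ideal with a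
   flat quotient, and x_0 is not a zero divisor on it, so L is recovered from the
   subscheme.  Conversely, by flatness the forms vanishing on a point of the
   Hilbert functor are graphs over T in high degree; dividing by x_0 descends
   this to degree r, so that they are generated by those of degree r. *)

Set Implicit Arguments.
Unset Strict Implicit.
Unset Printing Implicit Defensive.

(** * Borel-fixed sets of monomials *)

(** The degree n + 1 comes from presenting L as the kernel of M. Written with generators of L, the
    bound on x_0 L + .. + x_n L would give minors whose size grows with its rank; written with M,
    all that depends on L is n + 1 blocks of P(r) columns each. The obstacle is that good
    coordinates and the set T vary with the point of Spec A, so that nothing is in normal form
    globally. Both the Hilbert functor and the equations are therefore compared with one
    intermediate condition, [good], tested on all local A-algebras; elements and memberships are
    handled one prime at a time, by clearing denominators. Coordinates are changed by a matrix over
    k, not over the residue field, because such a matrix acts over A as well and turns coefficients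
    into functionals [lam] over k; hence deformations are specialized at natural numbers.
    Characteristic 0 serves three times: for these specializations, for the exponents that appear as
    derivatives, and for a division by P(r)! in a Laplace expansion summed over all maps. Monomials
    are ordered so that x_0 divides a form once it divides its initial monomial. *)

Fixpoint monos (m d : nat) : seq (seq nat) :=
  if m is m'.+1 then
    flatten [seq [seq ((d - l)%N :: u) | u <- monos m' l] | l <- iota 0 d.+1]
  else if d == 0%N then [:: [::]] else [::].

Lemma monosS m d : monos m.+1 d =
  flatten [seq [seq (d - l)%N :: u | u <- monos m l] | l <- iota 0 d.+1].
Proof. by []. Qed.

Lemma mem_monos m d s : (s \in monos m d) = (size s == m) && (sumn s == d).
Proof.
elim: m d s => [|m IH] d s; last rewrite monosS.
  by case: s => [|x s]; case: d => [|d] //=; rewrite ?inE ?andbF.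
apply/idP/idP => [/flatten_mapP[l]|].
  rewrite mem_iota => /andP[_ ld] /mapP[u]; rewrite IH => /andP[/eqP su /eqP du] ->.
  by rewrite /= su du eqxx; lia.
case: s => [|e u] // /andP[/eqP [su] /eqP du]; apply/flatten_mapP; rewrite /= in du; exists (sumn u).
  by rewrite mem_iota; lia.
by apply/mapP; exists u; [rewrite IH su !eqxx | congr (_ :: _); lia].
Qed.

Lemma uniq_monos m d : uniq (monos m d).
Proof.
elim: m d => [|m IH] d; first by rewrite /=; case: (d == 0%N).
have H (s : seq nat) : uniq s -> (forall l, l \in s -> l <= d)%N ->
    uniq (flatten [seq [seq ((d - l)%N :: u) | u <- monos m l] | l <- s]).
  elim: s => //= l s IHs /andP[ls us] hs; rewrite cat_uniq map_inj_uniq ?IH; last by move=> ? ? [].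
  rewrite IHs // => [|x xs]; last by apply: hs; rewrite inE xs orbT.
  rewrite andbT; apply/hasPn => x /flatten_mapP[l' l's /mapP[u um ->]].
  apply/negP => /mapP[v vm [e _]]; move: ls; suff -> : l = l' by rewrite l's.
  move: (hs l (mem_head _ _)) (hs l'); rewrite inE l's orbT => h1 /(_ isT) h2; lia.
rewrite monosS; apply: H; first exact: iota_uniq.
by move=> l; rewrite mem_iota; lia.
Qed.

Definition colen m d (T : pred (seq nat)) : nat := count (predC T) (monos m d).

Definition slice d (T : pred (seq nat)) l : pred (seq nat) :=
  fun u => T ((d - l)%N :: u).

Lemma colenS m d T :
  colen m.+1 d T = \sum_(0 <= l < d.+1) colen m l (slice d T l).
Proof.
rewrite /colen monosS count_flatten -map_comp sumnE big_map /index_iota subn0.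
by apply: eq_bigr => l _ /=; rewrite count_map.
Qed.

Lemma colen_sub m d T T' : {in monos m d, subpred T T'} ->
  (colen m d T' <= colen m d T)%N.
Proof.
rewrite /colen; elim: (monos m d) => //= x l IH H.
have Hl : {in l, subpred T T'} by move=> y yl; apply: H; rewrite inE yl orbT.
by move: (H x (mem_head _ _)) (IH Hl); case: (T x) => [->|] //; case: (T' x) => //=; lia.
Qed.

Lemma eq_colen m d T T' : {in monos m d, T =1 T'} -> colen m d T = colen m d T'.
Proof. by move=> H; apply: eq_in_count => s /H /= ->. Qed.

Lemma colen_eq_sub m d (T T' : pred (seq nat)) : {in monos m d, subpred T T'} ->
  colen m d T = colen m d T' -> {in monos m d, T =1 T'}.
Proof.
rewrite /colen; elim: (monos m d) => //= s l IH H e.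
have H' : {in l, subpred T T'} by move=> x xl; apply: H; rewrite inE xl orbT.
have le : (count (predC T') l <= count (predC T) l)%N.
  elim: l H' {IH H e} => //= x l IH H.
  move: (H x (mem_head _ _)) (IH (fun y yl => H y (mem_behead (s:=_::_) yl))).
  by case: (T x) => [->|] //; case: (T' x) => //=; lia.
have Es := H s (mem_head _ _).
have E : count (predC T) l = count (predC T') l.
  by move: Es e; case: (T s) => [->|]//; case: (T' s) => //= _; lia.
move=> x; rewrite inE => /orP[/eqP->|]; last exact: IH.
by move: Es e; rewrite E; case: (T s) => [->|]//; case: (T' s) => //= _; lia.
Qed.

(* Divide by the first variable that occurs: on a Borel-fixed set the
   multiples of degree one more are exactly those whose quotient lies in it. *)
Fixpoint shift_at (s : seq nat) (T : pred (seq nat)) : bool :=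
  match s with
  | [::] => false
  | 0 :: u => shift_at u (fun v => T (0%N :: v))
  | e.+1 :: u => T (e :: u)
  end.

Definition shift (T : pred (seq nat)) : pred (seq nat) := shift_at ^~ T.

(** The part of Borel-fixedness that an induction on the number of variables can use: the slices by
    powers of the first variable are Borel-fixed, and trading one factor of that variable for
    another variable leads from a slice to the next. *)
Fixpoint borel m d (T : pred (seq nat)) : Prop :=
  if m is m'.+1 then
    (forall l, l <= d -> borel m' l (slice d T l))%N /\
    (forall l, l < d -> {in monos m' l.+1, subpred (shift (slice d T l)) (slice d T l.+1)})%N
  else True.

Lemma eq_shift T T' : T =1 T' -> shift T =1 shift T'.
Proof.
move=> H s; rewrite /shift; elim: s T T' H => [|[|e] u IH] T T' H //=.
by apply: IH => v; exact: H.
Qed.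

Lemma shift_sub m d T T' : {in monos m d, subpred T T'} ->
  {in monos m d.+1, subpred (shift T) (shift T')}.
Proof.
elim: m d T T' => [|m IH] d T T' H s; first by rewrite mem_monos => /andP[/nilP->].
case: s => [|[|e] u]; rewrite mem_monos //= /shift /= => /andP[/eqP[su] /eqP du].
  apply: (IH d (fun v => T (0%N :: v)) (fun v => T' (0%N :: v))).
    move=> v vm; apply: H; move: vm; rewrite !mem_monos /= => /andP[/eqP -> /eqP ->].
    by rewrite add0n !eqxx.
  by rewrite mem_monos su -du add0n !eqxx.
by apply: H; rewrite mem_monos /= su; apply/andP; split=> //; lia.
Qed.

Lemma eq_in_shift m d T T' : {in monos m d, T =1 T'} ->
  {in monos m d.+1, shift T =1 shift T'}.
Proof.
move=> H s sm; apply/idP/idP; apply: shift_sub sm => u um /=; first by rewrite H.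
by rewrite -H.
Qed.

Lemma slice_shift d T l : (l <= d)%N -> slice d.+1 (shift T) l =1 slice d T l.
Proof. by move=> ld u; rewrite /slice subSn. Qed.

Lemma slice_shift_last d T : slice d.+1 (shift T) d.+1 =1 shift (slice d T d).
Proof. by move=> u; rewrite /slice !subnn. Qed.

Lemma eq_borel m d T T' : T =1 T' -> borel m d T -> borel m d T'.
Proof.
elim: m d T T' => //= m IH d T T' H [H1 H2]; split=> l ld.
  by apply: IH (H1 l ld) => u; rewrite /slice H.
move=> u um; rewrite -(eq_shift (T := slice d T l)) => [|v]; last by rewrite /slice H.
by move/(H2 l ld u um); rewrite /slice H.
Qed.

(** In degree d + 1 only the slice without the first variable is new; it is the shift of the last
    slice of T. *)
Lemma colen_shift m d T : colen m.+1 d.+1 (shift T) =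
  (colen m.+1 d T + colen m d.+1 (shift (slice d T d)))%N.
Proof.
rewrite !colenS big_nat_recr //=; congr addn.
  rewrite big_nat [RHS]big_nat; apply: eq_bigr => l /andP[_ ld].
  by apply: eq_colen => u _; rewrite slice_shift.
by apply: eq_colen => u _; rewrite slice_shift_last.
Qed.

Lemma colen_shift0 d T : colen 0 d.+1 T = 0%N. Proof. by []. Qed.

(** The Gotzmann expression cut after s summands, at the value d. The sequence a is infinite so that
    s can vary independently of it; for s <= d + 1 the truncated subtraction is exact. *)
Definition gbinom (a : nat -> nat) (s d : nat) : nat :=
  \sum_(0 <= i < s) 'C(d + a i - i, a i).

Definition noninc (a : nat -> nat) := forall i j, (i <= j)%N -> (a j <= a i)%N.

Lemma noninc_pos a s : noninc a -> exists2 s', (s' <= s)%N &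
  (forall i, i < s' -> 0 < a i)%N /\ (forall i, s' <= i -> i < s -> a i = 0)%N.
Proof.
move=> na; elim: s => [|s [s' s's [H1 H2]]]; first by exists 0%N.
have [as0|as0] := posnP (a s).
  exists s'; first exact: leqW.
  split=> // i si; rewrite ltnS leq_eqVlt => /orP[/eqP->//|]; exact: H2.
exists s.+1 => //; split=> i; last by lia.
by rewrite ltnS => si; apply: leq_trans as0 (na _ _ _).
Qed.

Lemma noninc_pred a : noninc a -> noninc (fun i => (a i).-1).
Proof. by move=> H i j /H; lia. Qed.

Lemma gbinom_le a s s' d : (s <= s')%N -> (gbinom a s d <= gbinom a s' d)%N.
Proof. by move=> ss; rewrite /gbinom (@big_cat_nat _ _ _ s 0 s') //= leq_addr. Qed.

(* The hyperplane section lowers each a_i > 0 by one and drops the others. *)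
Lemma gbinomS a s s' d : (s' <= s)%N -> (s <= d.+1)%N ->
  (forall i, i < s' -> 0 < a i)%N -> (forall i, s' <= i -> i < s -> a i = 0)%N ->
  gbinom a s d.+1 = (gbinom a s d + gbinom (fun i => (a i).-1) s' d.+1)%N.
Proof.
move=> ss sd H1 H2; rewrite /gbinom (@big_cat_nat _ _ _ s' 0 s) //=.
rewrite (@big_cat_nat _ _ _ s' 0 s _ (fun i => 'C(d + _ - _, _))) //= addnAC -big_split /=.
congr addn; rewrite big_nat [RHS]big_nat; apply: eq_bigr => i /andP[i0 is'].
  have := H1 i is'; case: (a i) => // k _ /=.
  have -> : (d.+1 + k.+1 - i = (d + k.+1 - i).+1)%N by lia.
  by rewrite binS; congr (_ + 'C(_, _))%N; lia.
by rewrite H2 ?bin0 //; lia.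
Qed.

Lemma hockey k d i : (i <= d)%N ->
  (\sum_(i <= l < d.+1) 'C(l - i + k, k) = 'C(d - i + k.+1, k.+1))%N.
Proof.
elim: d => [|d IH] id.
  by move: id; rewrite leqn0 => /eqP->; rewrite big_nat1 !binn.
rewrite big_nat_recr //=; case: (ltnP d i) => di.
  have -> : i = d.+1 by lia.
  by rewrite big_geq // subnn !binn.
by rewrite IH // !addnS subSn // !addSn binS addnC addnS.
Qed.

(** Each slice gets one extra unit, for the strict excess assumed in the proof of Green's bound. For
    fixed i the terms with l > i sum, by the hockey stick identity, to the i-th summand of
    [gbinom a s' d] minus the missing term at l = i, which is 1; these missing units make up s'. *)
Lemma gbinom_trunc_sum a s' d : (forall i, i < s' -> 0 < a i)%N -> (s' <= d)%N ->
  (\sum_(0 <= l < d.+1) (gbinom (fun i => (a i).-1) (minn l s') l).+1 + s' =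
   gbinom a s' d + d.+1)%N.
Proof.
move=> H sd.
under eq_bigr do rewrite -addn1.
rewrite big_split /= sum_nat_const_nat muln1 subn0 addnAC; congr addn.
rewrite /gbinom.
have E l : \sum_(0 <= i < minn l s') 'C(l + (a i).-1 - i, (a i).-1) =
    \sum_(0 <= i < s') (if i < l then 'C(l + (a i).-1 - i, (a i).-1) else 0)%N.
  rewrite (@big_cat_nat _ _ _ (minn l s') 0 s') ?geq_minr //=.
  rewrite [X in (_ + X)%N]big_nat_cond [X in (_ + X)%N]big1 ?addn0 => [|i].
    rewrite big_nat_cond [RHS]big_nat_cond; apply: eq_bigr => i.
    by rewrite andbT leq_min => /andP[_ /andP[-> _]].
  by rewrite geq_min andbT => /andP[/orP[|] h1 h2]; case: ifP => //; lia.
under eq_bigr do rewrite E.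
rewrite exchange_big /=.
have {2}-> : s' = (\sum_(0 <= i < s') 1)%N by rewrite sum_nat_const_nat; lia.
rewrite -big_split /= big_nat [RHS]big_nat; apply: eq_bigr => i /andP[_ is'].
have id : (i <= d)%N by lia.
have := hockey (a i).-1 id.
rewrite big_ltn // subnn add0n binn prednK ?H // => E1.
have -> : (d + a i - i = d - i + a i)%N by lia.
rewrite -E1 addnC; congr (1 + _)%N.
rewrite (@big_cat_nat _ _ _ i.+1 0 d.+1) //= big_nat big1 ?add0n => [|l /andP[_ li]]; last first.
  by rewrite ltnNge -ltnS li.
rewrite big_nat [RHS]big_nat; apply: eq_bigr => l /andP[li _].
by rewrite li; congr 'C(_, _); lia.
Qed.

Lemma down_ind s d (Q : nat -> Prop) : Q d ->
  (forall l, s <= l -> l < d -> Q l.+1 -> Q l)%N ->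
  forall l, (s <= l)%N -> (l <= d)%N -> Q l.
Proof.
move=> Qd H l sl ld; rewrite -(subKn ld).
have : (d - l <= d - s)%N by lia.
elim: (d - l)%N => [|k IH] kd; first by rewrite subn0.
have e : (d - k = (d - k.+1).+1)%N by lia.
by apply: H; [lia | lia | rewrite -e; apply: IH; lia].
Qed.

Definition macaulay_bound m := forall d T a s, noninc a -> (s <= d)%N ->
  borel m d T -> (colen m d T <= gbinom a s d)%N ->
  (colen m d.+1 (shift T) <= gbinom a s d.+1)%N.

(* If the section were larger than expected, Macaulay's bound applied to the
   slices in lower degrees would make all of them too large. *)
Lemma green m d T a s s' : macaulay_bound m -> noninc a -> (s <= d)%N ->
  (s' <= s)%N -> (forall i, i < s' -> 0 < a i)%N ->
  (forall i, s' <= i -> i < s -> a i = 0)%N -> borel m.+1 d T ->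
  (colen m.+1 d T <= gbinom a s d)%N ->
  (colen m d (slice d T d) <= gbinom (fun i => (a i).-1) s' d)%N.
Proof.
move=> IH na sd ss H1 H2 [B1 B2] H; rewrite leqNgt; apply/negP => C.
have key l : (l <= d)%N ->
    (gbinom (fun i => (a i).-1) (minn l s') l < colen m l (slice d T l))%N.
  move: l (leq0n l); apply: down_ind => [|l _ ld IHl].
    by rewrite (minn_idPr (leq_trans ss sd)).
  rewrite ltnNge; apply/negP => C'; move: IHl; rewrite ltnNge => /negP; apply.
  apply: leq_trans (colen_sub (B2 l ld)) _.
  have := IH l _ _ (minn l s') (noninc_pred na) (geq_minl _ _) (B1 l (ltnW ld)) C'.
  by move=> /leq_trans; apply; apply: gbinom_le; lia.
have := gbinom_trunc_sum H1 (leq_trans ss sd).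
have : (gbinom a s d <= gbinom a s' d + (s - s'))%N.
  rewrite /gbinom (@big_cat_nat _ _ _ s' 0 s) //= leq_add2l big_nat.
  rewrite (eq_bigr (fun=> 1%N)) => [|i /andP[i1 i2]]; last by rewrite H2 ?bin0.
  by rewrite -big_nat sum_nat_const_nat muln1.
have : (\sum_(0 <= l < d.+1) (gbinom (fun i => (a i).-1) (minn l s') l).+1 <=
        colen m.+1 d T)%N.
  by rewrite colenS big_nat [leqRHS]big_nat; apply: leq_sum => l /andP[_]; exact: key.
lia.
Qed.

(** Of the two summands of [colen_shift], the first is the hypothesis; for the second, Green's bound
    controls the last slice and the same theorem in one variable less controls its shift. The
    binomial expression splits in the same way. *)
Lemma macaulay m : macaulay_bound m.
Proof.
elim: m => [|m IH] d T a s na sd B H; first by rewrite colen_shift0.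
have [s' ss [H1 H2]] := noninc_pos s na.
have G := green IH na sd ss H1 H2 B H.
rewrite colen_shift (gbinomS ss _ H1 H2) ?leqW // leq_add //.
by apply: IH => //; [exact: noninc_pred | exact: leq_trans sd | case: B => B _; exact: B].
Qed.

(** A strict inequality is inherited from the first summand of [colen_shift], the second one being
    bounded as before. *)
Lemma macaulay_strict m d T a s : noninc a -> (s <= d)%N ->
  borel m d T -> (colen m d T < gbinom a s d)%N ->
  (colen m d.+1 (shift T) < gbinom a s d.+1)%N.
Proof.
move=> na sd B H; case: m B H => [|m] B H.
  rewrite colen_shift0; case: s sd H => [|s] sd; first by rewrite /gbinom big_geq.
  move=> _; rewrite /gbinom big_ltn // ltn_addr // bin_gt0; lia.
have [s' ss [H1 H2]] := noninc_pos s na.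
have G := green (@macaulay m) na sd ss H1 H2 B (ltnW H).
rewrite colen_shift (gbinomS ss _ H1 H2) ?leqW // -addSn leq_add //.
apply: macaulay => //; [exact: noninc_pred | exact: leq_trans sd | case: B => B _; exact: B].
Qed.

Lemma iter_shift_slice d T j : slice (d + j) (iter j shift T) (d + j) =1
  iter j shift (slice d T d).
Proof.
elim: j => [|j IH] u; first by rewrite addn0.
rewrite iterS addnS slice_shift_last /=; exact: eq_shift.
Qed.

(** The difference of the two given equalities is an equality for the shift of the last slice. By
    the strict bound the slice itself cannot be smaller than expected in degree d, so it satisfies
    both hypotheses in one variable less. *)
Lemma colen_persist m d T a s : noninc a -> (s <= d)%N -> borel m d T ->
  colen m d T = gbinom a s d -> colen m d.+1 (shift T) = gbinom a s d.+1 ->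
  forall j, colen m (d + j) (iter j shift T) = gbinom a s (d + j).
Proof.
elim: m d T a s => [|m IH] d T a s na sd B h0 h1 j.
  have s0 : s = 0%N.
    case: s sd h0 h1 => // s sd _; rewrite colen_shift0 /gbinom big_ltn // => /esym/eqP.
    by rewrite addn_eq0 -leqn0 leqNgt bin_gt0; case/andP=> /negP[]; lia.
  rewrite s0 /gbinom big_geq //; case: j => [|j]; last by rewrite addnS.
  by rewrite addn0 h0 s0 /gbinom big_geq.
have [s' ss [H1 H2]] := noninc_pos s na.
have := green (@macaulay m) na sd ss H1 H2 B; rewrite h0 => /(_ (leqnn _)) G.
have Bd : borel m d (slice d T d) by case: B => B _; exact: B.
have sd' := leq_trans ss sd.
have e1 : colen m d.+1 (shift (slice d T d)) = gbinom (fun i => (a i).-1) s' d.+1.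
  by apply: (@addnI (gbinom a s d)); rewrite -gbinomS ?leqW // -h1 -h0 colen_shift.
have e0 : colen m d (slice d T d) = gbinom (fun i => (a i).-1) s' d.
  apply/eqP; rewrite eqn_leq G /= leqNgt; apply/negP => /(macaulay_strict (noninc_pred na) sd' Bd).
  by rewrite e1 ltnn.
have P := IH _ _ _ _ (noninc_pred na) sd' Bd e0 e1.
elim: j => [|j IHj]; first by rewrite addn0.
rewrite addnS /= colen_shift IHj (@gbinomS a s s') //; last by lia.
congr addn; rewrite -addnS -P; apply: eq_colen => u _ /=.
exact/eq_shift/iter_shift_slice.
Qed.

(* The truncation in degree l of the saturation of a Borel-fixed set that is
   given in degree d. *)
Definition trunc d (T : pred (seq nat)) l : pred (seq nat) :=
  fun s => if s is e :: u then T ((e + (d - l))%N :: u) else false.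

Lemma slice_trunc d T l j : (j <= l)%N -> (l <= d)%N ->
  slice l (trunc d T l) j =1 slice d T j.
Proof. by move=> jl ld u; rewrite /slice /trunc; congr (T (_ :: _)); lia. Qed.

Lemma borel_trunc m d T l : (l <= d)%N -> borel m.+1 d T ->
  borel m.+1 l (trunc d T l).
Proof.
move=> ld [B1 B2]; split=> j jl.
  by apply: eq_borel (B1 j _) => [u|]; [rewrite slice_trunc | lia].
move=> u um; rewrite slice_trunc // (eq_shift (slice_trunc T (ltnW jl) ld)).
by apply: B2; lia.
Qed.

Lemma shift_trunc m d T l : (l < d)%N -> borel m.+1 d T ->
  {in monos m.+1 l.+1, subpred (shift (trunc d T l)) (trunc d T l.+1)}.
Proof.
move=> ld [_ B] [|[|e] u]; rewrite mem_monos //= => /andP[/eqP[su] /eqP du].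
  rewrite /shift /= add0n => H.
  have um : u \in monos m l.+1 by rewrite mem_monos su -du add0n !eqxx.
  exact: (B l ld u um H).
by rewrite /shift /= addSn -addnS; have -> : (d - l = (d - l.+1).+1)%N by lia.
Qed.

(** * Truncations of a Borel-fixed set in lower degrees *)

Section Regularity.
Variables (m d s : nat) (T : pred (seq nat)) (a : nat -> nat).
Hypotheses (na : noninc a) (sd : (s <= d)%N) (B : borel m.+1 d T).
Hypotheses (h0 : colen m.+1 d T = gbinom a s d)
  (h1 : colen m.+1 d.+1 (shift T) = gbinom a s d.+1).

Lemma colen_trunc_top : colen m.+1 d (trunc d T d) = gbinom a s d.
Proof.
rewrite -h0; apply: eq_colen => -[|e u]; rewrite mem_monos //= => _.
by rewrite subnn addn0.
Qed.

(* Both a smaller and a larger value would persist, by the strict bound, up to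
   degree d + 1, respectively for the truncation and for its section. *)
Lemma colen_trunc l : (s <= l)%N -> (l <= d)%N ->
  colen m.+1 l (trunc d T l) = gbinom a s l.
Proof.
move=> sl ld; have [s' ss [H1 H2]] := noninc_pos s na.
have [B1 B2] := B.
have e1 : colen m d.+1 (shift (slice d T d)) = gbinom (fun i => (a i).-1) s' d.+1.
  by apply: (@addnI (gbinom a s d)); rewrite -gbinomS ?leqW // -h1 -h0 colen_shift.
have sect j : (s <= j)%N -> (j <= d)%N ->
    (gbinom (fun i => (a i).-1) s' j <= colen m j (slice d T j))%N.
  move: j; apply: down_ind => [|i sl' ld' IHl]; rewrite leqNgt; apply/negP => C.
    by have := macaulay_strict (noninc_pred na) (leq_trans ss sd) (B1 d (leqnn _)) C; rewrite e1 ltnn.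
  move: IHl; rewrite leqNgt => /negP; apply.
  apply: leq_ltn_trans (colen_sub (B2 _ ld')) _.
  by apply: macaulay_strict C; [exact: noninc_pred | lia | apply: B1; lia].
apply/eqP; rewrite eqn_leq; apply/andP; split; last rewrite leqNgt.
  move: l sl ld; apply: down_ind => [|l sl ld]; first by rewrite colen_trunc_top.
  rewrite (@gbinomS a s s') //; last by lia.
  rewrite colenS big_nat_recr //= => H.
  have S1 := sect l.+1 ltac:(lia) ld.
  rewrite (eq_colen (T' := slice d T l.+1)) in H; last first.
    by move=> u _; rewrite slice_trunc.
  have E : (\sum_(0 <= i < l.+1) colen m i (slice l.+1 (trunc d T l.+1) i)
     = colen m.+1 l (trunc d T l))%N.
    rewrite colenS big_nat [RHS]big_nat; apply: eq_bigr => i /andP[_ id].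
    by apply: eq_colen => u _; rewrite !slice_trunc //; lia.
  rewrite E in H; lia.
apply/negP; move: l sl ld; apply: down_ind => [|l sl ld IHl C].
  by rewrite colen_trunc_top ltnn.
apply: IHl; apply: leq_ltn_trans (colen_sub (shift_trunc ld B)) _.
by apply: macaulay_strict C => //; apply: borel_trunc (ltnW ld) B.
Qed.

(** Macaulay's bound for the truncation in degree l and the exact colength of the truncation in
    degree l + 1 leave no room in the inclusion [shift_trunc]. *)
Lemma trunc_generated l : (s <= l)%N -> (l < d)%N ->
  {in monos m.+1 l.+1, shift (trunc d T l) =1 trunc d T l.+1}.
Proof.
move=> sl ld; apply: colen_eq_sub; first exact: shift_trunc.
apply/eqP; rewrite eqn_leq; apply/andP; split; last first.
  by apply: colen_sub; apply: shift_trunc.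
rewrite (colen_trunc _ ld) ?leqW //; apply: macaulay => //.
  by apply: borel_trunc (ltnW ld) B.
by rewrite colen_trunc // ltnW.
Qed.

End Regularity.

Import GRing.Theory Num.Theory.
Local Open Scope ring_scope.

(** * Ideals, localizations and residue fields *)

Section Ideals.
Variables (A : comNzRingType) (I : A -> Prop) (hI : is_ideal I).

Lemma idealN x : I x -> I (- x).
Proof. by move=> Ix; rewrite -mulN1r; apply: idealM. Qed.

Lemma idealB x y : I x -> I y -> I (x - y).
Proof. by move=> Ix Iy; apply: idealD => //; apply: idealN. Qed.

Lemma ideal_sum (T : Type) (s : seq T) (P : pred T) (F : T -> A) :
  (forall t, P t -> I (F t)) -> I (\sum_(t <- s | P t) F t).
Proof. by move=> H; apply: big_ind => //; [exact: ideal0 | exact: idealD]. Qed.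

End Ideals.

Section Submodules.
Variables (A : comNzRingType) (M : lmodType A) (W : M -> Prop).
Hypothesis hW : is_submodule W.

Lemma submoduleN v : W v -> W (- v).
Proof. by move=> Wv; rewrite -scaleN1r; apply: submoduleZ. Qed.

Lemma submoduleB u v : W u -> W v -> W (u - v).
Proof. by move=> Wu Wv; apply: submoduleD => //; apply: submoduleN. Qed.

Lemma submodule_sum (T : Type) (s : seq T) (P : pred T) (F : T -> M) :
  (forall t, P t -> W (F t)) -> W (\sum_(t <- s | P t) F t).
Proof. by move=> H; apply: big_ind => //; [exact: submodule0 | exact: submoduleD]. Qed.

Lemma span_min (G : M -> Prop) v : (forall u, G u -> W u) -> span G v -> W v.
Proof.
move=> GW [s [sG ->]]; rewrite big_seq; apply: submodule_sum => t ts.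
by apply: submoduleZ => //; apply/GW/sG.
Qed.

End Submodules.

Lemma span_submodule (A : comNzRingType) (M : lmodType A) (G : M -> Prop) :
  is_submodule (span G).
Proof.
split.
- by exists [::]; split=> //; rewrite big_nil.
- move=> u v [s [sG ->]] [t [tG ->]]; exists (s ++ t); rewrite big_cat; split=> //.
  by move=> x; rewrite mem_cat => /orP[/sG|/tG].
move=> a v [s [sG ->]]; exists [seq (a * x.1, x.2) | x <- s]; split.
  by move=> x /mapP[y /sG Gy ->].
by rewrite big_map scaler_sumr; apply: eq_bigr => x _; rewrite scalerA.
Qed.

Lemma sub_span (A : comNzRingType) (M : lmodType A) (G : M -> Prop) v :
  G v -> span G v.
Proof.
move=> Gv; exists [:: (1, v)]; split; last by rewrite big_seq1 scale1r.
by move=> t; rewrite inE => /eqP->.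
Qed.

Lemma ideal_gen_ideal (S : comNzRingType) (G : S -> Prop) : is_ideal (ideal_gen G).
Proof.
split.
- by exists [::]; split=> //; rewrite big_nil.
- move=> u v [s [sG ->]] [t [tG ->]]; exists (s ++ t); rewrite big_cat; split=> //.
  by move=> x; rewrite mem_cat => /orP[/sG|/tG].
move=> a v [s [sG ->]]; exists [seq (a * x.1, x.2) | x <- s]; split.
  by move=> x /mapP[y /sG Gy ->].
by rewrite big_map mulr_sumr; apply: eq_bigr => x _; rewrite mulrA.
Qed.

Lemma sub_ideal_gen (S : comNzRingType) (G : S -> Prop) v : G v -> ideal_gen G v.
Proof.
move=> Gv; exists [:: (1, v)]; split; last by rewrite big_seq1 mul1r.
by move=> t; rewrite inE => /eqP->.
Qed.

Lemma ideal_gen_min (S : comNzRingType) (G I : S -> Prop) v : is_ideal I ->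
  (forall u, G u -> I u) -> ideal_gen G v -> I v.
Proof.
move=> hI GI [s [sG ->]]; rewrite big_seq; apply: ideal_sum => // t ts.
by apply: idealM => //; apply/GI/sG.
Qed.

Lemma image_gen_ideal_gen (A B : comNzRingType) (f : {rmorphism A -> B})
    (G : A -> Prop) (I : B -> Prop) v : is_ideal I ->
  (forall u, G u -> I (f u)) -> ideal_gen G v -> I (f v).
Proof.
move=> hI GI [s [sG ->]]; rewrite rmorph_sum big_seq; apply: ideal_sum => // t ts.
by rewrite rmorphM; apply: idealM => //; apply/GI/sG.
Qed.

(** * Rings of fractions of a quotient ring *)

Section LocalizedQuotient.
Local Open Scope quotient_scope.
Variables (A : comNzRingType) (I S : A -> Prop).
Hypotheses (hI : is_ideal I) (S1 : S 1)
  (SM : forall x y, S x -> S y -> S (x * y)) (SI : forall s, S s -> ~ I s).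

(** A pair whose second entry lies outside S stands for a fraction with denominator 1, so that the
    quotient can be taken on all pairs. *)
Let den (p : A * A) : A := if `[< S p.2 >] then p.2 else 1.

Let denS p : S (den p). Proof. by rewrite /den; case: asboolP. Qed.

Let denE a s : S s -> den (a, s) = s.
Proof. by rewrite /den /=; case: asboolP. Qed.

Let frac_rel : rel (A * A) := fun p q =>
  `[< exists u, S u /\ I (u * (p.1 * den q - q.1 * den p)) >].

Let frac_rel_equiv : equiv_class_of frac_rel.
Proof.
split.
- by move=> p; apply/asboolP; exists 1; split=> //; rewrite subrr mulr0; apply: ideal0.
- have H p q : frac_rel p q -> frac_rel q p.
    move=> /asboolP[u [Su Iu]]; apply/asboolP; exists u; split=> //.
    by rewrite -opprB mulrN; apply: idealN.
  by move=> p q; apply/idP/idP; apply: H.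
move=> q p r /asboolP[u [Su Iu]] /asboolP[v [Sv Iv]]; apply/asboolP.
exists (u * v * den q); split; first by do !apply: SM.
have -> : u * v * den q * (p.1 * den r - r.1 * den p) =
   v * den r * (u * (p.1 * den q - q.1 * den p)) +
   u * den p * (v * (q.1 * den r - r.1 * den q)) by ring.
by apply: idealD => //; apply: idealM.
Qed.

Let frac_equiv := EquivRelPack frac_rel_equiv.

Let Q := {eq_quot frac_equiv}.
Let pi (p : A * A) : Q := \pi_Q p.

Let pi_eq p q : (pi p = pi q) <-> exists u, S u /\ I (u * (p.1 * den q - q.1 * den p)).
Proof.
split=> [/eqquotP|H]; first by move/asboolP.
by apply/eqquotP/asboolP.
Qed.

Let pi_eq1 p q : p.1 * den q = q.1 * den p -> pi p = pi q.
Proof.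
by move=> e; apply/pi_eq; exists 1; split=> //; rewrite e subrr mulr0; apply: ideal0.
Qed.

Let qadd (x y : Q) : Q :=
  pi ((repr x).1 * den (repr y) + (repr y).1 * den (repr x), den (repr x) * den (repr y)).
Let qmul (x y : Q) : Q := pi ((repr x).1 * (repr y).1, den (repr x) * den (repr y)).
Let qopp (x : Q) : Q := pi (- (repr x).1, den (repr x)).

Let qW (P : Q -> Prop) : (forall a s, S s -> P (pi (a, s))) -> forall x, P x.
Proof.
move=> H x; rewrite -[x]reprK -/(pi _).
have -> : pi (repr x) = pi ((repr x).1, den (repr x)) by apply: pi_eq1; rewrite denE.
exact: H.
Qed.

Let repr_rel a s : S s -> exists u, S u /\
  I (u * ((repr (pi (a, s))).1 * s - a * den (repr (pi (a, s))))).
Proof.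
move=> Ss; have /pi_eq[u [Su H]] : pi (repr (pi (a, s))) = pi (a, s) by rewrite /pi reprK.
by exists u; split=> //; rewrite denE in H.
Qed.

Let qaddE a s b t : S s -> S t ->
  qadd (pi (a, s)) (pi (b, t)) = pi (a * t + b * s, s * t).
Proof.
move=> Ss St; rewrite /qadd.
have [u [Su Iu]] := repr_rel a Ss; have [v [Sv Iv]] := repr_rel b St.
move: (repr _) (repr _) Iu Iv => q p Iu Iv.
apply/pi_eq => /=; rewrite !denE; try by apply: SM.
exists (u * v); split; first exact: SM.
have -> : u * v * ((p.1 * den q + q.1 * den p) * (s * t) - (a * t + b * s) * (den p * den q)) =
  v * t * den q * (u * (p.1 * s - a * den p)) + u * s * den p * (v * (q.1 * t - b * den q)) by ring.
by apply: idealD => //; apply: idealM.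
Qed.

Let qmulE a s b t : S s -> S t -> qmul (pi (a, s)) (pi (b, t)) = pi (a * b, s * t).
Proof.
move=> Ss St; rewrite /qmul.
have [u [Su Iu]] := repr_rel a Ss; have [v [Sv Iv]] := repr_rel b St.
move: (repr _) (repr _) Iu Iv => q p Iu Iv.
apply/pi_eq => /=; rewrite !denE; try by apply: SM.
exists (u * v); split; first exact: SM.
have -> : u * v * ((p.1 * q.1) * (s * t) - (a * b) * (den p * den q)) =
  v * t * q.1 * (u * (p.1 * s - a * den p)) + u * a * den p * (v * (q.1 * t - b * den q)) by ring.
by apply: idealD => //; apply: idealM.
Qed.

Let qoppE a s : S s -> qopp (pi (a, s)) = pi (- a, s).
Proof.
move=> Ss; rewrite /qopp; have [u [Su Iu]] := repr_rel a Ss.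
move: (repr _) Iu => p Iu; apply/pi_eq => /=; rewrite !denE //; exists u; split=> //.
have -> : u * (- p.1 * s - - a * den p) = - (u * (p.1 * s - a * den p)) by ring.
exact: idealN.
Qed.

Let q0 : Q := pi (0, 1).
Let q1 : Q := pi (1, 1).

Let solve1 a s b t : S s -> S t -> a * t = b * s -> pi (a, s) = pi (b, t).
Proof. by move=> Ss St e; apply: pi_eq1; rewrite /= !denE. Qed.

Let qaddA : associative qadd.
Proof.
elim/qW=> a s Ss; elim/qW=> b t St; elim/qW=> c u Su.
rewrite !qaddE //; try by apply: SM.
by apply: solve1; do ?apply: SM; rewrite ?denE; try exact: S1; try ring.
Qed.

Let qaddC : commutative qadd.
Proof.
elim/qW=> a s Ss; elim/qW=> b t St; rewrite !qaddE //.
by apply: solve1; do ?apply: SM; rewrite ?denE; try exact: S1; try ring.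
Qed.

Let qadd0 : left_id q0 qadd.
Proof. by elim/qW=> a s Ss; rewrite !qaddE //; apply: solve1; do ?apply: SM; rewrite ?denE; try exact: S1; try ring. Qed.

Let qaddN : left_inverse q0 qopp qadd.
Proof. by elim/qW=> a s Ss; rewrite qoppE // !qaddE //; apply: solve1; do ?apply: SM; rewrite ?denE; try exact: S1; try ring. Qed.

Let qmulA : associative qmul.
Proof.
elim/qW=> a s Ss; elim/qW=> b t St; elim/qW=> c u Su.
rewrite !qmulE //; try by apply: SM.
by apply: solve1; do ?apply: SM; rewrite ?denE; try exact: S1; try ring.
Qed.

Let qmulC : commutative qmul.
Proof.
elim/qW=> a s Ss; elim/qW=> b t St; rewrite !qmulE //.
by apply: solve1; do ?apply: SM; rewrite ?denE; try exact: S1; try ring.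
Qed.

Let qmul1 : left_id q1 qmul.
Proof. by elim/qW=> a s Ss; rewrite !qmulE //; apply: solve1; do ?apply: SM; rewrite ?denE; try exact: S1; try ring. Qed.

Let qmulDl : left_distributive qmul qadd.
Proof.
elim/qW=> a s Ss; elim/qW=> b t St; elim/qW=> c u Su.
rewrite ?(qmulE, qaddE) //; try by apply: SM.
by apply: solve1; do ?apply: SM; rewrite ?denE; try exact: S1; try ring.
Qed.

Let q1_neq0 : q1 != q0.
Proof.
apply/eqP => /pi_eq[u [Su]] /=; rewrite !denE // !mulr1 subr0 mulr1.
exact: SI.
Qed.

HB.instance Definition _ := Choice.on Q.
HB.instance Definition _ := GRing.isZmodule.Build Q qaddA qaddC qadd0 qaddN.
HB.instance Definition _ :=
  GRing.Zmodule_isComNzRing.Build Q qmulA qmulC qmul1 qmulDl q1_neq0.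

Let inj (a : A) : Q := pi (a, 1).

Let inj_zmod : zmod_morphism inj.
Proof.
move=> a b; rewrite -[RHS]/(qadd _ (qopp _)) qoppE // qaddE //.
by apply: solve1; rewrite ?mulr1 //; apply: SM.
Qed.

Let inj_monoid : monoid_morphism inj.
Proof.
split=> [//|a b]; rewrite -[_ * _ in RHS]/(qmul _ _) qmulE //.
by apply: solve1; rewrite ?mulr1 //; apply: SM.
Qed.

HB.instance Definition _ := GRing.isZmodMorphism.Build A Q inj inj_zmod.
HB.instance Definition _ := GRing.isMonoidMorphism.Build A Q inj inj_monoid.

(** One construction for three uses: residue fields, with I prime and S its complement, and, with I
    = 0, the localizations at a prime and at an element. *)
Lemma localized_quotient : exists (B : comNzRingType) (f : {rmorphism A -> B}),
  [/\ forall s, S s -> exists b, f s * b = 1,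
      forall b, exists a s, S s /\ f s * b = f a &
      forall a, f a = 0 <-> exists2 s, S s & I (s * a)].
Proof.
exists (Q : comNzRingType), (inj : {rmorphism A -> Q}); split.
- move=> s Ss; exists (pi (1, s)); rewrite -[_ * _]/(qmul _ _) qmulE //.
  by apply: solve1; do ?apply: SM; try exact: S1; try ring.
- elim/qW=> a s Ss; exists a, s; split=> //; rewrite -[_ * _]/(qmul _ _) qmulE //.
  by apply: solve1; do ?apply: SM; try exact: S1; try ring.
move=> a; split=> [/pi_eq[u [Su]]|[s Ss Is]].
  by rewrite /= !denE // !mulr1 subr0; exists u.
by apply/pi_eq; exists s; rewrite /= !denE // !mulr1 subr0.
Qed.

End LocalizedQuotient.

Section FieldOf.
Variables (B : comNzRingType) (hB : forall b : B, b != 0 -> exists c, c * b = 1).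

Lemma field_of : exists (K : fieldType) (f : {rmorphism B -> K}),
  bijective f.
Proof.
have /choice[inv hinv] : forall b : B, exists c, (b != 0 -> c * b = 1) /\ (b = 0 -> c = 0).
  move=> b; have [->|b0] := eqVneq b 0; first by exists 0; split=> //; rewrite eqxx.
  by have [c hc] := hB b0; exists c; split=> // /eqP; rewrite (negPf b0).
have mulV x : x != 0 -> inv x * x = 1 by case: (hinv x).
have inv0 : inv 0 = 0 by case: (hinv 0) => _; apply.
pose F := GRing.ComNzRing_isField.Build B mulV inv0.
pose K : fieldType := HB.pack (GRing.ComNzRing.sort B) F.
by exists K, (idfun : {rmorphism B -> B}); exists idfun.
Qed.

End FieldOf.

(** No set of denominators is fixed: each b brings a denominator whose image under g is a unit. The
    value at b is then forced, and the condition on kernels makes it independent of the fraction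
    chosen. *)
Lemma ring_lift (A B R : comNzRingType) (f : {rmorphism A -> B})
    (g : {rmorphism A -> R}) :
  (forall b, exists a s t, f s * b = f a /\ g s * t = 1) ->
  (forall a, f a = 0 -> g a = 0) ->
  exists h : {rmorphism B -> R}, forall a, h (f a) = g a.
Proof.
move=> H1 H2.
have /choice[h hh] : forall b, exists r, forall a s, f s * b = f a -> g s * r = g a.
  move=> b; have [a [s [t [e1 e2]]]] := H1 b; exists (g a * t) => a' s' e'.
  have : f (s' * a - s * a') = 0 by rewrite rmorphB !rmorphM -e1 -e'; ring.
  move/H2/eqP; rewrite rmorphB !rmorphM subr_eq0 => /eqP E.
  by rewrite mulrA E mulrAC e2 mul1r.
have cancel s t (x y : R) : g s * t = 1 -> g s * x = g s * y -> x = y.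
  by move=> e /(congr1 ( *%R t)); rewrite !mulrA [t * _]mulrC e !mul1r.
have hE a : h (f a) = g a by have := hh (f a) a 1; rewrite !rmorph1 !mul1r; apply.
have hB : zmod_morphism h.
  move=> x y; have [a [s [t [e1 e2]]]] := H1 x; have [b [s' [t' [e1' e2']]]] := H1 y.
  apply: (cancel (s * s') (t * t')); first by rewrite rmorphM mulrACA e2 e2' mulr1.
  have := hh (x - y) (a * s' - b * s) (s * s').
  rewrite !(rmorphB, rmorphM) -e1 -e1' => ->; last by ring.
  by rewrite -(hh _ _ _ e1) -(hh _ _ _ e1'); ring.
have hM : monoid_morphism h.
  split=> [|x y]; first by rewrite -(rmorph1 f) hE rmorph1.
  have [a [s [t [e1 e2]]]] := H1 x; have [b [s' [t' [e1' e2']]]] := H1 y.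
  apply: (cancel (s * s') (t * t')); first by rewrite rmorphM mulrACA e2 e2' mulr1.
  have := hh (x * y) (a * b) (s * s').
  rewrite !rmorphM -e1 -e1' => ->; last by ring.
  by rewrite -(hh _ _ _ e1) -(hh _ _ _ e1'); ring.
pose Fz := GRing.isZmodMorphism.Build B R h hB.
pose Fm := GRing.isMonoidMorphism.Build B R h hM.
pose H : {rmorphism B -> R} := HB.pack h Fz Fm.
by exists H.
Qed.

Definition prime_ideal (A : comNzRingType) (q : A -> Prop) : Prop :=
  [/\ is_ideal q, ~ q 1 & forall x y, q (x * y) -> q x \/ q y].

Lemma ker_prime (A : comNzRingType) (K : fieldType) (phi : {rmorphism A -> K}) :
  prime_ideal (fun a => phi a = 0).
Proof.
split; last by move=> x y /eqP; rewrite rmorphM mulf_eq0 => /orP[]/eqP; [left|right].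
  split=> [|x y h1 h2|a x h]; first exact: rmorph0.
    by rewrite rmorphD h1 h2 addr0.
  by rewrite rmorphM h mulr0.
by rewrite rmorph1; apply/eqP/oner_neq0.
Qed.

Lemma residue_at (A : comNzRingType) (q : A -> Prop) : prime_ideal q ->
  exists (K : fieldType) (phi : {rmorphism A -> K}),
    is_residue_field phi /\ forall a, phi a = 0 <-> q a.
Proof.
move=> [hq q1 qM].
have [||B [f [f1 f2 f3]]] := @localized_quotient A q (fun a => ~ q a) hq q1.
- by move=> x y qx qy /qM[].
- by [].
have f0 a : f a = 0 <-> q a.
  rewrite f3; split=> [[s qs /qM[]]//|qa]; exists 1 => //.
  by rewrite mul1r.
have hB (b : B) : b != 0 -> exists c, c * b = 1.
  move=> b0; have [a [s [Ss e]]] := f2 b.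
  have [qa|/f1[c hc]] := pselect (q a).
    have [c hc] := f1 _ Ss; case/eqP: b0.
    by rewrite -[b]mul1r -hc mulrAC e (f0 a).2 ?mul0r.
  by exists (c * f s); rewrite -mulrA e mulrC.
have [K [g bg]] := field_of hB; have ig := bij_inj bg.
exists K, (g \o f); split=> [z|a]; last first.
  by rewrite -f0; split=> [/eqP|/= ->]; rewrite ?rmorph0 //= raddf_eq0 // => /eqP.
have [g' gK g'K] := bg; have [a [s [Ss e]]] := f2 (g' z); exists a, s.
have ns : g (f s) != 0 by rewrite raddf_eq0 //; apply/eqP => /f0.
by split=> //=; rewrite -e rmorphM g'K mulrAC mulfV // mul1r.
Qed.

Lemma maximal_above (A : comNzRingType) (I : A -> Prop) : is_ideal I -> ~ I 1 ->
  exists q : A -> Prop, prime_ideal q /\ forall x, I x -> q x.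
Proof.
move=> hI I1.
pose P (J : A -> Prop) := [/\ is_ideal J, ~ J 1 & forall x, I x -> J x].
pose T := {J : A -> Prop | P J}.
pose t0 : T := exist _ I (And3 hI I1 (fun _ h => h)).
pose R : rel T := fun J J' => `[< forall x, sval J x -> sval J' x >].
have [||C tot|[M [hM M1 IM]] /= maxM] := @classical_sets.ZL_preorder T t0 R.
- by move=> J; apply/asboolP.
- by move=> J1 J2 J3 /asboolP h1 /asboolP h2; apply/asboolP => x /h1/h2.
- have [[J0 CJ0]|C0] := pselect (exists J, C J); last first.
    by exists t0 => J CJ; case: C0; exists J.
  pose U x := exists2 J : T, C J & sval J x.
  have hU : P U.
    split; last by move=> x Ix; exists J0 => //; case: (svalP J0) => _ _; apply.
    - split.
      + by exists J0 => //; case: (svalP J0) => h _ _; apply: ideal0.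
      + move=> x y [J CJ Jx] [J' CJ' J'y].
        have [/asboolP h|/asboolP h] := tot _ _ CJ CJ'.
          by exists J' => //; case: (svalP J') => hJ _ _; apply: idealD => //; apply: h.
        by exists J => //; case: (svalP J) => hJ _ _; apply: idealD => //; apply: h.
      + by move=> a x [J CJ Jx]; exists J => //; case: (svalP J) => hJ _ _; apply: idealM.
    - by move=> [J _]; case: (svalP J).
  by exists (exist _ U hU) => J CJ; apply/asboolP => x Jx; exists J.
exists M; split=> //; split=> // x y Mxy.
have [Mx|nMx] := pselect (M x); [by left | right].
have [My|nMy] := pselect (M y) => //.
pose N z := exists a m, M m /\ z = m + a * x.
have hN : is_ideal N.
  split.
  - by exists 0, 0; rewrite mul0r addr0; split=> //; apply: ideal0.
  - move=> u v [a [m [Mm ->]]] [b [m' [Mm' ->]]]; exists (a + b), (m + m').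
    by split; [apply: idealD | ring].
  - move=> c u [a [m [Mm ->]]]; exists (c * a), (c * m).
    by split; [apply: idealM | ring].
have [[a [m [Mm e]]]|N1] := pselect (N 1).
  case: nMy; have -> : y = y * m + a * (x * y) by rewrite -[LHS]mulr1 e; ring.
  by apply: idealD => //; apply: idealM.
have hP : P N.
  split=> // z Iz; exists 0, z; rewrite mul0r addr0; split=> //; exact: (IM _ Iz).
have NM : forall z, N z -> M z.
  apply/asboolP; apply: (maxM (exist _ N hP)); apply/asboolP => z Mz /=.
  by exists 0, z; rewrite mul0r addr0.
case: nMx; apply: NM; exists 1, 0; rewrite mul1r add0r; split=> //.
exact: ideal0.
Qed.

(** R is then a local ring with maximal ideal ker chi; K may be any extension of its residue
    field. *)
Definition local_to (R : comNzRingType) (K : fieldType) (chi : {rmorphism R -> K}) :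
  Prop := forall a, chi a != 0 -> exists b, a * b = 1.

Lemma field_local (K : fieldType) : local_to (idfun : {rmorphism K -> K}).
Proof. by move=> a a0; exists a^-1; rewrite mulfV. Qed.

(* [R] is the localization of [A] at the prime ideal ker phi, and [chi] the map
   to its residue field. *)
Definition localizes_at (A R : comNzRingType) (K : fieldType)
    (phi : {rmorphism A -> K}) (psi : {rmorphism A -> R}) (chi : {rmorphism R -> K}) :
    Prop :=
  [/\ forall a, chi (psi a) = phi a,
      local_to chi,
      forall r, exists a s, phi s != 0 /\ psi s * r = psi a &
      forall a, psi a = 0 <-> exists2 s, phi s != 0 & s * a = 0].

Lemma localize_at (A : comNzRingType) (K : fieldType) (phi : {rmorphism A -> K}) :
  exists (R : comNzRingType) (psi : {rmorphism A -> R}) (chi : {rmorphism R -> K}),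
    localizes_at phi psi chi.
Proof.
have h0 : is_ideal (fun a : A => a = 0).
  by split=> [//|x y -> ->|a x ->]; rewrite ?addr0 ?mulr0.
have [|||R [psi [f1 f2 f3]]] := @localized_quotient A _ (fun s => phi s != 0) h0.
- by rewrite rmorph1 oner_neq0.
- by move=> x y; rewrite rmorphM mulf_eq0 negb_or => -> ->.
- by move=> s + e; rewrite e rmorph0 eqxx.
have [||chi hchi] := @ring_lift A R K psi phi.
- move=> b; have [a [s [Ss e]]] := f2 b; exists a, s, (phi s)^-1; split=> //.
  by rewrite mulfV.
- by move=> a /f3[s Ss /(congr1 phi)/eqP]; rewrite rmorph0 rmorphM mulf_eq0 (negPf Ss) => /eqP.
exists R, psi, chi; split=> // r hr.
have [a [s [Ss e]]] := f2 r.
have ha : phi a != 0 by rewrite -hchi -e rmorphM mulf_neq0 // hchi.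
by have [b hb] := f1 _ ha; exists (psi s * b); rewrite mulrA [r * _]mulrC e.
Qed.

(** The point [phi] witnesses that f is not nilpotent, hence that A_f is not the zero ring. *)
Lemma localize_elt (A : comNzRingType) (K : fieldType) (phi : {rmorphism A -> K}) f :
  phi f != 0 ->
  exists (B : comNzRingType) (psi : {rmorphism A -> B}), is_localization psi f.
Proof.
move=> f0.
have h0 : is_ideal (fun a : A => a = 0).
  by split=> [//|x y -> ->|a x ->]; rewrite ?addr0 ?mulr0.
have [|||R [psi [f1 f2 f3]]] := @localized_quotient A _ (fun s => exists m, s = f ^+ m) h0.
- by exists 0; rewrite expr0.
- by move=> x y [m ->] [m' ->]; exists (m + m')%N; rewrite exprD.
- by move=> s [m ->] /(congr1 phi)/eqP; rewrite rmorph0 rmorphXn expf_eq0 (negPf f0) andbF.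
exists R, psi; split.
- by apply: f1; exists 1%N.
- by move=> b; have [a [_ [[m ->] e]]] := f2 b; exists a, m.
- by move=> a /f3[_ [m ->] e]; exists m.
Qed.

(** The passage from local to global: I is taken to be the ideal of the multipliers c for which c
    times some element is zero, or lies in a given submodule, or the ideal generated by the f over
    which a quotient becomes free. An ideal without 1 lies in a prime, at whose residue field it
    vanishes. *)
Lemma locally_unit (A : comNzRingType) (I : A -> Prop) : is_ideal I ->
  (forall (K : fieldType) (phi : {rmorphism A -> K}), is_residue_field phi ->
     exists2 a, I a & phi a != 0) -> I 1.
Proof.
move=> hI H; have [//|nI] := pselect (I 1).
have [q [hq Iq]] := maximal_above hI nI.
have [K [phi [hphi f0]]] := residue_at hq.
by have [a Ia] := H K phi hphi; rewrite (f0 a).2 ?eqxx //; apply: Iq.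
Qed.

(** * Quotient modules *)

Section QuotientModule.
Local Open Scope quotient_scope.
Variables (A : comNzRingType) (V : lmodType A) (W : V -> Prop).
Hypothesis hW : is_submodule W.

Let rel_W : rel V := fun u v => `[< W (u - v) >].

Let rel_W_equiv : equiv_class_of rel_W.
Proof.
split.
- by move=> u; apply/asboolP; rewrite subrr; apply: submodule0.
- have H u v : rel_W u v -> rel_W v u.
    by move=> /asboolP h; apply/asboolP; rewrite -opprB; apply: submoduleN.
  by move=> u v; apply/idP/idP; apply: H.
- move=> u v w /asboolP h1 /asboolP h2; apply/asboolP.
  by rewrite -(subrKA u); apply: submoduleD.
Qed.

Let Q := {eq_quot (EquivRelPack rel_W_equiv)}.
Let pi (v : V) : Q := \pi_Q v.

Let pi_eq u v : pi u = pi v <-> W (u - v).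
Proof. by split=> [/eqquotP/asboolP|h] //; apply/eqquotP/asboolP. Qed.

Let qadd (x y : Q) : Q := pi (repr x + repr y).
Let qopp (x : Q) : Q := pi (- repr x).
Let qscale (a : A) (x : Q) : Q := pi (a *: repr x).

Let repr_rel v : W (repr (pi v) - v).
Proof. by apply/pi_eq; rewrite /pi reprK. Qed.

Let qaddE u v : qadd (pi u) (pi v) = pi (u + v).
Proof. by apply/pi_eq; rewrite opprD addrACA; apply: submoduleD. Qed.

Let qoppE u : qopp (pi u) = pi (- u).
Proof. by apply/pi_eq; rewrite -opprD; apply: submoduleN. Qed.

Let qscaleE a u : qscale a (pi u) = pi (a *: u).
Proof. by apply/pi_eq; rewrite -scalerBr; apply: submoduleZ. Qed.

Let qW (P : Q -> Prop) : (forall v, P (pi v)) -> forall x, P x.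
Proof. by move=> H x; rewrite -[x]reprK; apply: H. Qed.

Let qaddA : associative qadd.
Proof. by elim/qW=> u; elim/qW=> v; elim/qW=> w; rewrite !qaddE addrA. Qed.
Let qaddC : commutative qadd.
Proof. by elim/qW=> u; elim/qW=> v; rewrite !qaddE addrC. Qed.
Let qadd0 : left_id (pi 0) qadd.
Proof. by elim/qW=> u; rewrite !qaddE add0r. Qed.
Let qaddN : left_inverse (pi 0) qopp qadd.
Proof. by elim/qW=> u; rewrite qoppE qaddE addNr. Qed.

HB.instance Definition _ := Choice.on Q.
HB.instance Definition _ := GRing.isZmodule.Build Q qaddA qaddC qadd0 qaddN.

Let qscaleA a b (x : Q) : qscale a (qscale b x) = qscale (a * b) x.
Proof. by elim/qW: x => u; rewrite !qscaleE scalerA. Qed.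
Let qscale1 : left_id 1 qscale.
Proof. by elim/qW=> u; rewrite qscaleE scale1r. Qed.
Let qscaleDr : right_distributive qscale +%R.
Proof.
move=> a; elim/qW=> u; elim/qW=> v.
by rewrite -[pi u + _]/(qadd _ _) -[RHS]/(qadd _ _) !(qaddE, qscaleE) scalerDr.
Qed.
Let qscaleDl (x : Q) : {morph qscale^~ x : a b / a + b}.
Proof.
elim/qW: x => u a b; rewrite -[RHS]/(qadd _ _) !(qaddE, qscaleE) scalerDl //.
Qed.

HB.instance Definition _ :=
  GRing.Zmodule_isLmodule.Build A Q qscaleA qscale1 qscaleDr qscaleDl.

Let pi_linear : linear pi.
Proof.
move=> a u v; rewrite -[RHS]/(qadd _ _) -[_ *: pi u]/(qscale _ _).
by rewrite qscaleE qaddE.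
Qed.

HB.instance Definition _ := GRing.isLinear.Build A V Q _ pi pi_linear.

(** Supplies the targets of the bilinear maps by which tensors are tested in the arguments on
    flatness. *)
Lemma quotient_module : exists (P : lmodType A) (f : {linear V -> P}),
  (forall x, exists v, f v = x) /\ (forall v, f v = 0 <-> W v).
Proof.
exists (Q : lmodType A), (pi : {linear V -> Q}); split.
  by elim/qW=> v; exists v.
by move=> v; have := pi_eq v 0; rewrite subr0.
Qed.

End QuotientModule.

(** * Spaces of forms as graphs *)

(** Expressing each e_j through the b_i and back gives two matrices; since the e_j are free modulo
    W, their product is the identity, which bounds the sizes. *)
Lemma leq_free_mod (K : fieldType) (V : lmodType K) (W : V -> Prop) (hW : is_submodule W)
    s q (e : 'I_s -> V) (b : 'I_q -> V) :
  (forall x : 'rV[K]_s, W (\sum_j x 0 j *: e j) -> x = 0) ->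
  (forall j, exists c : 'rV[K]_q, W (e j - \sum_i c 0 i *: b i)) ->
  (forall i, exists c : 'rV[K]_s, W (b i - \sum_j c 0 j *: e j)) ->
  (s <= q)%N.
Proof.
move=> free /choice[X hX] /choice[Y hY].
pose MX : 'M_(s, q) := \matrix_(j, i) X j 0 i.
pose MY : 'M_(q, s) := \matrix_(i, j) Y i 0 j.
apply: (@mulmx1_min _ _ _ MX MY); apply/esym/eqP; rewrite -subr_eq0; apply/eqP/row_matrixP => j.
rewrite row0; apply: free.
have -> : \sum_l (row j (1%:M - MX *m MY)) 0 l *: e l =
    (e j - \sum_i X j 0 i *: b i) + \sum_i X j 0 i *: (b i - \sum_l Y i 0 l *: e l).
  under [X in _ = _ + X]eq_bigr do rewrite scalerBr.
  rewrite sumrB addrA subrK; under [LHS]eq_bigr do rewrite !mxE scalerBl.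
  rewrite sumrB; congr (_ - _).
    rewrite (bigD1 j) //= eqxx scale1r big1 ?addr0 // => l lj.
    by rewrite eq_sym (negPf lj) scale0r.
  under [RHS]eq_bigr do rewrite scaler_sumr.
  rewrite exchange_big; apply: eq_bigr => l _; rewrite scaler_suml.
  by apply: eq_bigr => i _; rewrite scalerA !mxE.
apply: submoduleD => //; apply: submodule_sum => // i _; exact: submoduleZ.
Qed.

Definition mons n d : seq 'X_{1..n.+1} := [seq s2m (val t) | t <- enum (basis n.+1 d)].

Lemma mem_mons n d m : (m \in mons n d) = (mdeg m == d).
Proof. by rewrite basis_cover. Qed.

Lemma uniq_mons n d : uniq (mons n d).
Proof. exact: uniq_basis. Qed.

Lemma size_mons n d : size (mons n d) = 'C(n + d, n).
Proof. by rewrite size_basis addnC -bin_sub ?leq_addl // addnK. Qed.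

(** The combinatorial part recurses on the number of variables and so lives on plain sequences; this
    carries its counts over to monomials of a fixed polynomial ring. *)
Lemma mons_monos n d : perm_eq [seq tval (multinom_val m) | m <- mons n d] (monos n.+1 d).
Proof.
apply: uniq_perm; [|exact: uniq_monos|].
  rewrite map_inj_uniq ?uniq_mons // => m m' e; exact/val_inj/val_inj.
move=> s; rewrite mem_monos; apply/mapP/andP => [[m mm ->]|[/eqP sn /eqP sd]].
  by rewrite size_tuple eqxx; move: mm; rewrite mem_mons /mdeg sumnE.
have ts : size s == n.+1 by rewrite sn.
exists (Multinom (Tuple ts)) => //; rewrite mem_mons /mdeg /= -sd sumnE //.
Qed.

Lemma count_mons n d (T : pred (seq nat)) :
  count (fun m : 'X_{1..n.+1} => ~~ T m) (mons n d) = colen n.+1 d T.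
Proof.
rewrite /colen -(permP (mons_monos n d)) [RHS]count_map; exact: eq_count.
Qed.

Lemma mem_monos_mnm n d (m : 'X_{1..n.+1}) : mdeg m = d -> (m : seq nat) \in monos n.+1 d.
Proof. by move=> dm; rewrite mem_monos size_tuple eqxx /= sumnE -/(mdeg m) dm. Qed.

Section Columns.
Variables (n d : nat).
Implicit Types (T : pred (seq nat)) (u v : 'X_{1..n.+1}).

Definition cols T : seq 'X_{1..n.+1} := [seq u : 'X_{1..n.+1} <- mons n d | T u].

Lemma mem_cols T u : (u \in cols T) = (mdeg u == d) && T u.
Proof. by rewrite mem_filter mem_mons andbC. Qed.

Lemma uniq_cols T : uniq (cols T). Proof. exact/filter_uniq/uniq_mons. Qed.

Lemma size_cols T : (size (cols T) + colen n.+1 d T)%N = 'C(n + d, n).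
Proof. by rewrite size_filter -count_mons -size_mons -(count_predC (fun u : 'X_{1..n.+1} => T u)). Qed.

End Columns.

Section Graph.
Variables (n d : nat).
Implicit Types (T : pred (seq nat)) (u v : 'X_{1..n.+1}).

Section Ring.
Variable R : comNzRingType.
Implicit Types (W : {mpoly R[n.+1]} -> Prop) (F G : {mpoly R[n.+1]}).

(* [W] is the graph of a linear map from the span of the monomials in [T] to
   the span of the other ones: reading the coefficients on [T] is a bijection. *)
Definition graph_over T W : Prop :=
  (forall u, mdeg u = d -> T u -> exists2 F, W F &
     forall v, mdeg v = d -> T v -> F@_v = (v == u)%:R) /\
  (forall F, W F -> (forall v, mdeg v = d -> T v -> F@_v = 0) -> F = 0).

Definition form_space W : Prop :=
  is_submodule W /\ forall F, W F -> F \is d.-homog.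

Lemma graph_basis T W : graph_over T W -> exists E : 'X_{1..n.+1} -> {mpoly R[n.+1]},
  forall u, mdeg u = d -> T u ->
    W (E u) /\ forall v, mdeg v = d -> T v -> (E u)@_v = (v == u)%:R.
Proof.
move=> [H _].
suff /choice[E hE] : forall u, exists F, mdeg u = d -> T u ->
    W F /\ forall v, mdeg v = d -> T v -> F@_v = (v == u)%:R by exists E.
move=> u.
have [[du Tu]|N] := pselect (mdeg u = d /\ T u); last by exists 0 => ? ?; case: N.
by have [F WF hF] := H u du Tu; exists F.
Qed.

Lemma mcoeff_sum_cols T (c : 'X_{1..n.+1} -> R) E v :
  (forall u, mdeg u = d -> T u -> forall v, mdeg v = d -> T v -> (E u)@_v = (v == u)%:R) ->
  mdeg v = d -> T v -> (\sum_(u <- cols n d T) c u *: E u)@_v = c v.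
Proof.
move=> hE dv Tv; rewrite raddf_sum /= (bigD1_seq v) ?uniq_cols ?mem_cols ?dv ?eqxx //=.
rewrite mcoeffZ hE // eqxx mulr1 big_seq_cond big1 ?addr0 // => u.
by rewrite mem_cols => /andP[/andP[/eqP du Tu] uv]; rewrite mcoeffZ hE // eq_sym (negPf uv) mulr0.
Qed.

Lemma graph_expand T W E F : is_submodule W -> graph_over T W ->
  (forall u, mdeg u = d -> T u ->
    W (E u) /\ forall v, mdeg v = d -> T v -> (E u)@_v = (v == u)%:R) ->
  W F -> F = \sum_(u <- cols n d T) F@_u *: E u.
Proof.
move=> hW [_ inj] hE WF; apply/eqP; rewrite -subr_eq0; apply/eqP/inj.
  apply: submoduleB => //; rewrite big_seq; apply: submodule_sum => // u.
  rewrite mem_cols => /andP[/eqP du Tu]; apply: submoduleZ => //.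
  by case: (hE u du Tu).
move=> v dv Tv; rewrite mcoeffB mcoeff_sum_cols ?subrr // => u du Tu.
by case: (hE u du Tu).
Qed.

Lemma graph_reduce T W F : is_submodule W -> graph_over T W -> exists2 G, W G &
  forall v, mdeg v = d -> T v -> (F - G)@_v = 0.
Proof.
move=> hW g; have [E hE] := graph_basis g.
exists (\sum_(u <- cols n d T) F@_u *: E u).
  rewrite big_seq; apply: submodule_sum => // u.
  rewrite mem_cols => /andP[/eqP du Tu]; apply: submoduleZ => //.
  by case: (hE u du Tu).
move=> v dv Tv; rewrite mcoeffB mcoeff_sum_cols ?subrr // => u du Tu.
by case: (hE u du Tu).
Qed.

(** Takes the place of a comparison of dimensions over a ring that is not a field: subtracting from
    F in W' the element of W with the same coefficients on T leaves 0. *)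
Lemma graph_sub_eq T W W' : is_submodule W -> graph_over T W -> graph_over T W' ->
  is_submodule W' -> (forall F, W F -> W' F) -> same W W'.
Proof.
move=> hW g [_ inj] hW' sub F; split=> [/sub//|W'F].
have [G WG e] := graph_reduce F hW g.
suff -> : F = G by [].
apply/eqP; rewrite -subr_eq0; apply/eqP/inj => //.
by apply: submoduleB => //; exact: sub.
Qed.

Lemma eq_graph T W W' : same W W' -> graph_over T W -> graph_over T W'.
Proof.
move=> e [h1 h2]; split=> [u du Tu|F /e]; last exact: h2.
by have [F /e WF hF] := h1 u du Tu; exists F.
Qed.

Lemma eq_pred_graph T T' W : {in monos n.+1 d, T =1 T'} ->
  graph_over T W -> graph_over T' W.
Proof.
move=> e [h1 h2]; have e' u : mdeg u = d -> T u = T' u by move=> /mem_monos_mnm/e.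
split=> [u du Tu|F WF hF].
  have [|F WF hF] := h1 u du; first by rewrite e'.
  by exists F => // v dv Tv; apply: hF => //; rewrite e'.
by apply: h2 => // v dv Tv; apply: hF => //; rewrite -e'.
Qed.

Definition lincomb q (E : 'I_q -> {mpoly R[n.+1]}) (c : 'rV[R]_q) :=
  \sum_i c 0 i *: E i.

Definition cols_mx T q (E : 'I_q -> {mpoly R[n.+1]}) :
    'M[R]_(q, size (cols n d T)) :=
  \matrix_(i, j) (E i)@_(nth 0%MM (cols n d T) j).

Lemma lincomb_cols T q (E : 'I_q -> {mpoly R[n.+1]}) c j :
  (c *m cols_mx T E) 0 j = (lincomb E c)@_(nth 0%MM (cols n d T) j).
Proof.
rewrite mxE /lincomb [RHS]raddf_sum /=; apply: eq_bigr => i _.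
by rewrite mxE mcoeffZ.
Qed.

Lemma cols_nthP T v : mdeg v = d -> T v ->
  exists j : 'I_(size (cols n d T)), v = nth 0%MM (cols n d T) j.
Proof.
move=> dv Tv; have vc : v \in cols n d T by rewrite mem_cols dv eqxx.
have := vc; rewrite -index_mem => l; exists (Ordinal l).
by rewrite nth_index.
Qed.

Lemma nth_cols T (j : 'I_(size (cols n d T))) :
  mdeg (nth 0%MM (cols n d T) j) = d /\ T (nth 0%MM (cols n d T) j).
Proof.
have := mem_nth 0%MM (ltn_ord j); rewrite mem_cols => /andP[/eqP -> ->] //.
Qed.

Lemma graph_of_family T W (E : 'I_(size (cols n d T)) -> {mpoly R[n.+1]}) e :
  \det (cols_mx T E) * e = 1 ->
  (forall F, W F <-> exists c, F = lincomb E c) -> graph_over T W.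
Proof.
move=> de hW; set M := cols_mx T E.
have MV : M *m (e *: \adj M) = 1%:M.
  by rewrite -scalemxAr mul_mx_adj scale_scalar_mx mulrC de.
split=> [u du Tu|F /hW[c ->] h].
  have [j ->] := cols_nthP du Tu.
  pose c : 'rV[R]_(size (cols n d T)) := delta_mx 0 j *m (e *: \adj M).
  exists (lincomb E c) => [|v dv Tv]; first by apply/hW; exists c.
  have [l ->] := cols_nthP dv Tv.
  rewrite -lincomb_cols -mulmxA -/M.
  have -> : (e *: \adj M) *m M = 1%:M.
    by rewrite -scalemxAl mul_adj_mx scale_scalar_mx mulrC de.
  by rewrite mulmx1 mxE eqxx /= nth_uniq ?uniq_cols.
have c0 : c *m M = 0.
  apply/matrixP => i j; rewrite ord1 lincomb_cols mxE h //.
    by case: (nth_cols j).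
  by case: (nth_cols j).
have : c = 0 by rewrite -[c]mulmx1 -MV mulmxA c0 mul0mx.
by move=> ->; rewrite /lincomb big1 // => i _; rewrite mxE scale0r.
Qed.

Lemma lincomb_submodule q (E : 'I_q -> {mpoly R[n.+1]}) :
  is_submodule (fun F => exists c, F = lincomb E c).
Proof.
split.
- by exists 0; rewrite /lincomb big1 // => i _; rewrite mxE scale0r.
- move=> _ _ [c ->] [c' ->]; exists (c + c'); rewrite /lincomb -big_split.
  by apply: eq_bigr => i _; rewrite mxE scalerDl.
- move=> a _ [c ->]; exists (a *: c); rewrite /lincomb scaler_sumr.
  by apply: eq_bigr => i _; rewrite mxE scalerA.
Qed.

Lemma lincomb_in W q (E : 'I_q -> {mpoly R[n.+1]}) c : is_submodule W ->
  (forall i, W (E i)) -> W (lincomb E c).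
Proof.
by move=> hW WE; apply: submodule_sum => // i _; apply: submoduleZ.
Qed.

Lemma lincomb_delta q (E : 'I_q -> {mpoly R[n.+1]}) i :
  lincomb E (delta_mx 0 i) = E i.
Proof.
rewrite /lincomb (bigD1 i) //= mxE !eqxx scale1r big1 ?addr0 // => j ji.
by rewrite mxE (negPf ji) andbF scale0r.
Qed.

End Ring.

Definition image_span (R R' : comNzRingType) (f : {rmorphism R -> R'})
    (W : {mpoly R[n.+1]} -> Prop) : {mpoly R'[n.+1]} -> Prop :=
  span (fun G => exists2 F, W F & G = map_mpoly f F).

(** Injectivity does not pass to a base change by itself. It is recovered from the expansion along
    the basis E, an identity that holds on the generators of the image and is linear. *)
Lemma graph_base_change (R R' : comNzRingType) (f : {rmorphism R -> R'}) T
    (W : {mpoly R[n.+1]} -> Prop) :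
  is_submodule W -> graph_over T W -> graph_over T (image_span f W).
Proof.
move=> hW g; have [E hE] := graph_basis g.
have hE' u : mdeg u = d -> T u -> forall v, mdeg v = d -> T v ->
    (map_mpoly f (E u))@_v = (v == u)%:R.
  by move=> du Tu v dv Tv; rewrite mcoeff_map_mpoly (hE u du Tu).2 //= rmorph_nat.
split=> [u du Tu|F WF hF].
  exists (map_mpoly f (E u)); last exact: hE'.
  by apply: sub_span; exists (E u) => //; case: (hE u du Tu).
suff e : forall F, image_span f W F -> F = \sum_(u <- cols n d T) F@_u *: map_mpoly f (E u).
  rewrite (e F WF) big_seq big1 // => u; rewrite mem_cols => /andP[/eqP du Tu].
  by rewrite hF // scale0r.
pose P (F : {mpoly R'[n.+1]}) := F = \sum_(u <- cols n d T) F@_u *: map_mpoly f (E u).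
have hP : is_submodule P.
  split=> [|G H hG hH|a G hG]; rewrite /P.
  - by rewrite big1 // => u _; rewrite mcoeff0 scale0r.
  - rewrite {1}hG {1}hH -big_split; apply: eq_bigr => u _.
    by rewrite mcoeffD scalerDl.
  - by rewrite {1}hG scaler_sumr; apply: eq_bigr => u _; rewrite mcoeffZ scalerA.
move=> G; apply: (span_min hP) => _ [H WH ->].
rewrite /P {1}(graph_expand hW g hE WH) rmorph_sum /=; apply: eq_bigr => u _.
by rewrite mcoeff_map_mpoly map_mpolyZ.
Qed.

(* Over a local ring it is enough to check invertibility over the residue
   field. *)
Lemma graph_lift (R : comNzRingType) (K : fieldType) (chi : {rmorphism R -> K}) T
    (W : {mpoly R[n.+1]} -> Prop) (E : 'I_(size (cols n d T)) -> {mpoly R[n.+1]}) :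
  local_to chi ->
  (forall F, W F <-> exists c, F = lincomb E c) ->
  (forall c : 'rV[K]_(size (cols n d T)),
     (forall v, mdeg v = d -> T v -> (lincomb (fun i => map_mpoly chi (E i)) c)@_v = 0) ->
     c = 0) ->
  graph_over T W.
Proof.
move=> loc hW inj.
suff /loc[e he] : chi (\det (cols_mx T E)) != 0 by exact: graph_of_family he hW.
rewrite -det_map_mx; apply/negP => /det0P[c c0 hc]; case/eqP: c0; apply: inj => v dv Tv.
have [j ->] := cols_nthP dv Tv.
rewrite -lincomb_cols.
have -> : cols_mx T (fun i => map_mpoly chi (E i)) = map_mx chi (cols_mx T E).
  by apply/matrixP => i l; rewrite !mxE mcoeff_map_mpoly.
by rewrite hc mxE.
Qed.

(** Initial monomials are the smallest ones. In a relation over K the smallest monomial u with a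
    nonzero coefficient is met by no other member of the family, so its coefficient cannot
    cancel. *)
Lemma graph_triangular (R : comNzRingType) (K : fieldType) (chi : {rmorphism R -> K}) T
    (W : {mpoly R[n.+1]} -> Prop) (E : 'X_{1..n.+1} -> {mpoly R[n.+1]}) :
  local_to chi ->
  (forall F, W F <-> exists c : 'rV_(size (cols n d T)),
     F = lincomb (fun i => E (nth 0%MM (cols n d T) i)) c) ->
  (forall u, mdeg u = d -> T u -> chi (E u)@_u = 1) ->
  (forall u v, mdeg u = d -> T u -> mdeg v = d -> T v ->
     chi (E u)@_v <> 0 -> v = u \/ (u < v)%O) ->
  graph_over T W.
Proof.
move=> loc hW diag tri; apply: (graph_lift loc hW) => c hc.
apply/eqP/negPn/negP => c0.
have [i ci] : exists i, c 0 i != 0.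
  apply/existsP; rewrite -negb_forall; apply: contra c0 => /forallP h.
  by apply/eqP/matrixP => x j; rewrite ord1 mxE; apply/eqP/h.
have [j cj min] : exists2 j, c 0 j != 0 & forall l, c 0 l != 0 ->
    (nth 0%MM (cols n d T) j <= nth 0%MM (cols n d T) l)%O.
  case: (Order.TotalTheory.arg_minP (P := fun i => c 0 i != 0)
    (fun i : 'I_(size (cols n d T)) => nth 0%MM (cols n d T) i) ci) => j cj h.
  by exists j.
have [dj Tj] := nth_cols j.
have := hc _ dj Tj; rewrite /lincomb raddf_sum /= (bigD1 j) //= mcoeffZ mcoeff_map_mpoly /=.
rewrite diag // mulr1 big1 ?addr0 => [/eqP|l lj]; first by rewrite (negPf cj).
rewrite mcoeffZ mcoeff_map_mpoly /=.
have [->|cl] := eqVneq (c 0 l) 0; first by rewrite mul0r.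
have [dl Tl] := nth_cols l.
have [->|/eqP nz] := eqVneq (chi (E (nth 0%MM (cols n d T) l))@_(nth 0%MM (cols n d T) j)) 0.
  by rewrite mulr0.
case: (tri _ _ dl Tl dj Tj nz) => [/eqP|]; last by rewrite Order.TotalTheory.ltNge min.
by rewrite nth_uniq ?uniq_cols // => /eqP/ord_inj e; rewrite e eqxx in lj.
Qed.

Section Field.
Variable K : fieldType.
Implicit Types (W : {mpoly K[n.+1]} -> Prop).

Definition reads_onto T W := forall u, mdeg u = d -> T u -> exists2 F, W F &
  forall v, mdeg v = d -> T v -> F@_v = (v == u)%:R.

Lemma size_reads_onto T T' W : is_submodule W -> reads_onto T W ->
  graph_over T' W -> (size (cols n d T) <= size (cols n d T'))%N.
Proof.
move=> hW h g; have [E' hE'] := graph_basis g.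
have /choice[E hE] : forall u, exists F, mdeg u = d -> T u ->
    W F /\ forall v, mdeg v = d -> T v -> F@_v = (v == u)%:R.
  move=> u; have [[du Tu]|N] := pselect (mdeg u = d /\ T u).
    by have [F WF hF] := h u du Tu; exists F.
  by exists 0 => du Tu; case: N.
pose A := cols_mx T' (fun i : 'I_(size (cols n d T)) => E (nth 0%MM (cols n d T) i)).
pose B := cols_mx T (fun i : 'I_(size (cols n d T')) => E' (nth 0%MM (cols n d T') i)).
apply: (@mulmx1_min _ _ _ A B); apply/matrixP => i l; rewrite !mxE.
have [di Ti] := nth_cols i; have [dl Tl] := nth_cols l.
have [WE hEi] := hE _ di Ti.
have := congr1 (mcoeff (nth 0%MM (cols n d T) l)) (graph_expand hW g hE' WE).
rewrite hEi // nth_uniq ?uniq_cols // eq_sym => ->.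
rewrite raddf_sum /= (big_nth 0%MM) big_mkord; apply: eq_bigr => j _.
by rewrite mcoeffZ !mxE.
Qed.

Lemma size_graph T T' W : is_submodule W -> graph_over T W -> graph_over T' W ->
  size (cols n d T) = size (cols n d T').
Proof.
move=> hW g g'; apply/eqP; rewrite eqn_leq.
by rewrite (size_reads_onto hW g.1 g') (size_reads_onto hW g'.1 g).
Qed.

(** A nonzero element of W that vanishes on T has a nonzero coefficient at some monomial v, and v
    can be added to T after clearing this coefficient from the others. The number of remaining
    monomials decreases. *)
Lemma reads_onto_extend T W : form_space W -> reads_onto T W ->
  exists T', graph_over T' W /\ (forall s, T s -> T' s).
Proof.
move=> [hW hom].
have := leqnn (size (mons n d) - size (cols n d T))%N.
move: {2}(size (mons n d) - size (cols n d T))%N => N.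
elim: N T => [|N IH] T TN h.
all: have [g|] := pselect (graph_over T W); first by exists T.
all: have [inj|] := pselect (forall F, W F -> (forall v, mdeg v = d -> T v -> F@_v = 0) -> F = 0);
  first by case; split.
all: move=> /existsNP[F /not_implyP[WF /not_implyP[hF F0]]] _.
all: have [v Fv] : exists v, F@_v != 0 by
  apply: contra_notP F0 => /forallNP h0; apply/mpolyP => v; rewrite mcoeff0;
  apply/eqP/negPn/negP/h0.
all: have dv : mdeg v = d by
  apply/eqP/negPn/negP => ne; rewrite (dhomog_nemf_coeff (hom F WF) ne) eqxx in Fv.
all: have nTv : ~~ T v by apply: contraNN Fv => Tv; rewrite hF.
all: pose T1 : pred (seq nat) := predU1 (tval (multinom_val v)) T.
all: have inj_tv (u : 'X_{1..n.+1}) : (tval (multinom_val u) == tval (multinom_val v)) = (u == v)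
  by apply/eqP/eqP => [e|->//]; apply/val_inj/val_inj.
all: have lt : (size (cols n d T) < size (cols n d T1))%N.
1,3: apply: (@uniq_leq_size _ (v :: cols n d T)); first by
  rewrite /= mem_cols (negPf nTv) andbF uniq_cols.
1,2: by move=> u; rewrite inE mem_cols mem_cols /T1 /= inj_tv => /orP[/eqP->|/andP[-> ->]];
  rewrite ?dv ?eqxx ?orbT.
all: have le : (size (cols n d T1) <= size (mons n d))%N by rewrite size_filter count_size.
  by lia.
have [|u du|T' [g sub]] := IH T1.
- lia.
- rewrite /T1 /= inj_tv => /orP[/eqP->|Tu].
    exists ((F@_v)^-1 *: F); first exact: submoduleZ.
    move=> w dw; rewrite /= inj_tv mcoeffZ => /orP[/eqP->|Tw].
      by rewrite mulVf // eqxx.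
    rewrite (hF w) // mulr0; case: eqP => // e; by rewrite -e Tw in nTv.
  have [G WG hG] := h u du Tu.
  exists (G - (G@_v / F@_v) *: F).
    by apply: submoduleB => //; apply: submoduleZ.
  move=> w dw; rewrite /= inj_tv mcoeffB mcoeffZ => /orP[/eqP->|Tw].
    rewrite divfK // subrr; case: eqP => // e; by rewrite e Tu in nTv.
  by rewrite hG // (hF w) // mulr0 subr0.
by exists T'; split=> // s Ts; apply: sub; rewrite /T1 /= Ts orbT.
Qed.

Lemma graph_exists W : form_space W -> exists T, graph_over T W.
Proof.
move=> hW; have [|T [g _]] := @reads_onto_extend pred0 W hW; first by [].
by exists T.
Qed.

(** T extends to a set over which W is a graph, and the count shows that nothing was added. *)
Lemma graph_of_size T T' W : form_space W -> reads_onto T W -> graph_over T' W ->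
  size (cols n d T') = size (cols n d T) -> graph_over T W.
Proof.
move=> hW h g' e; have [T1 [g1 sub]] := reads_onto_extend hW h.
have e1 := size_graph hW.1 g1 g'.
apply: eq_pred_graph g1 => s sm; apply/idP/idP; last exact: sub.
have sp : perm_eq (cols n d T) (cols n d T1).
  have sb : {subset cols n d T <= cols n d T1}.
    by move=> u; rewrite !mem_cols => /andP[-> /sub ->].
  apply: uniq_perm; rewrite ?uniq_cols // => u.
  have sz : (size (cols n d T1) <= size (cols n d T))%N by rewrite e1 e.
  by have [_ ->] := uniq_min_size (uniq_cols n d T) sb sz.
have : s \in [seq tval (multinom_val m) | m <- mons n d] by rewrite (perm_mem (mons_monos n d)).
case/mapP => u um ->; have := perm_mem sp u; rewrite !mem_cols.
by rewrite mem_mons in um; rewrite um /= => ->.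
Qed.

(** The monomials outside T and the family b are both bases modulo W, so [leq_free_mod] applies in
    both directions. *)
Lemma quotient_dim_graph T W q : form_space W -> graph_over T W ->
  quotient_dim d W q -> (size (cols n d T) + q)%N = 'C(n + d, n).
Proof.
move=> [hW hom] g [b [bh hb]].
suff -> : q = colen n.+1 d T by exact: size_cols.
pose T' : pred (seq nat) := predC T.
have cc : size (cols n d T') = colen n.+1 d T by rewrite size_filter -count_mons.
rewrite -cc.
have /choice[c hc] : forall v : 'X_{1..n.+1}, exists c : 'rV[K]_q, mdeg v = d ->
    W ('X_[v] - \sum_i c 0 i *: b i).
  move=> v; have [dv|] := pselect (mdeg v = d); last by exists 0.
  have [|c [h _]] := hb 'X_[v]; first by rewrite dhomogX; apply/eqP.
  by exists c.
have /choice[G hG] : forall i : 'I_q, exists G : {mpoly K[n.+1]}, W (b i - G) /\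
    forall v, mdeg v = d -> T v -> G@_v = 0.
  move=> i; have [F WF hF] := graph_reduce (b i) hW g.
  by exists (b i - F); split=> //; rewrite opprB addrC subrK.
have Gh i : G i \is d.-homog.
  have -> : G i = b i - (b i - G i) by rewrite opprB addrC subrK.
  by apply: rpredB => //; apply: hom; case: (hG i).
have GE i : G i = \sum_(v <- cols n d T') (G i)@_v *: 'X_[v].
  apply/mpolyP => w; rewrite raddf_sum /=.
  have [wc|wc] := boolP (w \in cols n d T').
    rewrite (bigD1_seq w) ?uniq_cols //= mcoeffZ mcoeffX eqxx mulr1 big1 ?addr0 // => v vw.
    by rewrite mcoeffZ mcoeffX (negPf vw) mulr0.
  rewrite big_seq big1 => [|v vc]; last first.
    rewrite mcoeffZ mcoeffX; case: eqP => [e|]; last by rewrite mulr0.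
    by rewrite e (negPf wc) in vc.
  move: wc; rewrite mem_cols negb_and => /orP[dw|/= /negPn Tw].
    exact: dhomog_nemf_coeff (Gh i) dw.
  have [/eqP dw|dw] := boolP (mdeg w == d); first by apply: (hG i).2.
  exact: dhomog_nemf_coeff (Gh i) dw.
have GE' i : \sum_(j < size (cols n d T')) (G i)@_(nth 0%MM (cols n d T') j) *: 'X_[nth 0%MM (cols n d T') j] = G i.
  by symmetry; rewrite {1}GE (big_nth 0%MM) big_mkord.
have ce v : mdeg v = d -> ~~ T v -> exists j : 'I_(size (cols n d T')), v = nth 0%MM (cols n d T') j.
  by move=> dv Tv; apply: (@cols_nthP T').
apply/eqP; rewrite eqn_leq; apply/andP; split.
  apply: (@leq_free_mod _ _ W hW _ _ b (fun j => 'X_[nth 0%MM (cols n d T') j])).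
  - move=> y Wy; have [|c0 [h0 uniq]] := hb 0; first exact: rpred0.
    have W0 : W (0 - \sum_i (0 : 'rV[K]_q) 0 i *: b i).
      rewrite big1 ?subr0 => [|i _]; first exact: submodule0.
      by rewrite mxE scale0r.
    have ey : c0 = y by apply: uniq; rewrite sub0r; exact: submoduleN.
    by rewrite -ey; apply: uniq.
  - move=> i; exists (\row_(j < size (cols n d T')) (G i)@_(nth 0%MM (cols n d T') j)).
    have -> : \sum_(j < size (cols n d T')) (\row_(l < size (cols n d T')) (G i)@_(nth 0%MM (cols n d T') l)) 0 j *: 'X_[nth 0%MM (cols n d T') j] = G i.
      by rewrite -[RHS]GE'; apply: eq_bigr => j _; rewrite mxE.
    by case: (hG i).
  - by move=> j; exists (c (nth 0%MM (cols n d T') j)); apply: hc; case: (nth_cols j).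
apply: (@leq_free_mod _ _ W hW _ _ (fun j => 'X_[nth 0%MM (cols n d T') j]) b).
- move=> y Wy; have h0 : \sum_j y 0 j *: 'X_[nth 0%MM (cols n d T') j] = 0.
    apply: g.2 => // v dv Tv; rewrite raddf_sum /= big1 // => j _.
    rewrite mcoeffZ mcoeffX; case: eqP => [e|]; last by rewrite mulr0.
    by have [_] := nth_cols j; rewrite e /T' /= Tv.
  apply/matrixP => a j; rewrite ord1 mxE.
  have := congr1 (mcoeff (nth 0%MM (cols n d T') j)) h0.
  rewrite raddf_sum /= (bigD1 j) //= mcoeffZ mcoeffX eqxx mulr1 mcoeff0 big1 ?addr0 // => l lj.
  by rewrite mcoeffZ mcoeffX nth_uniq ?uniq_cols // (inj_eq val_inj) (negPf lj) mulr0.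
- by move=> j; exists (c (nth 0%MM (cols n d T') j)); apply: hc; case: (nth_cols j).
- move=> i; exists (\row_(j < size (cols n d T')) (G i)@_(nth 0%MM (cols n d T') j)).
  have -> : \sum_(j < size (cols n d T')) (\row_(l < size (cols n d T')) (G i)@_(nth 0%MM (cols n d T') l)) 0 j *: 'X_[nth 0%MM (cols n d T') j] = G i.
    by rewrite -[RHS]GE'; apply: eq_bigr => j _; rewrite mxE.
  by case: (hG i).
Qed.

End Field.
End Graph.

(** * Generic initial monomials *)

Section Action.
Variables (k : fieldType) (n : nat).

Section Ring.
Variables (R : comNzRingType) (iota : {rmorphism k -> R}).
Implicit Types (g h : 'M[k]_n.+1) (F : {mpoly R[n.+1]}).

Definition act g F : {mpoly R[n.+1]} :=
  F \mPo [tuple \sum_j iota (g i j) *: 'X_j | i < n.+1].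

Lemma actD g F G : act g (F + G) = act g F + act g G.
Proof. exact: raddfD. Qed.
Lemma act0 g : act g 0 = 0. Proof. exact: raddf0. Qed.
Lemma actB g F G : act g (F - G) = act g F - act g G.
Proof. exact: raddfB. Qed.
Lemma actM g F G : act g (F * G) = act g F * act g G.
Proof. exact: rmorphM. Qed.
Lemma actZ g c F : act g (c *: F) = c *: act g F.
Proof. exact: comp_mpolyZ. Qed.
Lemma act_sum g (I : Type) (s : seq I) (P : pred I) (f : I -> {mpoly R[n.+1]}) :
  act g (\sum_(i <- s | P i) f i) = \sum_(i <- s | P i) act g (f i).
Proof. exact: raddf_sum. Qed.
Lemma actX g i : act g 'X_i = \sum_j iota (g i j) *: 'X_j.
Proof.
by rewrite /act comp_mpolyXU -tnth_nth tnth_mktuple.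
Qed.
Lemma actXm g m : act g 'X_[m] = \prod_i (\sum_j iota (g i j) *: 'X_j) ^+ m i.
Proof.
by rewrite /act comp_mpolyX; apply: eq_bigr => i _; rewrite tnth_mktuple.
Qed.

Lemma act1 F : act 1%:M F = F.
Proof.
rewrite -[RHS]comp_mpoly_id; congr (_ \mPo _); apply: eq_from_tnth => i.
rewrite !tnth_mktuple (bigD1 i) //= mxE eqxx rmorph1 scale1r big1 ?addr0 // => j ji.
by rewrite mxE eq_sym (negPf ji) rmorph0 scale0r.
Qed.

Lemma mpoly_ind_linear (P : {mpoly R[n.+1]} -> Prop) :
  P 0 -> (forall F G, P F -> P G -> P (F + G)) ->
  (forall c m, P (c *: 'X_[m])) -> forall F, P F.
Proof.
move=> h0 hD hX F; rewrite [F]mpolyE; apply: big_ind => // m _; exact: hX.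
Qed.

Lemma act_mul g h F : act g (act h F) = act (h *m g) F.
Proof.
elim/mpoly_ind_linear: F => [|F G hF hG|c m]; first by rewrite !act0.
  by rewrite !actD hF hG.
rewrite !actZ; congr (_ *: _); rewrite !actXm {1}/act rmorph_prod /=.
apply: eq_bigr => i _; rewrite rmorphXn /=; congr (_ ^+ _).
rewrite -/(act g _) act_sum.
under [LHS]eq_bigr do rewrite actZ actX scaler_sumr.
rewrite exchange_big; apply: eq_bigr => l _; rewrite mxE rmorph_sum scaler_suml.
by apply: eq_bigr => j _; rewrite scalerA rmorphM.
Qed.

Lemma dhomog_linear (f : 'I_n.+1 -> R) : \sum_j f j *: 'X_j \is 1.-homog.
Proof.
by apply: rpred_sum => j _; apply: rpredZ; rewrite dhomogX /= mdeg1.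
Qed.

Lemma act_homog d g F : F \is d.-homog -> act g F \is d.-homog.
Proof.
move=> hF; rewrite [F]mpolyE act_sum big_seq; apply: rpred_sum => m mF.
rewrite actZ; apply: rpredZ; rewrite actXm.
have <- : (\sum_i m i)%N = d by rewrite -mdegE; exact: (dhomog_mf hF).
elim/big_ind2: _ => [|d1 F1 d2 F2 h1 h2|i _].
- exact: dhomog1.
- exact: dhomogM.
- by have := dhomogMn (m i) (dhomog_linear (fun j => iota (g i j))); rewrite mul1n.
Qed.

(** The space W in the coordinates g. As a preimage it is a submodule for every matrix, and
    membership unfolds without an inverse. *)
Definition pre g (W : {mpoly R[n.+1]} -> Prop) : {mpoly R[n.+1]} -> Prop :=
  fun F => W (act g F).

Lemma pre_submodule g W : is_submodule W -> is_submodule (pre g W).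
Proof.
move=> hW; split; rewrite /pre.
- by rewrite act0; apply: submodule0.
- by move=> F G; rewrite actD; apply: submoduleD.
- by move=> a F; rewrite actZ; apply: submoduleZ.
Qed.

Lemma unit_act_homog d g F : g \in unitmx -> act g F \is d.-homog -> F \is d.-homog.
Proof.
move=> ug h; rewrite -[F]act1 -(mulmxV ug) -act_mul; exact: act_homog.
Qed.

Lemma pre_form_space d g W : g \in unitmx -> form_space d W -> form_space d (pre g W).
Proof.
move=> ug [hW hom]; split; first exact: pre_submodule.
by move=> F /hom; apply: unit_act_homog.
Qed.

End Ring.

Lemma act_map (R S : comNzRingType) (iR : {rmorphism k -> R}) (iS : {rmorphism k -> S})
    (f : {rmorphism R -> S}) g F : (forall c, f (iR c) = iS c) ->
  map_mpoly f (act iR g F) = act iS g (map_mpoly f F).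
Proof.
move=> e; elim/mpoly_ind_linear: F => [|F G hF hG|c m].
- by rewrite act0 !rmorph0 act0.
- by rewrite actD !rmorphD /= actD hF hG.
rewrite actZ !map_mpolyZ /= actZ map_mpolyX !actXm rmorph_prod; congr (_ *: _).
apply: eq_bigr => i _; rewrite rmorphXn /= rmorph_sum /=; congr (_ ^+ _).
by apply: eq_bigr => j _; rewrite map_mpolyZ /= map_mpolyX e.
Qed.

End Action.

Lemma multinomP n (u v : 'X_{1..n}) :
  (tval (multinom_val u) == tval (multinom_val v)) = (u == v).
Proof. by apply/eqP/eqP => [e|->//]; apply/val_inj/val_inj. Qed.

(** * Deformation by transvections *)

Section Transvection.
Variables (k K : fieldType) (n : nat) (iota : {rmorphism k -> K}).
Variables (i j : 'I_n.+1) (ij : i != j).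

Definition transv (t : k) : 'M[k]_n.+1 := 1%:M + t *: delta_mx i j.

Lemma transvV t : transv t *m transv (- t) = 1%:M.
Proof.
rewrite /transv mulmxDl mul1mx mulmxDr mulmx1 -scalemxAl -scalemxAr mul_delta_mx_0 1?eq_sym //.
by rewrite !scaler0 addr0 scaleNr addrAC -addrA subrr addr0.
Qed.

Definition mvm (m : 'X_{1..n.+1}) l := (m - U_(i) *+ l + U_(j) *+ l)%MM.

Lemma act_transv_X t m : act iota (transv t) 'X_[m] =
  \sum_(l < (m i).+1) ('C(m i, l)%:R * iota t ^+ l) *: 'X_[mvm m l].
Proof.
have lin l : \sum_c iota (transv t l c) *: 'X_c =
    'X_l + (if l == i then iota t *: 'X_j else 0) :> {mpoly K[n.+1]}.
  transitivity (\sum_c ((l == c)%:R *: 'X_c +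
    (if c == j then (if l == i then iota t *: 'X_j else 0) else 0)) : {mpoly K[n.+1]}).
    apply: eq_bigr => c _; rewrite !mxE rmorphD rmorph_nat rmorphM rmorph_nat scalerDl.
    congr (_ + _); case: (l == i); case: eqP => [->|] /=; by rewrite ?mulr1 ?mulr0 ?scale0r.
  rewrite big_split /= -big_mkcond big_pred1_eq; congr (_ + _).
  rewrite (bigD1 l) //= eqxx scale1r big1 ?addr0 // => c cl.
  by rewrite eq_sym (negPf cl) scale0r.
rewrite actXm; under eq_bigr do rewrite lin.
rewrite (bigD1 i) //= eqxx.
have -> : \prod_(l | l != i) ('X_l + (if l == i then iota t *: 'X_j else 0)) ^+ m l =
    'X_[m - U_(i) *+ m i] :> {mpoly K[n.+1]}.
  rewrite [RHS]mpolyXE_id [RHS](bigD1 i) //= mnmBE mulmnE mnm1E eqxx mul1n subnn expr0 mul1r.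
  apply: eq_bigr => l li; rewrite (negPf li) addr0 mnmBE mulmnE mnm1E eq_sym (negPf li).
  by rewrite mul0n subn0.
rewrite exprDn mulr_suml; apply: eq_bigr => l _.
rewrite exprZn -scalerAr !mpolyXn -mpolyXD -scaler_nat scalerA -scalerAl -mpolyXD.
congr (_ *: 'X_[_]); apply/mnmP => c.
have := ltn_ord l; rewrite /mvm !(mnmDE, mnmBE, mulmnE, mnm1E) ltnS => li.
case: eqP => [<-|_]; case: eqP => [|_]; lia.
Qed.

(** The coefficient at v after the substitution of x_i + t x_j for x_i, as a polynomial in t. Its
    linear term, computed in [transv_poly1], is the coefficient of x_j times the derivative along
    x_i. *)
Definition transv_poly (F : {mpoly K[n.+1]}) v : {poly K} :=
  \sum_(m <- msupp F) F@_m *: \sum_(l < (m i).+1) (('C(m i, l) * (mvm m l == v))%:R *: 'X^l).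

Lemma transv_polyE F v t : (transv_poly F v).[iota t] = (act iota (transv t) F)@_v.
Proof.
rewrite /transv_poly horner_sum [in RHS](mpolyE F) act_sum raddf_sum /=.
apply: eq_bigr => m _; rewrite hornerZ actZ mcoeffZ act_transv_X horner_sum raddf_sum /=.
congr (_ * _); apply: eq_bigr => l _.
by rewrite hornerZ hornerXn mcoeffZ mcoeffX natrM mulrAC.
Qed.

Lemma transv_poly0 F v : (transv_poly F v)`_0 = F@_v.
Proof.
rewrite /transv_poly coef_sum [in RHS](mpolyE F) raddf_sum /=; apply: eq_bigr => m _.
rewrite coefZ mcoeffZ coef_sum big_ord_recl /= big1 ?addr0 => [|l _].
  rewrite coefZ coefXn eqxx mulr1 bin0 mul1n mcoeffX; congr (_ * (_ == _)%:R).
  by apply/mnmP => c; rewrite /mvm !(mnmDE, mnmBE, mulmnE, mnm1E); lia.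
by rewrite coefZ coefXn mulr0.
Qed.

Lemma transv_poly1 F v : (transv_poly F v)`_1 =
  \sum_(m <- msupp F) F@_m * ((m i) * (mvm m 1 == v))%:R.
Proof.
rewrite /transv_poly coef_sum; apply: eq_bigr => m _.
rewrite coefZ coef_sum; congr (_ * _); case: (m i) => [|e].
  by rewrite big_ord_recl big_ord0 addr0 coefZ coefXn mulr0 mul0n.
rewrite 2!big_ord_recl /= big1 ?addr0 => [|l _]; last by rewrite coefZ coefXn mulr0.
by rewrite !coefZ !coefXn /= mulr0 add0r mulr1 bin1.
Qed.

End Transvection.

(** A natural number comes from k although p has coefficients in K, so the deformed coordinates
    remain defined over k; it is positive because a row will be divided by it. *)
Lemma nat_nonroot (K : fieldType) (hK : [pchar K] =i pred0) (p : {poly K}) : p != 0 ->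
  exists m : nat, (0 < m)%N /\ p.[m%:R] != 0.
Proof.
move=> p0; apply: contrapT => /forallNP h.
have inj : injective (fun m : nat => m%:R : K).
  move=> a b /eqP; rewrite -subr_eq0.
  wlog ab : a b / (b <= a)%N => [H|].
    case/orP: (leq_total b a) => ab; first exact: H.
    by move=> e; apply/esym/H => //; rewrite -opprB oppr_eq0.
  by rewrite -natrB // ((pcharf0P K).1 hK) => e; apply/eqP; rewrite eqn_leq ab -subn_eq0 e.
have := @max_poly_roots _ p [seq m%:R | m <- iota 1 (size p)] p0.
rewrite size_map size_iota ltnn => H; suff : false by []; apply: H.
  apply/allP => x /mapP[m]; rewrite mem_iota => /andP[m0 _] ->.
  by apply/negPn/negP => nr; apply: (h m).
by rewrite map_inj_uniq ?iota_uniq.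
Qed.

Section Gin.
Variables (k K : fieldType) (n d : nat) (iota : {rmorphism k -> K}).
Hypothesis hk : [pchar k] =i pred0.
Variable W : {mpoly K[n.+1]} -> Prop.
Hypothesis hW : form_space d W.
Implicit Types (T : pred (seq nat)) (u v : 'X_{1..n.+1}).

Definition rank u : nat := count (fun v => (v < u)%O) (mons n d).

(** The quantity minimized over all coordinates and all T: exchanging an element of T for a smaller
    monomial lowers it. *)
Definition weight T : nat := \sum_(u <- cols n d T) rank u.

Lemma rank_lt u v : mdeg u = d -> (u < v)%O -> (rank u < rank v)%N.
Proof.
move=> du uv; rewrite /rank => {}.
have h : (count (fun w => w < u)%O (mons n d) + count (pred1 u) (mons n d) <=
    count (fun w => w < v)%O (mons n d))%N.
  rewrite -count_predUI [X in (_ + X <= _)%N](_ : _ = 0%N) ?addn0.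
    apply: sub_count => w /= /orP[wu|/eqP->//]; exact: Order.POrderTheory.lt_trans wu uv.
  apply/eqP; rewrite -leqn0 leqNgt -has_count -all_predC; apply/allP => w _ /=.
  by apply/negP => /andP[+ /eqP e]; rewrite e Order.POrderTheory.ltxx.
by move: h; rewrite (count_uniq_mem _ (uniq_mons n d)) mem_mons du eqxx addn1.
Qed.

Definition exchange T u v : pred (seq nat) := fun s =>
  (s == tval (multinom_val v)) || (T s && (s != tval (multinom_val u))).

Lemma exchangeE T u v w : exchange T u v (w : 'X_{1..n.+1}) = (w == v) || (T w && (w != u)).
Proof. by rewrite /exchange !multinomP. Qed.

Lemma cols_exchange T u v : mdeg u = d -> mdeg v = d -> T u -> ~~ T v ->
  perm_eq (u :: cols n d (exchange T u v)) (v :: cols n d T).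
Proof.
move=> du dv Tu nTv; apply: uniq_perm.
- by rewrite /= uniq_cols andbT mem_cols exchangeE eqxx andbF orbF; case: (u =P v) => [e|]; rewrite ?andbF //; rewrite -e Tu in nTv.
- by rewrite /= uniq_cols andbT mem_cols (negPf nTv) andbF.
move=> w; rewrite !inE !mem_cols exchangeE.
have [->|wu] := eqVneq w u; first by rewrite du eqxx Tu orbT.
have [->|wv] := eqVneq w v; first by rewrite dv eqxx.
by rewrite andbT.
Qed.

Lemma weight_exchange T u v : mdeg u = d -> mdeg v = d -> T u -> ~~ T v ->
  (rank u + weight (exchange T u v) = rank v + weight T)%N.
Proof.
move=> du dv Tu nTv; have := perm_big (op := addn) (F := rank) (P := predT) _ (cols_exchange du dv Tu nTv).
by move=> /(_ 0%N); rewrite !big_cons.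
Qed.

Lemma graph_exchange T u v F : is_submodule W -> graph_over d T W -> mdeg u = d -> T u -> W F ->
  (forall w, mdeg w = d -> T w -> F@_w = (w == u)%:R) -> mdeg v = d -> ~~ T v ->
  F@_v != 0 -> graph_over d (exchange T u v) W.
Proof.
move=> hW' [h inj] du Tu WF hF dv nTv Fv; split=> [w dw|G WG hG].
  rewrite exchangeE => /orP[/eqP->|/andP[Tw wu]].
    exists ((F@_v)^-1 *: F); first exact: submoduleZ.
    move=> x dx; rewrite exchangeE mcoeffZ => /orP[/eqP->|/andP[Tx xu]].
      by rewrite mulVf // eqxx.
    rewrite (hF x) // (negPf xu) mulr0; case: eqP => // e; by rewrite -e Tx in nTv.
  have [G WG hG] := h w dw Tw; exists (G - (G@_v / F@_v) *: F).
    by apply: submoduleB => //; apply: submoduleZ.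
  move=> x dx; rewrite exchangeE mcoeffB mcoeffZ => /orP[/eqP->|/andP[Tx xu]].
    rewrite divfK // subrr; case: eqP => // e; by rewrite e Tw in nTv.
  by rewrite hG // (hF x) // (negPf xu) mulr0 subr0.
have e : G = G@_u *: F.
  apply/eqP; rewrite -subr_eq0; apply/eqP/inj.
    by apply: submoduleB => //; apply: submoduleZ.
  move=> x dx Tx; rewrite mcoeffB mcoeffZ hF //.
  have [->|xu] := eqVneq x u; first by rewrite mulr1 subrr.
  by rewrite hG ?mulr0 ?subr0 // exchangeE Tx xu orbT.
have := hG v dv; rewrite exchangeE eqxx e mcoeffZ => /(_ isT)/eqP.
by rewrite mulf_eq0 (negPf Fv) orbF => /eqP->; rewrite scale0r.
Qed.

Definition borel_fixed T := forall u (i j : 'I_n.+1), mdeg u = d -> T u -> (i < j)%N ->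
  (0 < u i)%N -> T (u - U_(i) + U_(j))%MM.

(** The initial monomial is the smallest one, in an order that compares forms of one degree by the
    exponent of x_0 before the others. All other monomials thus contain at least as many factors
    x_0, as for the reverse lexicographic order with x_0 last. *)
Definition triangular T (V : {mpoly K[n.+1]} -> Prop) := forall u F, mdeg u = d -> T u -> V F ->
  (forall v, mdeg v = d -> T v -> F@_v = (v == u)%:R) ->
  forall v, F@_v != 0 -> v = u \/ (u < v)%O.

Lemma move_lt u (i j : 'I_n.+1) : (i < j)%N -> (0 < u i)%N ->
  mdeg (u - U_(i) + U_(j)) = mdeg u /\ ((u - U_(i) + U_(j))%MM < u)%O.
Proof.
move=> ij ui; have iu : (U_(i) <= u)%MM by rewrite lep1mP -lt0n.
have du : (mdeg (u - U_(i)) + 1)%N = mdeg u by rewrite -[in RHS](submK iu) mdegD mdeg1.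
have dm : mdeg (u - U_(i) + U_(j)) = mdeg u by rewrite mdegD mdeg1.
split=> //; apply/(ltmcP dm).
exists i => [l li|]; rewrite !(mnmDE, mnmBE, mnm1E).
  case: (i =P l) => [e|_]; first by rewrite e ltnn in li.
  by case: (j =P l) => [e|_]; [have := ltn_trans li ij; rewrite e ltnn | rewrite subn0 addn0].
rewrite eqxx; case: (j =P i) => [e|_]; first by rewrite e ltnn in ij.
by move: ui; case: (u i) => // x _; rewrite addn0 subn1.
Qed.

Lemma mvm1 (i j : 'I_n.+1) m : mvm i j m 1 = (m - U_(i) + U_(j))%MM.
Proof. by []. Qed.

(* If T is not Borel-fixed at u, deforming along x_i -> x_i + t x_j makes the
   minor on the exchanged set nonzero: dividing the row of u by t, it is
   already nonzero at t = 0. *)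
Lemma gin_deform T u (i j : 'I_n.+1) : graph_over d T W -> triangular T W ->
  mdeg u = d -> T u -> (i < j)%N -> (0 < u i)%N -> ~~ T (u - U_(i) + U_(j))%MM ->
  exists2 h : 'M[k]_n.+1, h \in unitmx &
    graph_over d (exchange T u (u - U_(i) + U_(j))%MM) (pre iota h W).
Proof.
move=> g tri du Tu ij ui; have [du' u'u] := move_lt ij ui.
have injM (m : 'X_{1..n.+1}) : (0 < m i)%N ->
    (m - U_(i) + U_(j))%MM = (u - U_(i) + U_(j))%MM -> m = u.
  by move=> mi /addIm eq; rewrite -(@submK _ U_(i)%MM m) ?eq ?submK // lep1mP -lt0n.
have mono (m : 'X_{1..n.+1}) : (0 < m i)%N -> (u < m)%O ->
    ((u - U_(i) + U_(j))%MM < (m - U_(i) + U_(j))%MM)%O.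
  move=> mi um; rewrite ltmc_add2l -(ltmc_add2l _ _ U_(i)) !submK // lep1mP -lt0n //.
set u' := (u - U_(i) + U_(j))%MM in du' u'u injM mono *; move=> nTu'.
have ij' : i != j by apply/eqP => eq; rewrite eq ltnn in ij.
have {}du' : mdeg u' = d by rewrite du'.
set T' := exchange T u u'; have [hWs hom] := hW.
have [E hE] := graph_basis g.
have uu' : u != u' by apply: contraNneq nTu' => <-.
pose e (l : 'I_(size (cols n d T'))) := nth 0%MM (cols n d T') l.
have eT' l : mdeg (e l) = d /\ ((e l == u') || (T (e l) && (e l != u))).
  by have [h1 h2] := nth_cols l; split=> //; rewrite -exchangeE.
have eT l : e l != u' -> T (e l) /\ e l != u.
  by have [_] := eT' l; case: eqP => //= _ /andP[].
have Eu0 l : (E u)@_(e l) = 0.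
  have [el1 el2] := eT' l; have [eu'|/eT[Tel elu]] := eqVneq (e l) u'; last first.
    by rewrite (hE u du Tu).2 // (negPf elu).
  rewrite eu'; apply/eqP/negPn/negP => /(tri u (E u) du Tu (hE u du Tu).1 (hE u du Tu).2).
  by case=> [eq|lt]; [rewrite eq eqxx in uu' | have := Order.POrderTheory.lt_trans lt u'u; rewrite Order.POrderTheory.ltxx].
pose tp (F : {mpoly K[n.+1]}) c := transv_poly i j F (e c).
(* The matrix of the deformed basis on the exchanged set, with the row of u placed at u'. By [Eu0]
   this row vanishes at t = 0, so [drop_poly 1] is an exact division by t. *)
pose MP : 'M[{poly K}]_(size (cols n d T')) := \matrix_(l, c)
  (if e l == u' then drop_poly 1 (tp (E u) c) else tp (E (e l)) c).
have [l' el'] : exists l', e l' = u'.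
  by have [|l' ->] := @cols_nthP n d T' u' du'; [rewrite /T' exchangeE eqxx | exists l'].
have einj l c : e l = e c -> l = c.
  by move/eqP; rewrite nth_uniq ?uniq_cols // => /eqP/val_inj.
have D1 c : (tp (E u) c)`_1 != 0 -> e c = u' \/ (u' < e c)%O.
  rewrite /tp transv_poly1 => h.
  have [m [mi mc cm]] : exists m : 'X_{1..n.+1}, [/\ (0 < m i)%N, (E u)@_m != 0 & mvm i j m 1 = e c].
    apply: contrapT => /forallNP H; case/eqP: h; apply: big1_seq => m /andP[_ mE].
    have [m0|m0] := posnP (m i); first by rewrite m0 mul0n mulr0.
    case: eqP => [eq|]; last by rewrite muln0 mulr0.
    by case: (H m); split=> //; rewrite -mcoeff_msupp.
  case: (tri u (E u) du Tu (hE u du Tu).1 (hE u du Tu).2 m mc) => [mu|um].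
    by left; rewrite -cm mvm1 mu.
  by right; rewrite -cm mvm1; apply: mono.
have det0 : \det MP != 0.
  suff : \det (map_mx (horner_eval 0) MP) != 0.
    by rewrite det_map_mx; apply: contraNneq => ->; rewrite rmorph0.
  apply/negP => /det0P[c c0 hc]; case/eqP: c0.
  have M0 l m : map_mx (horner_eval 0) MP l m =
      if e l == u' then (tp (E u) m)`_1 else (E (e l))@_(e m).
    rewrite !mxE /horner_eval; case: eqP => _; rewrite horner_coef0 ?coef_drop_poly //.
    by rewrite /tp transv_poly0.
  have rel m : c 0 l' * (tp (E u) m)`_1 + \sum_(l | l != l') c 0 l * (E (e l))@_(e m) = 0.
    have : (c *m map_mx (horner_eval 0) MP) 0 m = 0 by rewrite hc mxE.
    rewrite mxE (bigD1 l') //= M0 el' eqxx => h; rewrite -[RHS]h; congr (_ + _).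
    apply: eq_bigr => l ll'; rewrite M0 ifN //; apply: contraNneq ll' => el.
    by apply/eqP/einj; rewrite el el'.
  have ne l : l != l' -> e l != u'.
    by apply: contraNneq => el; apply/eqP/einj; rewrite el el'.
  have relT m : m != l' -> c 0 m = - (c 0 l' * (tp (E u) m)`_1).
    move=> ml; have [Tm mu] := eT m (ne m ml); have [dm _] := eT' m.
    apply/eqP; rewrite -addr_eq0 addrC -[X in _ == X](rel m) (bigD1 m) //=.
    rewrite (hE (e m) dm Tm).2 // eqxx mulr1 big1 ?addr0 // => l /andP[ll lm].
    have [Tl lu] := eT l (ne l ll); have [dl _] := eT' l.
    rewrite (hE (e l) dl Tl).2 //; case: eqP => [eq|]; last by rewrite mulr0.
    by rewrite (einj _ _ eq) eqxx in lm.
  (* In column u' the entry of the row of u is the exponent u i, nonzero in characteristic 0. The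
     other terms vanish: a row l that meets u' has its monomial below u', whereas the linear term of
     the row of u only meets u' and monomials above it. *)
  have cl' : c 0 l' = 0.
    have := rel l'; rewrite big1 ?addr0 => [|l ll].
      move/eqP; rewrite mulf_eq0 => /orP[/eqP//|/eqP h].
      have : (tp (E u) l')`_1 = (u i)%:R.
        rewrite /tp transv_poly1 (bigD1_seq u) ?msupp_uniq //=; last first.
          by rewrite mcoeff_msupp (hE u du Tu).2 // eqxx oner_eq0.
        rewrite (hE u du Tu).2 // eqxx mul1r mvm1 el' -/u' eqxx muln1 big1 ?addr0 // => m mu.
        have [m0|m0] := posnP (m i); first by rewrite m0 mul0n mulr0.
        rewrite mvm1; case: eqP => [/(injM m m0)eq|]; last by rewrite muln0 mulr0.
        by rewrite eq eqxx in mu.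
      rewrite h => /esym/eqP; rewrite -(rmorph_nat iota) fmorph_eq0.
      by rewrite ((pcharf0P k).1 hk) => /eqP ui0; rewrite ui0 in ui.
    rewrite relT // el'; have [Tl lu] := eT l (ne l ll); have [dl _] := eT' l.
    have [->|Fu'] := eqVneq (E (e l))@_u' 0; first by rewrite mulr0.
    case: (tri (e l) (E (e l)) dl Tl (hE _ dl Tl).1 (hE _ dl Tl).2 u' Fu') => [eq|lt].
      by have := ne l ll; rewrite eq eqxx.
    have [->|/D1[eq|gt]] := eqVneq (tp (E u) l)`_1 0; first by rewrite mulr0 oppr0 mul0r.
      by have := ne l ll; rewrite eq eqxx.
    by have := Order.POrderTheory.lt_trans lt gt; rewrite Order.POrderTheory.ltxx.
  apply/matrixP => a m; rewrite ord1 mxE.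
  by have [->//|ml] := eqVneq m l'; rewrite relT // cl' mul0r oppr0.
have hK : [pchar K] =i pred0 by move=> x; rewrite (fmorph_pchar iota).
have [m [m0 hm]] := nat_nonroot hK det0.
have mK : m%:R != 0 :> K by rewrite ((pcharf0P K).1 hK) -lt0n.
pose t : k := m%:R; have it : iota t = m%:R by rewrite rmorph_nat.
have tV : transv i j (- t) *m transv i j t = 1%:M.
  by have := transvV ij' (- t); rewrite opprK.
exists (transv i j (- t)); first by case: (mulmx1_unit tV).
pose Fam (l : 'I_(size (cols n d T'))) : {mpoly K[n.+1]} := if e l == u' then (m%:R)^-1 *: act iota (transv i j t) (E u)
              else act iota (transv i j t) (E (e l)).
have FamW w : mdeg w = d -> T w -> pre iota (transv i j (- t)) W (act iota (transv i j t) (E w)).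
  by move=> dw Tw; rewrite /pre act_mul (transvV ij') act1; case: (hE w dw Tw).
have pW := pre_submodule iota (transv i j (- t)) hWs.
apply: (graph_of_family (T := T') (E := Fam) (e := (\det MP).[m%:R]^-1)).
  have -> : cols_mx d T' Fam = map_mx (horner_eval m%:R) MP.
    apply/matrixP => l c; rewrite !mxE /horner_eval /Fam -/(e c).
    case: eqP => _; last by rewrite /tp -it transv_polyE.
    have tk : take_poly 1 (tp (E u) c) = 0.
      apply/polyP => b; rewrite coef_take_poly coef0; case: b => [|b] //=.
      by rewrite /tp transv_poly0 ?Eu0.
    have := poly_take_drop 1 (tp (E u) c); rewrite tk add0r => /(congr1 (horner^~ m%:R)).
    rewrite hornerM hornerXn expr1 mcoeffZ -(transv_polyE _ ij') it -/(tp (E u) c) => <-.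
    by rewrite mulrC mulfK.
  by rewrite det_map_mx mulfV.
move=> F; split=> [WF|[c ->]]; last first.
  apply: lincomb_in => // l; rewrite /Fam; case: eqP => [_|/eqP/eT[Tl _]].
    by apply: submoduleZ => //; apply: FamW.
  by apply: FamW => //; case: (eT' l).
have -> : F = act iota (transv i j t) (act iota (transv i j (- t)) F).
  by rewrite act_mul tV act1.
rewrite (graph_expand hWs g hE WF) act_sum big_seq.
apply: (submodule_sum (lincomb_submodule Fam)) => w; rewrite mem_cols => /andP[/eqP dw Tw].
rewrite actZ; apply: (submoduleZ (lincomb_submodule Fam)).
have [->|wu] := eqVneq w u.
  exists ((m%:R : K) *: delta_mx 0 l'); rewrite -[RHS]mul1r.
  rewrite mul1r; transitivity ((m%:R : K) *: Fam l').
    by rewrite /Fam el' eqxx scalerA mulfV // scale1r.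
  rewrite -(lincomb_delta Fam l') /lincomb scaler_sumr; apply: eq_bigr => l _.
  by rewrite !mxE scalerA.
have [l wl] : exists l, w = e l.
  by apply: cols_nthP => //; rewrite /T' exchangeE Tw wu orbT.
exists (delta_mx 0 l); rewrite lincomb_delta /Fam -wl ifN //.
by apply: contraNneq nTu' => <-.
Qed.

End Gin.

Lemma pre_pre (k : fieldType) (R : comNzRingType) n (iota : {rmorphism k -> R})
    (g h : 'M[k]_n.+1) (W : {mpoly R[n.+1]} -> Prop) :
  pre iota h (pre iota g W) = pre iota (h *m g) W.
Proof. by apply/funext => F; rewrite /pre act_mul. Qed.

(** Minimality of the weight gives both properties at once. A monomial below the initial one allows
    an exchange in the same coordinates, and a failure of Borel-fixedness allows one after a further
    transvection; either would lower the weight. *)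
Theorem gin (k K : fieldType) n d (iota : {rmorphism k -> K})
    (W : {mpoly K[n.+1]} -> Prop) : [pchar k] =i pred0 -> form_space d W ->
  exists (g : 'M[k]_n.+1) (T : pred (seq nat)),
    [/\ g \in unitmx, graph_over d T (pre iota g W),
        triangular d T (pre iota g W) & borel_fixed n d T].
Proof.
move=> hk hW.
pose Q N := `[< exists (g : 'M[k]_n.+1) (T : pred (seq nat)),
  [/\ g \in unitmx, graph_over d T (pre iota g W) & weight n d T = N] >].
have exQ : exists N, Q N.
  have [T gT] := graph_exists hW; exists (weight n d T); apply/asboolP.
  exists 1%:M, T; split=> //; first exact: unitmx1.
  by have -> : pre iota 1%:M W = W by apply/funext => F; rewrite /pre act1.
case: (ex_minnP exQ) => N /asboolP[g [T [ug gT wT]]] min.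
exists g, T; have hg := pre_form_space iota ug hW.
have tri : triangular d T (pre iota g W).
  move=> u F du Tu WF hF v Fv.
  have [->|vu] := eqVneq v u; [by left | right].
  have dv : mdeg v = d.
    by apply/eqP/negPn/negP => ne; rewrite (dhomog_nemf_coeff (hg.2 F WF) ne) eqxx in Fv.
  have nTv : ~~ T v by apply: contraNN Fv => Tv; rewrite hF // (negPf vu).
  rewrite Order.TotalTheory.ltNge; apply/negP => le.
  have lt : (v < u)%O by rewrite Order.POrderTheory.lt_neqAle vu.
  have := graph_exchange hg.1 gT du Tu WF hF dv nTv Fv.
  move=> gx; have := weight_exchange du dv Tu nTv; have := rank_lt dv lt.
  have : (N <= weight n d (exchange T u v))%N by apply: min; apply/asboolP; exists g, (exchange T u v).
  by rewrite wT; lia.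
split=> // u i j du Tu ij ui; apply/negPn/negP => nT.
have [du' lt] := move_lt ij ui; rewrite du in du'.
have [h uh gh] := gin_deform iota hk hg gT tri du Tu ij ui nT.
rewrite pre_pre in gh.
have := weight_exchange du du' Tu nT; have := rank_lt du' lt.
have : (N <= weight n d (exchange T u (u - U_(i) + U_(j))%MM))%N.
  apply: min; apply/asboolP; exists (h *m g), (exchange T u (u - U_(i) + U_(j))%MM).
  by split=> //; rewrite unitmx_mul uh ug.
by rewrite wT; lia.
Qed.

(** * Regularity over a field *)

Lemma shift_atP s (T : pred (seq nat)) : reflect (exists2 i, (i < size s)%N &
    [/\ forall l, (l < i)%N -> nth 0%N s l = 0%N, (0 < nth 0%N s i)%N &
        T (set_nth 0%N s i (nth 0%N s i).-1)]) (shift T s).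
Proof.
rewrite /shift; elim: s T => [|[|e] u IH] T /=; first by constructor; case.
  apply: (iffP (IH _)) => [[i iu [h1 h2 h3]]|[[|i] iu [h1 h2 h3]]] //.
    by exists i.+1 => //; split=> // -[|l] // /h1.
  by exists i => //; split=> // l li; apply: (h1 l.+1).
apply: (iffP idP) => [Te|[[|i] iu [h1 h2 h3]]] //; first by exists 0%N.
by have := h1 0%N isT.
Qed.

Lemma shift_atE s (T : pred (seq nat)) i : (i < size s)%N -> (forall l, (l < i)%N -> nth 0%N s l = 0%N) ->
  (0 < nth 0%N s i)%N -> shift T s = T (set_nth 0%N s i (nth 0%N s i).-1).
Proof.
rewrite /shift; elim: s T i => [|[|e] u IH] T [|i] //= iu h1 h2.
  by rewrite (IH _ i) // => l li; apply: (h1 l.+1).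
by have := h1 0%N isT.
Qed.

Section ShiftMonomials.
Variable n : nat.
Implicit Types (u v w : 'X_{1..n.+1}) (T : pred (seq nat)).

Lemma tval_nth u (i : 'I_n.+1) : nth 0%N (tval (multinom_val u)) i = u i.
Proof. by rewrite -mnm_nth. Qed.

Lemma set_nth_addU v (i : 'I_n.+1) :
  set_nth 0%N (tval (multinom_val (U_(i) + v)%MM)) i (v i) = tval (multinom_val v).
Proof.
apply: (@eq_from_nth _ 0%N).
  by rewrite size_set_nth !size_tuple; have := ltn_ord i; lia.
move=> l; rewrite size_set_nth size_tuple => ln; rewrite nth_set_nth /=.
have {}ln : (l < n.+1)%N by have := ltn_ord i; lia.
rewrite (tval_nth (U_(i) + v)%MM (Ordinal ln)) mnmDE mnm1E.
rewrite -(inj_eq val_inj) /= eq_sym; case: eqP => [e|_].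
  by rewrite -e tval_nth.
by rewrite add0n -(tval_nth v (Ordinal ln)).
Qed.

Lemma shift_addU T (i : 'I_n.+1) v : (forall l : 'I_n.+1, (l < i)%N -> v l = 0%N) ->
  shift T (U_(i) + v)%MM = T v.
Proof.
move=> h; rewrite (@shift_atE _ _ i) ?size_tuple //.
- by rewrite tval_nth mnmDE mnm1E eqxx /= set_nth_addU.
- move=> l li; have ln : (l < n.+1)%N := ltn_trans li (ltn_ord i).
  rewrite (tval_nth _ (Ordinal ln)) mnmDE mnm1E (h (Ordinal ln)) // addn0.
  by case: eqP => // e; rewrite e ltnn in li.
- by rewrite tval_nth mnmDE mnm1E eqxx.
Qed.

Lemma shift_mnmP T w : shift T w -> exists (i : 'I_n.+1) v,
  [/\ w = (U_(i) + v)%MM, T v & forall l : 'I_n.+1, (l < i)%N -> v l = 0%N].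
Proof.
case/shift_atP => i; rewrite size_tuple => iu [h1 h2 h3].
pose i' := Ordinal iu; exists i', (w - U_(i'))%MM.
have iw : (U_(i') <= w)%MM by rewrite lep1mP -lt0n -tval_nth.
have e : w = (U_(i') + (w - U_(i')))%MM by rewrite addmC submK.
have wi : (w - U_(i'))%MM i' = (nth 0%N w i).-1.
  by rewrite mnmBE mnm1E eqxx -(tval_nth w i') subn1.
split=> //; first by rewrite -(set_nth_addU _ i') -e wi.
move=> l li; rewrite mnmBE mnm1E -(tval_nth w l) h1 //.
Qed.

End ShiftMonomials.

Definition move_unit (s : seq nat) i j :=
  set_nth 0%N (set_nth 0%N s i (nth 0%N s i).-1) j (nth 0%N s j).+1.

Definition seq_borel m d (T : pred (seq nat)) := forall s i j, s \in monos m d -> T s ->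
  (i < j)%N -> (j < m)%N -> (0 < nth 0%N s i)%N -> T (move_unit s i j).

Lemma seq_borelP m d T : seq_borel m d T -> borel m d T.
Proof.
elim: m d T => //= m IH d T H; split=> l ld.
  apply: IH => s i j sm Ts ij jm si.
  have sm' : (d - l)%N :: s \in monos m.+1 d.
    by move: sm; rewrite !mem_monos /= => /andP[/eqP-> /eqP->]; rewrite eqxx subnK // eqxx.
  exact: (H _ i.+1 j.+1 sm' Ts).
move=> u; rewrite mem_monos => /andP[/eqP su /eqP du] /shift_atP[i].
rewrite su => im [h1 h2 h3].
set v := set_nth _ _ _ _ in h3.
have vm : v \in monos m l.
  rewrite mem_monos size_set_nth su (maxn_idPr im) eqxx sumn_set_nth0 du /=.
  by apply/eqP; lia.
have sm' : (d - l)%N :: v \in monos m.+1 d.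
  move: vm; rewrite !mem_monos /= => /andP[/eqP-> /eqP->].
  by rewrite eqxx subnK ?eqxx // ltnW.
have := H _ 0%N i.+1 sm' h3 isT im; rewrite /= subn_gt0 => /(_ ld).
rewrite /move_unit /= nth_set_nth /= eqxx prednK // set_set_nth eqxx.
have -> : set_nth 0%N u i (nth 0%N u i) = u.
  apply: (@eq_from_nth _ 0%N); first by rewrite size_set_nth su (maxn_idPr im).
  by move=> c _; rewrite nth_set_nth /=; case: eqP => [->|].
by rewrite /slice; congr (T (_ :: _)); lia.
Qed.

Lemma borel_fixedP n d (T : pred (seq nat)) : borel_fixed n d T -> borel n.+1 d T.
Proof.
move=> B; apply: seq_borelP => s i j sm Ts ij jn si.
have : s \in [seq tval (multinom_val m) | m <- mons n d] by rewrite (perm_mem (mons_monos n d)).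
case/mapP => u um e; rewrite {}e in sm Ts si *.
have iN := ltn_trans ij jn; pose i' := Ordinal iN; pose j' := Ordinal jn.
have du : mdeg u = d by move: um; rewrite mem_mons => /eqP.
have ui : (0 < u i')%N by rewrite -tval_nth.
have := B u i' j' du Ts ij ui.
suff -> : tval (multinom_val (u - U_(i') + U_(j'))%MM) = move_unit (tval (multinom_val u)) i j by [].
rewrite /move_unit; apply: (@eq_from_nth _ 0%N).
  by rewrite !size_set_nth !size_tuple; lia.
move=> l; rewrite size_tuple => ln.
rewrite (tval_nth _ (Ordinal ln)) mnmDE mnmBE !mnm1E !nth_set_nth /= .
rewrite -!(inj_eq val_inj) /= (tval_nth u j') (tval_nth u i') nth_set_nth /=.
have [e|jl] := eqVneq j l.
  have -> : Ordinal ln = j' by apply: val_inj.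
  by rewrite -e (ltn_eqF ij) subn0 addn1.
rewrite addn0 (eq_sym l i).
have [e|il] := eqVneq i l; last by rewrite subn0 -(tval_nth u (Ordinal ln)).
have -> : Ordinal ln = i' by apply: val_inj.
by rewrite subn1.
Qed.

Section Generated.
Variables (n r : nat) (R : comNzRingType) (K : fieldType) (chi : {rmorphism R -> K}).
Variables (T : pred (seq nat)) (F : 'X_{1..n.+1} -> {mpoly R[n.+1]}).

Definition top (w : 'X_{1..n.+1}) : 'I_n.+1 := odflt ord0 [pick i : 'I_n.+1 | [forall l : 'I_n.+1, (l < i)%N ==> (w l == 0%N)] && (0 < w i)%N].

Lemma topE (i : 'I_n.+1) (v : 'X_{1..n.+1}) :
  (forall l : 'I_n.+1, (l < i)%N -> v l = 0%N) -> top (U_(i) + v)%MM = i.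
Proof.
move=> h; rewrite /top; case: pickP => [j /andP[/forallP jP j0]|/(_ i)] /=.
  apply/val_inj/eqP; rewrite eqn_leq; apply/andP; split; rewrite leqNgt; apply/negP => lt.
    by have /implyP/(_ lt) := jP i; rewrite mnmDE mnm1E eqxx.
  have ne : (i == j) = false by apply/eqP => e; rewrite e ltnn in lt.
  by move: j0; rewrite mnmDE mnm1E h // ne.
move/negbT; rewrite negb_and => /orP[/negP[]|]; last by rewrite mnmDE mnm1E eqxx.
apply/forallP => l; apply/implyP => li; rewrite mnmDE mnm1E h // addn0.
by apply/eqP; case: eqP => // e; rewrite e ltnn in li.
Qed.

(* The products of the F u by monomials in the x_b with b at most the first index
   occurring in u; they are indexed by their initial monomials. *)
Fixpoint multiple j (w : 'X_{1..n.+1}) : {mpoly R[n.+1]} :=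
  if j is j'.+1 then 'X_(top w) * multiple j' (w - U_(top w))%MM else F w.

Lemma multipleS j (i : 'I_n.+1) (v : 'X_{1..n.+1}) : (forall l : 'I_n.+1, (l < i)%N -> v l = 0%N) ->
  multiple j.+1 (U_(i) + v)%MM = 'X_i * multiple j v.
Proof. by move=> h /=; rewrite topE // addmC addmK. Qed.

Lemma mcoeffXM (G : {mpoly R[n.+1]}) (i : 'I_n.+1) (v : 'X_{1..n.+1}) :
  ('X_i * G)@_v = if (0 < v i)%N then G@_(v - U_(i))%MM else 0.
Proof.
case: ifP => [vi|/negbT]; last rewrite -leqNgt leqn0 => /eqP vi.
  have iv : (U_(i) <= v)%MM by rewrite lep1mP -lt0n.
  by rewrite -{1}(submK iv) addmC mulrC mcoeffMX.
apply/eqP; rewrite mcoeff_eq0; apply/negP => /msuppM_le/allpairsP[[m1 m2]] /= [].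
rewrite msuppX inE => /eqP-> _ e; move: vi; rewrite e mnmDE mnm1E eqxx //.
Qed.

Hypothesis F1 : forall u, mdeg u = r -> T u -> chi (F u)@_u = 1.
Hypothesis Ft : forall u v, mdeg u = r -> T u -> chi (F u)@_v <> 0 -> v = u \/ (u < v)%O.

Lemma multiple_initial j w : mdeg w = (r + j)%N -> iter j shift T w ->
  chi (multiple j w)@_w = 1 /\
  forall v, chi (multiple j w)@_v <> 0 -> v = w \/ (w < v)%O.
Proof.
elim: j w => [|j IH] w dw; first by rewrite addn0 in dw => Tw; split; [exact: F1 | move=> v; exact: Ft].
rewrite iterS => /shift_mnmP[i [v [e Tv vi]]]; rewrite {}e in dw *.
have dv : mdeg v = (r + j)%N by move: dw; rewrite mdegD mdeg1; lia.
have [IH1 IH2] := IH v dv Tv; rewrite multipleS //; split.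
  by rewrite mcoeffXM mnmDE mnm1E eqxx /= addmC addmK.
move=> x; rewrite mcoeffXM; case: ifP => [xi|_]; last by rewrite rmorph0.
have ix : (U_(i) <= x)%MM by rewrite lep1mP -lt0n.
case/IH2 => [<-|lt]; first by left; rewrite addmC submK.
by right; rewrite -(submK ix) addmC ltmc_add2l.
Qed.

Definition multiples j (G : {mpoly R[n.+1]}) : Prop :=
  exists c : 'rV_(size (cols n (r + j) (iter j shift T))),
    G = lincomb (fun i => multiple j (nth 0%MM (cols n (r + j) (iter j shift T)) i)) c.

Lemma multiples_submodule j : is_submodule (multiples j).
Proof. exact: lincomb_submodule. Qed.

Lemma multiple_multiples j w : mdeg w = (r + j)%N -> iter j shift T w ->
  multiples j (multiple j w).
Proof.
move=> dw Tw; have [i ->] := @cols_nthP n (r + j) (iter j shift T) w dw Tw.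
by exists (delta_mx 0 i); rewrite lincomb_delta.
Qed.

Lemma multiples_min j (V : {mpoly R[n.+1]} -> Prop) G : is_submodule V ->
  (forall w, mdeg w = (r + j)%N -> iter j shift T w -> V (multiple j w)) ->
  multiples j G -> V G.
Proof.
move=> hV h [c ->]; apply: lincomb_in => // i.
by have [d1 T1] := nth_cols i; apply: h.
Qed.

(** The products [multiple F j w] have w as initial monomial over K, one for each w in the shifted
    set, so they are triangular on it. *)
Lemma graph_multiples j : local_to chi ->
  graph_over (r + j) (iter j shift T) (multiples j).
Proof.
move=> loc; apply: (graph_triangular (chi := chi) (E := multiple j)) => //.
  by move=> u du Tu; case: (multiple_initial du Tu).
by move=> u v du Tu _ _; case: (multiple_initial du Tu) => _; apply.
Qed.

End Generated.

Section Families.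
Variables (n : nat) (R : comNzRingType).
Implicit Types (I : nat -> {mpoly R[n.+1]} -> Prop) (F G : {mpoly R[n.+1]}).

Lemma dhomogP_coeff d F : F \is d.-homog <-> forall v, F@_v != 0 -> mdeg v = d.
Proof.
split=> [hF v Fv|h].
  by apply/eqP/negPn/negP => ne; rewrite (dhomog_nemf_coeff hF ne) eqxx in Fv.
by apply/dhomogP => v; rewrite mcoeff_msupp => /h.
Qed.

Lemma dhomogX_mul d F (i : 'I_n.+1) : F \is d.-homog -> 'X_i * F \is d.+1.-homog.
Proof.
by move=> hF; have := dhomogM (_ : 'X_i \is 1.-homog) hF; apply; rewrite dhomogX /= mdeg1.
Qed.

Record saturated_family I : Prop := SaturatedFamily {
  fam_form : forall d, form_space d (I d);
  fam_mul : forall d i F, I d F -> I d.+1 ('X_i * F);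
  fam_sat : forall d F, F \is d.-homog -> (forall i, I d.+1 ('X_i * F)) -> I d F }.

Lemma mdeg_split (w : 'X_{1..n.+1}) M : mdeg w = M.+1 ->
  exists i v, w = (U_(i) + v)%MM /\ mdeg v = M.
Proof.
move=> dw; have [i wi] : exists i, w i != 0%N.
  apply/existsP; rewrite -negb_forall; apply/negP => /forallP h.
  have : w = 0%MM by apply/mnmP => i; rewrite mnm0E; apply/eqP; exact: h.
  by move=> e; rewrite e mdeg0 in dw.
have iw : (U_(i) <= w)%MM by rewrite lep1mP.
exists i, (w - U_(i))%MM; rewrite addmC submK //; split=> //.
by move: dw; rewrite -{1}(submK iw) mdegD mdeg1; lia.
Qed.

Lemma fam_mulX I d F w M : saturated_family I -> mdeg w = M -> I d F ->
  I (d + M)%N ('X_[w] * F).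
Proof.
move=> hI; elim: M w => [|M IH] w dw IF.
  by move/eqP: dw; rewrite mdeg_eq0 => /eqP ->; rewrite mpolyX0 mul1r addn0.
have [i [v [-> dv]]] := mdeg_split dw.
by rewrite addnS mpolyXD -mulrA; apply: fam_mul => //; apply: IH.
Qed.

Lemma fam_satX I M d F : saturated_family I -> F \is d.-homog ->
  (forall w, mdeg w = M -> I (d + M)%N ('X_[w] * F)) -> I d F.
Proof.
move=> hI; elim: M d F => [|M IH] d F hF h.
  by have := h 0%MM; rewrite mdeg0 mpolyX0 mul1r addn0; apply.
apply: fam_sat => // i; apply: IH; first exact: dhomogX_mul.
move=> w dw; rewrite addSn -addnS mulrA -mpolyXD; apply: h.
by rewrite mdegD mdeg1 dw addn1.
Qed.

Lemma mulX_coeff F w v : ('X_[w] * F)@_(w + v) = F@_v.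
Proof. by rewrite mulrC mcoeffMX. Qed.

Lemma mulX_eq0 F w : 'X_[w] * F = 0 -> F = 0.
Proof. by move=> e; apply/mpolyP => v; rewrite -(mulX_coeff F w) e !mcoeff0. Qed.

Lemma mulX_divide F w : (forall v, F@_v != 0 -> (w <= v)%MM) ->
  exists2 G, F = 'X_[w] * G & forall v, G@_v = F@_(w + v).
Proof.
move=> h; pose G := \sum_(m <- msupp F) F@_m *: 'X_[R, m - w].
have e : F = 'X_[w] * G.
  rewrite {1}[F]mpolyE mulr_sumr; apply: eq_big_seq => m mF.
  rewrite -scalerAr -mpolyXD addmC submK //; apply: h.
  by rewrite -mcoeff_msupp.
by exists G => // v; rewrite e mulX_coeff.
Qed.

(* x_0 is a nonzerodivisor modulo the family where the columns are the shifts
   of one another. *)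
Lemma graph_nzd (W W' : {mpoly R[n.+1]} -> Prop) T d F : is_submodule W -> is_submodule W' ->
  (forall G, W G -> W' ('X_ord0 * G)) -> graph_over d T W ->
  (forall G, W' G -> (forall v, mdeg v = d.+1 -> shift T v -> G@_v = 0) -> G = 0) ->
  W' ('X_ord0 * F) -> W F.
Proof.
move=> hW hW' mul g inj XF; have [G IG h] := graph_reduce F hW g.
suff : F - G = 0 by move/eqP; rewrite subr_eq0 => /eqP->.
apply: (@mulX_eq0 _ U_(ord0)); apply: inj.
  by rewrite mulrBr; apply: submoduleB => //; apply: mul.
move=> v dv Tv; rewrite mcoeffXM; case: ifP => // v0.
have iv : (U_(ord0) <= v)%MM by rewrite lep1mP -lt0n.
apply: h; first by move: dv; rewrite -{1}(submK iv) mdegD mdeg1; lia.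
by rewrite -(@shift_addU _ T ord0) // addmC submK.
Qed.

Lemma pre_saturated (k : fieldType) (iota : {rmorphism k -> R}) g I : g \in unitmx ->
  saturated_family I -> saturated_family (fun d => pre iota g (I d)).
Proof.
move=> ug hI; split=> [d|d i F IF|d F hF h].
- by apply: pre_form_space => //; exact: fam_form.
- rewrite /pre actM actX mulr_suml; apply: (submodule_sum (fam_form hI d.+1).1) => j _.
  rewrite -scalerAl; apply: (submoduleZ (fam_form hI d.+1).1); exact: fam_mul.
- apply: fam_sat => //; first exact: act_homog.
  move=> i; have -> : 'X_i = act iota g (act iota (invmx g) 'X_i).
    by rewrite act_mul mulVmx // act1.
  rewrite -actM actX mulr_suml act_sum; apply: (submodule_sum (fam_form hI d.+1).1) => j _.
  rewrite -scalerAl actZ; apply: (submoduleZ (fam_form hI d.+1).1); exact: h.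
Qed.

Lemma multiple_in I r (T : pred (seq nat)) (F : 'X_{1..n.+1} -> {mpoly R[n.+1]}) :
  (forall d i F, I d F -> I d.+1 ('X_i * F)) ->
  (forall u, mdeg u = r -> T u -> I r (F u)) ->
  forall j w, mdeg w = (r + j)%N -> iter j shift T w -> I (r + j)%N (multiple F j w).
Proof.
move=> hmul hF; elim=> [|j IH] w dw; first by rewrite addn0 in dw *; exact: hF.
rewrite iterS => /shift_mnmP[i [v [e Tv vi]]]; rewrite {}e in dw *.
rewrite multipleS // addnS; apply: hmul; apply: IH => //.
by move: dw; rewrite mdegD mdeg1; lia.
Qed.

End Families.

Lemma pre_quotient_dim (k K : fieldType) n (iota : {rmorphism k -> K}) g d
    (W : {mpoly K[n.+1]} -> Prop) q : g \in unitmx ->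
  quotient_dim d W q -> quotient_dim d (pre iota g W) q.
Proof.
move=> ug [b [bh hb]]; exists (fun i => act iota (invmx g) (b i)); split.
  by move=> i; apply: act_homog.
move=> F hF; have [c [hc uniq]] := hb _ (act_homog iota g hF).
have E (x : 'rV[K]_q) : act iota g (F - \sum_i x 0 i *: act iota (invmx g) (b i)) =
    act iota g F - \sum_i x 0 i *: b i.
  rewrite actB act_sum; congr (_ - _); apply: eq_bigr => i _.
  by rewrite actZ act_mul mulVmx // act1.
exists c; split; first by rewrite /pre E.
by move=> c'; rewrite /pre E; exact: uniq.
Qed.

Lemma truncE n d (T : pred (seq nat)) l (u : 'X_{1..n.+1}) :
  trunc d T l u = T (U_(ord0) *+ (d - l) + u)%MM.
Proof.
have -> : tval (multinom_val (U_(ord0) *+ (d - l) + u)%MM) =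
    (u ord0 + (d - l))%N :: behead (tval (multinom_val u)).
  apply: (@eq_from_nth _ 0%N); first by rewrite size_tuple /= size_behead size_tuple.
  move=> [|i]; rewrite size_tuple => i0.
    rewrite (tval_nth _ (Ordinal i0)) mnmDE mulmnE mnm1E /= mul1n addnC.
    by congr (_ + _)%N; congr (u _); apply: val_inj.
  rewrite (tval_nth _ (Ordinal i0)) mnmDE mulmnE mnm1E /= mul0n.
  by rewrite nth_behead (tval_nth u (Ordinal i0)).
rewrite -(tval_nth u ord0) /trunc; case: u => -[[|e s] //= es].
Qed.

Lemma lt_head n (u v : 'X_{1..n.+1}) : mdeg u = mdeg v -> (u < v)%O -> (u ord0 <= v ord0)%N.
Proof.
move=> e /(ltmcP e)[[[|i] ii]] h1 h2.
  by have -> : ord0 = Ordinal ii by [apply: val_inj]; exact: ltnW.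
by rewrite h1.
Qed.

(** The default value 0 prolongs the sequence without spoiling its monotonicity. *)
Definition gotz (s : seq nat) : nat -> nat := fun i => nth 0%N s i.

(* Gotzmann's regularity and persistence theorems, in generic coordinates. *)
Theorem field_regular (k K : fieldType) n (iota : {rmorphism k -> K})
    (I : nat -> {mpoly K[n.+1]} -> Prop) (a : nat -> nat) r d1 :
  [pchar k] =i pred0 -> noninc a -> saturated_family I ->
  (forall d, (d1 <= d)%N -> quotient_dim d (I d) (gbinom a r d)) ->
  exists (g : 'M[k]_n.+1) (T : pred (seq nat)),
    [/\ g \in unitmx, borel n.+1 r T,
      forall j, colen n.+1 (r + j) (iter j shift T) = gbinom a r (r + j),
      forall j, graph_over (r + j) (iter j shift T) (pre iota g (I (r + j)%N)) &
      triangular r T (pre iota g (I r))].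
Proof.
move=> hk na hI0 codim0; pose d0 := maxn d1 r.
have rd0 : (r <= d0)%N by rewrite leq_maxr.
have [g [T0 [ug g0 tri0 bf]]] := gin iota hk (fam_form hI0 d0).
have B := borel_fixedP bf.
have hI := pre_saturated iota ug hI0.
pose J d := pre iota g (I d).
have codim d : (d0 <= d)%N -> quotient_dim d (J d) (gbinom a r d).
  move=> dd; apply: pre_quotient_dim => //; apply: codim0.
  by apply: leq_trans dd; rewrite leq_maxl.
have sub d : is_submodule (J d) := (fam_form hI d).1.
have size_cols_eq d T T' : colen n.+1 d T = colen n.+1 d T' -> size (cols n d T) = size (cols n d T').
  by move=> e; apply: (@addIn (colen n.+1 d T)); rewrite {2}e !size_cols.
have colenJ d T : (d0 <= d)%N -> graph_over d T (J d) -> colen n.+1 d T = gbinom a r d.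
  move=> dd gT; apply: (@addnI (size (cols n d T))).
  by rewrite size_cols (quotient_dim_graph (fam_form hI d) gT (codim d dd)).
have [E hE] := graph_basis g0.
have F1 u : mdeg u = d0 -> T0 u -> (idfun : {rmorphism K -> K}) (E u)@_u = 1.
  by move=> du Tu; rewrite /= (hE u du Tu).2 // eqxx.
have Ft u v : mdeg u = d0 -> T0 u -> (idfun : {rmorphism K -> K}) (E u)@_v <> 0 -> v = u \/ (u < v)%O.
  by move=> du Tu /eqP; apply: tri0 => //; case: (hE u du Tu).
have gm j := graph_multiples F1 Ft j (@field_local K).
have mJ j G : multiples d0 T0 E j G -> J (d0 + j)%N G.
  apply: multiples_min => // w dw Tw.
  apply: (multiple_in (I := J) (T := T0)) dw Tw; first exact: fam_mul.
  by move=> u du Tu; case: (hE u du Tu).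
have onto j : reads_onto (d0 + j) (iter j shift T0) (J (d0 + j)%N).
  move=> u du Tu; have [F mF hF] := (gm j).1 u du Tu; exists F => //; exact: mJ.
have h0 : colen n.+1 d0 T0 = gbinom a r d0 by apply: colenJ.
(* Macaulay's bound is one inequality. For the other, the products of degree d0 + 1 lie in J, whose
   codimension there is the expected one. *)
have h1 : colen n.+1 d0.+1 (shift T0) = gbinom a r d0.+1.
  apply/eqP; rewrite eqn_leq; apply/andP; split.
    by apply: macaulay => //; rewrite h0.
  have [T' gT'] := graph_exists (fam_form hI d0.+1).
  have := onto 1%N; rewrite addn1 => /(size_reads_onto (sub _)) /(_ gT') /= le.
  have := size_cols n d0.+1 T'; have := size_cols n d0.+1 (shift T0).
  rewrite (colenJ _ T') ?leqnSn //.
  by rewrite /J in le; lia.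
have hj := colen_persist na rd0 B h0 h1.
have gJ j : graph_over (d0 + j) (iter j shift T0) (J (d0 + j)%N).
  have [T' gT'] := graph_exists (fam_form hI (d0 + j)%N).
  apply: (graph_of_size (fam_form hI (d0 + j)%N) (onto j) gT').
  by apply: size_cols_eq; rewrite hj colenJ // leq_addr.
have nzd d F : (d0 <= d)%N -> J d.+1 ('X_ord0 * F) -> J d F.
  move=> dd; rewrite -(subnKC dd); set e := (d - d0)%N.
  apply: (graph_nzd (fam_form hI (d0 + e)%N).1 (fam_form hI (d0 + e).+1).1 (@fam_mul _ _ _ hI _ _) (gJ e)) => G.
  by have := (gJ e.+1).2 G; rewrite addnS.
have nzdX i d F : (d0 <= d)%N -> J (d + i)%N ('X_[U_(ord0) *+ i] * F) -> J d F.
  move=> dd; elim: i => [|i IH]; first by rewrite mulm0n mpolyX0 mul1r addn0.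
  rewrite mulmS mpolyXD addnS -mulrA => /nzd h; apply/IH/h.
  by rewrite (leq_trans dd) ?leq_addr.
(* A form of degree d0 whose initial monomial is divisible by x_0^(d0 - l) is itself divisible by
   this power, by the choice of the order. The quotient lies in J l, because x_0 is not a zero
   divisor from degree d0 on and the family is saturated. *)
have gT l : (l <= d0)%N -> graph_over l (trunc d0 T0 l) (J l).
  move=> ld; set w0 : 'X_{1..n.+1} := (U_(ord0) *+ (d0 - l))%MM.
  have dw0 : mdeg w0 = (d0 - l)%N by rewrite mdegMn mdeg1 mul1n.
  split=> [u du|F JF hF].
    rewrite truncE -/w0 => Tu; have dwu : mdeg (w0 + u) = d0 by rewrite mdegD dw0 du subnK.
    have [JE EE] := hE _ dwu Tu.
    have hd := (dhomogP_coeff d0 _).1 ((fam_form hI d0).2 _ JE).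
    have [|G eG hG] := @mulX_divide _ _ (E (w0 + u)%MM) w0.
      move=> v Ev; have dv := hd v Ev.
      have v0 : ((w0 + u)%MM ord0 <= v ord0)%N.
        by case: (tri0 _ _ dwu Tu JE EE v Ev) => [->//|lt]; apply: lt_head lt; rewrite dwu.
      apply/mnm_lepP => i; rewrite mulmnE mnm1E; case: eqP => [<-|_]; last by rewrite mul0n.
      by apply: leq_trans v0; rewrite mnmDE mulmnE mnm1E eqxx leq_addr.
    have Gh : G \is l.-homog.
      apply/dhomogP_coeff => v; rewrite hG => Ev.
      by have := hd _ Ev; rewrite mdegD dw0; lia.
    exists G => [|v dv]; last first.
      rewrite truncE -/w0 => Tv; rewrite hG EE ?eqm_add2l //.
      by rewrite mdegD dw0 dv subnK.
    apply: (fam_satX (M := d0 - l) hI Gh) => w dw; rewrite subnKC //.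
    apply: (nzdX (d0 - l)%N) => //; rewrite -/w0 mulrCA -eG.
    exact: fam_mulX.
  apply: (@mulX_eq0 _ _ _ w0); apply: g0.2.
    by have := fam_mulX hI dw0 JF; rewrite subnKC.
  move=> v dv Tv; have [wv|wv] := boolP (w0 <= v)%MM.
    rewrite -(submK wv) addmC mulX_coeff; apply: hF.
      by move: dv; rewrite -{1}(submK wv) mdegD dw0; lia.
    by rewrite truncE -/w0 addmC submK.
  apply/eqP; rewrite mcoeff_eq0; apply: contra wv => /msuppM_le/allpairsP[[m1 m2]] /= [].
  by rewrite msuppX inE => /eqP-> _ ->; rewrite lem_addr.
(* The descent reaches degree r because Macaulay's bound for r summands holds from degree r on. *)
have genT j : (r + j <= d0)%N ->
    {in monos n.+1 (r + j), iter j shift (trunc d0 T0 r) =1 trunc d0 T0 (r + j)}.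
  elim: j => [|j IH] rj; first by rewrite addn0.
  rewrite addnS in rj *; move=> s sm; rewrite iterS (eq_in_shift (IH (ltnW rj))) //.
  by apply: (trunc_generated na rd0 B h0 h1) => //; rewrite leq_addr.
have topT : {in monos n.+1 d0, iter (d0 - r) shift (trunc d0 T0 r) =1 T0}.
  have := genT (d0 - r)%N; rewrite subnKC // => /(_ (leqnn _)) h s sm; rewrite h //.
  case: s sm => [|e s]; first by rewrite mem_monos.
  by rewrite /trunc subnn addn0.
have genT' j : {in monos n.+1 (d0 + j), iter (d0 - r + j) shift (trunc d0 T0 r) =1 iter j shift T0}.
  elim: j => [|j IH]; first by rewrite !addn0.
  by rewrite !addnS !iterS; apply: eq_in_shift.
have cases j : (r + j <= d0)%N \/ exists2 i, j = (d0 - r + i)%N & (r + j = d0 + i)%N.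
  have [h|h] := leqP (r + j) d0; [by left | right].
  by exists (r + j - d0)%N; lia.
exists g, (trunc d0 T0 r); split=> //.
- exact: borel_trunc.
- move=> j; case: (cases j) => [h|[i -> e]].
    by rewrite (eq_colen (genT j h)) (colen_trunc na rd0 B h0 h1) ?leq_addr.
  have -> : (r + (d0 - r + i) = d0 + i)%N by lia.
  by rewrite (eq_colen (genT' i)) hj.
- move=> j; case: (cases j) => [h|[i -> e]].
    by apply: eq_pred_graph (gT _ h) => s sm; rewrite genT.
  have -> : (r + (d0 - r + i) = d0 + i)%N by lia.
  by apply: eq_pred_graph (gJ i) => s sm; rewrite genT'.
move=> u F du Tu JF hF v Fv.
pose w0 : 'X_{1..n.+1} := (U_(ord0) *+ (d0 - r))%MM.
have dw0 : mdeg w0 = (d0 - r)%N by rewrite mdegMn mdeg1 mul1n.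
have Twu : T0 (w0 + u)%MM by rewrite -truncE.
have dwu : mdeg (w0 + u) = d0 by rewrite mdegD dw0 du subnK.
have Jw : J d0 ('X_[w0] * F) by have := fam_mulX hI dw0 JF; rewrite subnKC.
have := tri0 (w0 + u)%MM ('X_[w0] * F) dwu Twu Jw _ (w0 + v)%MM.
rewrite mulX_coeff => H; case: H => //.
- move=> w dw Tw; have [wv|wv] := boolP (w0 <= w)%MM.
    rewrite -(submK wv) addmC mulX_coeff eqm_add2l; apply: hF.
      by move: dw; rewrite -{1}(submK wv) mdegD dw0; lia.
    by rewrite truncE -/w0 addmC submK.
  rewrite [X in X = _](_ : _ = 0).
    by case: eqP => // e; rewrite e lem_addr in wv.
  apply/eqP; rewrite mcoeff_eq0; apply: contra wv => /msuppM_le/allpairsP[[m1 m2]] /= [].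
  by rewrite msuppX inE => /eqP-> _ ->; rewrite lem_addr.
- by move=> /addmI ->; left.
- by rewrite ltmc_add2r; right.
Qed.

(** * Flatness and homogenization *)

Lemma minimal_generators (A : comNzRingType) (K : fieldType) (phi : {rmorphism A -> K})
    q (c : 'I_q -> A) :
  (exists2 s, phi s != 0 & forall v, s * c v = 0) \/
  exists2 al : 'I_q -> A, exists v, phi (al v) != 0 &
    forall x : 'I_q -> A, \sum_v x v * c v = 0 -> phi (\sum_v x v * al v) = 0.
Proof.
pose gens (S : {set 'I_q}) := exists s (B : 'I_q -> 'I_q -> A), phi s != 0 /\
  forall v, s * c v = \sum_(i in S) B v i * c i.
have gT : gens setT.
  exists 1, (fun v i => (v == i)%:R); split; first by rewrite rmorph1 oner_neq0.
  move=> v; rewrite mul1r (bigD1 v) ?inE //= eqxx mul1r big1 ?addr0 // => i /andP[_ iv].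
  by rewrite eq_sym (negPf iv) mul0r.
have exN : exists N, `[< exists2 S, gens S & #|S| = N >].
  by exists #|[set: 'I_q]|; apply/asboolP; exists setT.
case: (ex_minnP exN) => N /asboolP[S [s [B [s0 hB]]] cS] min.
have [S0|[i0 iS]] := set_0Vmem S.
  left; exists s => // v; by rewrite hB S0 big_set0.
have drop b (D : 'I_q -> A) : b * c i0 = \sum_(i in S :\ i0) D i * c i -> phi b = 0.
  move=> e; apply/eqP/negPn/negP => b0.
  have : (N <= #|S :\ i0|)%N.
    apply: min; apply/asboolP; exists (S :\ i0) => //.
    exists (s * b), (fun v i => B v i0 * D i + b * B v i); split.
      by rewrite rmorphM mulf_neq0.
    move=> v; have E : b * (s * c v) = \sum_(i in S) b * (B v i * c i).
      by rewrite hB mulr_sumr.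
    rewrite mulrCA mulrA in E; rewrite E (bigD1 i0) //= mulrCA e mulr_sumr.
    rewrite [X in _ + X = _](eq_bigl (mem (S :\ i0))) => [|i]; last by rewrite !inE andbC.
    rewrite -big_split; apply: eq_bigr => i _; rewrite /=; ring.
  by rewrite -cS (cardsD1 i0 S) iS; lia.
right; exists (fun v => B v i0).
  exists i0; apply/negP => /eqP B0.
  have := drop (s - B i0 i0) (B i0); rewrite mulrBl hB (bigD1 i0) //= addrAC subrr add0r.
  rewrite rmorphB B0 subr0 => h; case/eqP: s0; apply: h.
  by apply: eq_bigl => i; rewrite !inE andbC.
move=> x hx; apply: (drop _ (fun i => - \sum_v x v * B v i)).
have : \sum_(i in S) (\sum_v x v * B v i) * c i = 0.
  under eq_bigr do rewrite mulr_suml.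
  rewrite exchange_big /=; transitivity (\sum_v x v * (s * c v)).
    by apply: eq_bigr => v _; rewrite hB mulr_sumr; apply: eq_bigr => i _; rewrite mulrA.
  under eq_bigr do rewrite mulrCA.
  by rewrite -mulr_sumr hx mulr0.
rewrite (bigD1 i0) //= => /eqP; rewrite addr_eq0 => /eqP ->; rewrite -sumrN.
apply: eq_big => [i|i _]; [by rewrite !inE andbC | by rewrite mulNr].
Qed.

(* Flatness is only used through this consequence: a relation with coefficients
   c in M / W persists when c is replaced by any family al that satisfies,
   modulo W', all the relations satisfied by c. *)
Lemma flat_push (A : comNzRingType) (M : lmodType A) (W W' : M -> Prop) q
    (c al : 'I_q -> A) (m : 'I_q -> M) : is_submodule W' ->
  flat_quotient W -> (forall y, W y -> W' y) -> W (\sum_v c v *: m v) ->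
  (forall x : 'I_q -> A, \sum_v x v * c v = 0 -> forall y, W' ((\sum_v x v * al v) *: y)) ->
  W' (\sum_v al v *: m v).
Proof.
move=> hW' flat sub Wc rel.
pose ker (x : 'rV[A]_q) := \sum_v x 0 v * c v = 0.
have hker : is_submodule ker.
  split; rewrite /ker.
  - by rewrite big1 // => v _; rewrite mxE mul0r.
  - move=> x y hx hy; under eq_bigr do rewrite mxE mulrDl.
    by rewrite big_split /= hx hy addr0.
  - move=> a x hx; under eq_bigr do rewrite mxE -mulrA.
    by rewrite -mulr_sumr hx mulr0.
(* N' is the ideal generated by the c v, presented as a quotient of A^q; its inclusion in A is the
   injective map to which flatness is applied. *)
have [N' [pi [surj pi0]]] := quotient_module hker.
have [P [rho [_ rho0]]] := quotient_module hW'.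
have /choice[sec hsec] := surj.
pose ev (x : 'rV[A]_q) : A^o := \sum_v x 0 v * c v.
have evD a x y : ev (a *: x + y) = a * ev x + ev y.
  rewrite /ev mulr_sumr -big_split; apply: eq_bigr => v _.
  by rewrite !mxE mulrDl mulrA.
have evB x y : ev (x - y) = ev x - ev y.
  have -> : x - y = -1 *: y + x by rewrite scaleN1r addrC.
  by rewrite evD mulN1r addrC.
have ev_pi x y : pi x = pi y -> ev x = ev y.
  move=> e; have /pi0 h : pi (x - y) = 0 by rewrite linearB e subrr.
  by apply/eqP; rewrite -subr_eq0 -evB; apply/eqP.
pose f n := ev (sec n).
have f_lin : linear f.
  move=> a x y; rewrite /f -[_ *: ev _]/(a * ev _) -evD; apply: ev_pi.
  by rewrite linearP !hsec.
pose fL := GRing.isLinear.Build A N' A^o _ f f_lin.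
pose fl : {linear N' -> A^o} := HB.pack f fL.
have f_inj : injective fl.
  move=> x y e; rewrite -[x]hsec -[y]hsec; apply/eqP; rewrite -subr_eq0 -linearB.
  apply/eqP/pi0; change (ev (sec x - sec y) = 0); rewrite evB; apply/eqP; rewrite subr_eq0; exact/eqP.
pose lam (x : 'rV[A]_q) := \sum_v x 0 v * al v.
have lamD a x y : lam (a *: x + y) = a * lam x + lam y.
  rewrite /lam mulr_sumr -big_split; apply: eq_bigr => v _.
  by rewrite !mxE mulrDl mulrA.
have lam_pi x z y : pi x = pi z -> rho (lam x *: y) = rho (lam z *: y).
  move=> e; have /pi0 h : pi (x - z) = 0 by rewrite linearB e subrr.
  apply/eqP; rewrite -subr_eq0 -linearB -scalerBl; apply/eqP/rho0.
  have -> : lam x - lam z = lam (x - z).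
    have -> : x - z = -1 *: z + x by rewrite scaleN1r addrC.
    by rewrite lamD mulN1r addrC.
  exact: rel.
(* The bilinear map with value al v y at the class of c v and y. It is independent of the section
   because the al v satisfy the relations of the c v modulo W'. *)
pose b (x : N') (y : M) : P := rho (lam (sec x) *: y).
have hb : bilinear_mod W b.
  split=> [a x y z|a x y z|x y Wy]; rewrite /b.
  - rewrite -linearZ /= scalerA -linearD -scalerDl -lamD; apply: lam_pi.
    by rewrite linearP !hsec.
  - by rewrite scalerDr scalerA mulrC -scalerA linearP.
  - by apply/rho0; apply: submoduleZ => //; exact: sub.
have := flat N' A^o fl f_inj [seq (pi (delta_mx 0 v), m v) | v <- enum 'I_q].
move=> /(_ _)/(_ P b hb) H.
apply/rho0; rewrite -H.
  rewrite big_map big_enum /= linear_sum; apply: eq_bigr => v _.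
  rewrite /b (lam_pi _ (delta_mx 0 v)) ?hsec // /lam (bigD1 v) //= mxE !eqxx mul1r.
  by rewrite big1 ?addr0 // => w wv; rewrite mxE (negPf wv) andbF mul0r.
move=> Q b' [b1 b2 b3]; rewrite -map_comp big_map big_enum /=.
have b20 : b' (1 : A^o) 0 = 0.
  have := b2 0 (1 : A^o) 0 0; rewrite scaler0 addr0 scale0r add0r //.
  by have := b2 (-1) (1 : A^o) 0 0; rewrite scaler0 addr0 scaleN1r addNr.
have b2s (s : seq 'I_q) : \sum_(v <- s) b' (1 : A^o) (c v *: m v) = b' (1 : A^o) (\sum_(v <- s) c v *: m v).
  elim: s => [|v s IH]; first by rewrite !big_nil b20.
  by rewrite !big_cons IH b2 -[c v *: m v]addr0 b2 b20 addr0.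
have b10 y : b' 0 y = 0.
  by have := b1 (-1) (0 : A^o) 0 y; rewrite scaler0 addr0 scaleN1r addNr.
transitivity (\sum_v b' (1 : A^o) (c v *: m v)).
  apply: eq_bigr => v _.
  have -> : f (pi (delta_mx 0 v)) = c v.
    rewrite -[LHS]/(ev (sec _)) (ev_pi _ (delta_mx 0 v)) ?hsec // /ev (bigD1 v) //= mxE !eqxx mul1r.
    by rewrite big1 ?addr0 // => w wv; rewrite mxE (negPf wv) andbF mul0r.
  have := b1 (c v) (1 : A^o) 0 (m v); rewrite b10 !addr0 -[c v *: (1 : A^o)]/(c v * 1) mulr1 => ->.
  by have := b2 (c v) (1 : A^o) (m v) 0; rewrite b20 !addr0.
have := b2s (index_enum 'I_q); rewrite /= => ->; exact: b3.
Qed.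

(** * Homogenization and clearing of denominators *)

Section LinearExtension.
Variables (n : nat) (R : comNzRingType) (V : lmodType R) (h : 'X_{1..n.+1} -> V).

Definition lin_ext (F : {mpoly R[n.+1]}) : V := \sum_(m <- msupp F) F@_m *: h m.

Lemma lin_ext_seq s F : uniq s -> {subset msupp F <= s} ->
  lin_ext F = \sum_(m <- s) F@_m *: h m.
Proof.
move=> us sub; rewrite /lin_ext [RHS](bigID (fun m => m \in msupp F)) /=.
rewrite [X in _ + X]big1 ?addr0 => [|m /memN_msupp_eq0 ->]; last by rewrite scale0r.
rewrite -[RHS]big_filter; apply: perm_big; apply: uniq_perm; rewrite ?msupp_uniq ?filter_uniq //.
by move=> m; rewrite mem_filter; case: (boolP (m \in msupp F)) => // /sub ->.
Qed.

Lemma lin_extD F G : lin_ext (F + G) = lin_ext F + lin_ext G.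
Proof.
pose s := undup (msupp F ++ msupp G).
rewrite !(@lin_ext_seq s) ?undup_uniq // => [|m|m|m].
- by rewrite -big_split; apply: eq_bigr => m _; rewrite mcoeffD scalerDl.
- by rewrite mem_undup mem_cat => ->; rewrite orbT.
- by rewrite mem_undup mem_cat => ->.
- by move=> /msuppD_le; rewrite mem_undup.
Qed.

Lemma lin_extZ c F : lin_ext (c *: F) = c *: lin_ext F.
Proof.
rewrite (@lin_ext_seq (msupp F)) ?msupp_uniq //; last exact: msuppZ_le.
by rewrite /lin_ext scaler_sumr; apply: eq_bigr => m _; rewrite mcoeffZ scalerA.
Qed.

Lemma lin_extX m : lin_ext 'X_[m] = h m.
Proof. by rewrite /lin_ext msuppX big_seq1 mcoeffX eqxx scale1r. Qed.

Lemma lin_ext0 : lin_ext 0 = 0.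
Proof. by have := lin_extZ 0 0; rewrite !scale0r. Qed.

Lemma lin_ext_sum (T : Type) (s : seq T) (P : pred T) (F : T -> {mpoly R[n.+1]}) :
  lin_ext (\sum_(t <- s | P t) F t) = \sum_(t <- s | P t) lin_ext (F t).
Proof.
elim: s => [|t s IH]; first by rewrite !big_nil lin_ext0.
by rewrite !big_cons; case: ifP => // _; rewrite lin_extD IH.
Qed.

End LinearExtension.

Section Homogenize.
Variables (n : nat) (R : comNzRingType) (i : 'I_n.+1).
Implicit Types (F G : {mpoly R[n.+1]}).

(* The form of degree D obtained from F by powers of x_i; the exponents are
   truncated, hence junk, on the monomials of degree more than D. *)
Definition homogenize D F : {mpoly R[n.+1]} :=
  lin_ext (fun m => 'X_[R, m + U_(i) *+ (D - mdeg m)]) F.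

Lemma homogenizeE D F : homogenize D F = \sum_(m <- msupp F) F@_m *: 'X_[m + U_(i) *+ (D - mdeg m)].
Proof. by []. Qed.

Lemma homogenize_mod (J : {mpoly R[n.+1]} -> Prop) D F : is_ideal J -> J ('X_i - 1) ->
  J (F - homogenize D F).
Proof.
move=> hJ h1; rewrite {1}[F]mpolyE homogenizeE -sumrB; apply: ideal_sum => // m _.
rewrite -scalerBr mpolyXD -mpolyXn -{1}['X_[m]]mulr1 -mulrBr -mul_mpolyC.
do 2! apply: idealM => //.
rewrite -opprB; apply: idealN => //.
elim: (D - mdeg m)%N => [|e IH]; first by rewrite expr0 subrr; apply: ideal0.
have -> : 'X_i ^+ e.+1 - 1 = 'X_i * ('X_i ^+ e - 1) + ('X_i - 1) :> {mpoly R[n.+1]}.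
  by rewrite exprS; ring.
by apply: idealD => //; apply: idealM.
Qed.

Lemma homogenize_in (J : {mpoly R[n.+1]} -> Prop) D F : is_ideal J -> J ('X_i - 1) ->
  J (homogenize D F) <-> J F.
Proof.
move=> hJ h1; have h := homogenize_mod D F hJ h1; split=> H.
  by rewrite -(subrK (homogenize D F) F); apply: idealD.
by rewrite -(subKr F (homogenize D F)); apply: idealB.
Qed.

Lemma mdeg_lt_msize F m D : (msize F <= D.+1)%N -> m \in msupp F -> (mdeg m <= D)%N.
Proof. by move=> hF /msize_mdeg_lt h; rewrite -ltnS; apply: leq_trans hF. Qed.

Lemma homogenize_homog D F : (msize F <= D.+1)%N -> homogenize D F \is D.-homog.
Proof.
move=> hF; rewrite homogenizeE big_seq; apply: rpred_sum => m /(mdeg_lt_msize hF) md.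
by apply: rpredZ; rewrite dhomogX /= mdegD mdegMn mdeg1 mul1n subnKC.
Qed.

Lemma homogenize_addn D e F : (msize F <= D.+1)%N ->
  homogenize (D + e) F = 'X_i ^+ e * homogenize D F.
Proof.
move=> hF; rewrite !homogenizeE mulr_sumr; apply: eq_big_seq => m /(mdeg_lt_msize hF) md.
rewrite -scalerAr mpolyXn -mpolyXD; congr (_ *: 'X_[_]); apply/mnmP => c.
have -> : (D + e - mdeg m = e + (D - mdeg m))%N by lia.
by rewrite !(mnmDE, mulmnE) mulnDr addnCA.
Qed.

Lemma homogenize_dhomog d D F : F \is d.-homog -> (d <= D)%N ->
  homogenize D F = 'X_i ^+ (D - d) * F.
Proof.
move=> hF dD; rewrite homogenizeE {3}[F]mpolyE mulr_sumr; apply: eq_big_seq => m mF.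
by rewrite (dhomog_mf hF mF) -scalerAr mpolyXn -mpolyXD addmC.
Qed.

Lemma homogenize_mulX D F w : (msize F <= D.+1)%N ->
  homogenize (D + mdeg w) ('X_[w] * F) = 'X_[w] * homogenize D F.
Proof.
move=> hF; rewrite {1}[F]mpolyE mulr_sumr /homogenize lin_ext_sum mulr_sumr.
apply: eq_big_seq => m /(mdeg_lt_msize hF) md.
rewrite -scalerAr -mpolyXD lin_extZ lin_extX -scalerAr -mpolyXD; congr (_ *: 'X_[_]).
by rewrite mdegD addnC subnDl addmA.
Qed.

End Homogenize.

Lemma map_homogenize n (R S : comNzRingType) (f : {rmorphism R -> S}) (i : 'I_n.+1) D F :
  map_mpoly f (homogenize i D F) = homogenize i D (map_mpoly f F).
Proof.
rewrite homogenizeE rmorph_sum /= /homogenize.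
rewrite (@lin_ext_seq _ _ _ _ (msupp F)) ?msupp_uniq //.
  by apply: eq_bigr => m _; rewrite map_mpolyZ /= map_mpolyX mcoeff_map_mpoly.
move=> m; rewrite !mcoeff_msupp mcoeff_map_mpoly /=; apply: contraNneq => ->.
by rewrite rmorph0.
Qed.

(** The elements that some multiplier psi s brings back to the image of W form a submodule, since
    fractions have denominators in S; this submodule contains the generators. *)
Lemma clear_span n (A R : comNzRingType) (psi : {rmorphism A -> R}) (S : A -> Prop)
    (W : {mpoly A[n.+1]} -> Prop) G :
  S 1 -> (forall x y, S x -> S y -> S (x * y)) ->
  (forall r, exists a s, S s /\ psi s * r = psi a) -> is_submodule W ->
  image_span psi W G -> exists s F, [/\ S s, W F & map_mpoly psi F = psi s *: G].
Proof.
move=> S1 SM frac hW; apply: (span_min (W := fun G => exists s F, [/\ S s, W F & map_mpoly psi F = psi s *: G])).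
  split.
  - exists 1, 0; split=> //; first exact: submodule0.
    by rewrite rmorph0 scaler0.
  - move=> u v [s [F [Ss WF e]]] [t [F' [St WF' e']]]; exists (s * t), (t *: F + s *: F').
    split; first exact: SM.
      by apply: submoduleD => //; apply: submoduleZ.
    by rewrite rmorphD /= !map_mpolyZ /= e e' !scalerA rmorphM scalerDr mulrC.
  - move=> a v [s [F [Ss WF e]]]; have [b [t [St eb]]] := frac a.
    exists (t * s), (b *: F); split; [exact: SM | exact: submoduleZ | ].
    by rewrite map_mpolyZ /= e !scalerA -eb rmorphM mulrAC.
move=> _ [F WF ->]; exists 1, F; split=> //; by rewrite rmorph1 scale1r.
Qed.

Lemma image_spanS n (A R : comNzRingType) (psi : {rmorphism A -> R})
    (W W' : {mpoly A[n.+1]} -> Prop) G : (forall F, W F -> W' F) ->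
  image_span psi W G -> image_span psi W' G.
Proof.
move=> sub; apply: span_min; first exact: span_submodule.
by move=> _ [F WF ->]; apply: sub_span; exists F => //; exact: sub.
Qed.

Lemma image_span_comp n (A B C : comNzRingType) (f : {rmorphism A -> B})
    (g : {rmorphism B -> C}) (W : {mpoly A[n.+1]} -> Prop) (h : {rmorphism A -> C}) :
  (forall a, h a = g (f a)) ->
  same (image_span g (image_span f W)) (image_span h W).
Proof.
move=> hE.
have mapE F : map_mpoly h F = map_mpoly g (map_mpoly f F).
  by apply/mpolyP => m; rewrite !mcoeff_map_mpoly /= hE.
move=> G; split; (apply: span_min; first exact: span_submodule) => _ [F WF ->].
  have hp : is_submodule (fun F => image_span h W (map_mpoly g F)).
    split=> [|F1 F2 h1 h2|a F1 h1].
    - by rewrite rmorph0; apply: submodule0; apply: span_submodule.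
    - by rewrite rmorphD; apply: submoduleD => //; apply: span_submodule.
    - by rewrite map_mpolyZ; apply: submoduleZ => //; apply: span_submodule.
  apply: (span_min hp _ WF) => _ [F' WF' ->].
  by rewrite -mapE; apply: sub_span; exists F'.
rewrite mapE; apply: sub_span; exists (map_mpoly f F) => //.
by apply: sub_span; exists F.
Qed.

Lemma image_span_homog n (A R : comNzRingType) (psi : {rmorphism A -> R}) d
    (W : {mpoly A[n.+1]} -> Prop) : (forall F, W F -> F \is d.-homog) ->
  form_space d (image_span psi W).
Proof.
move=> hom; split; first exact: span_submodule.
have hs : is_submodule (fun F : {mpoly R[n.+1]} => (F \is d.-homog) : Prop).
  split=> [|F G hF hG|a F hF]; [exact: rpred0 | exact: rpredD | exact: rpredZ].
move=> F; apply: (span_min hs) => _ [G WG ->]; apply/dhomogP_coeff => v.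
rewrite mcoeff_map_mpoly /= => h; apply: ((dhomogP_coeff d G).1 (hom G WG)).
by apply: contraNneq h => ->; rewrite rmorph0.
Qed.

Fixpoint gen n (R : comNzRingType) (L : {mpoly R[n.+1]} -> Prop) j :
    {mpoly R[n.+1]} -> Prop :=
  if j is j'.+1 then fun F => exists f : 'I_n.+1 -> {mpoly R[n.+1]},
    (forall i, gen L j' (f i)) /\ F = \sum_i 'X_i * f i
  else L.

Section Gen.
Variables (n : nat) (R : comNzRingType) (L : {mpoly R[n.+1]} -> Prop) (r : nat).
Hypothesis hL : form_space r L.

Lemma gen_form j : form_space (r + j) (gen L j).
Proof.
elim: j => [|j [IH hom]]; first by rewrite addn0.
split; last first.
  move=> _ [f [hf ->]]; rewrite addnS; apply: rpred_sum => i _.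
  by apply: dhomogX_mul; apply: hom; apply: hf.
split=> /=.
- exists (fun _ => 0); split=> [_|]; first exact: (submodule0 IH).
  by rewrite big1 // => i _; rewrite mulr0.
- move=> _ _ [f [hf ->]] [g [hg ->]]; exists (fun i => f i + g i); split.
    by move=> i; apply: submoduleD.
  by rewrite -big_split; apply: eq_bigr => i _; rewrite mulrDr.
- move=> a _ [f [hf ->]]; exists (fun i => a *: f i); split.
    by move=> i; apply: submoduleZ.
  by rewrite scaler_sumr; apply: eq_bigr => i _; rewrite scalerAr.
Qed.

Lemma gen_mul j i F : gen L j F -> gen L j.+1 ('X_i * F).
Proof.
move=> h; exists (fun l => if l == i then F else 0); split.
  by move=> l; case: eqP => // _; apply: submodule0; case: (gen_form j).
rewrite (bigD1 i) //= eqxx big1 ?addr0 // => l /negPf ->.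
by rewrite mulr0.
Qed.

Lemma gen_mulX j M w F : mdeg w = M -> gen L j F -> gen L (j + M)%N ('X_[w] * F).
Proof.
elim: M w => [|M IH] w dw LF.
  by move/eqP: dw; rewrite mdeg_eq0 => /eqP ->; rewrite mpolyX0 mul1r addn0.
have [i [v [-> dv]]] := mdeg_split dw.
by rewrite addnS mpolyXD -mulrA; apply: gen_mul; apply: IH.
Qed.

Lemma gen_min (I : nat -> {mpoly R[n.+1]} -> Prop) j F :
  (forall d, is_submodule (I d)) ->
  (forall d i F, I d F -> I d.+1 ('X_i * F)) ->
  (forall F, L F -> I r F) -> gen L j F -> I (r + j)%N F.
Proof.
move=> hI hmul sub; elim: j F => [|j IH] F; first by rewrite addn0; exact: sub.
move=> [f [hf ->]]; rewrite addnS; apply: submodule_sum => // i _.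
by apply: hmul; apply: IH; apply: hf.
Qed.

End Gen.

Lemma gen_image n (A R : comNzRingType) (psi : {rmorphism A -> R}) r
    (L : {mpoly A[n.+1]} -> Prop) j : form_space r L ->
  same (gen (image_span psi L) j) (image_span psi (gen L j)).
Proof.
move=> hL; have hL' := image_span_homog psi hL.2.
elim: j => [|j IH] F //; split=> [[f [hf ->]]|].
  have hs : is_submodule (image_span psi (gen L j.+1)) by apply: span_submodule.
  apply: (submodule_sum hs) => i _.
  have hp : is_submodule (fun F => image_span psi (gen L j.+1) ('X_i * F)).
    split=> [|F1 F2 h1 h2|a F1 h1].
    - by rewrite mulr0; apply: submodule0.
    - by rewrite mulrDr; apply: submoduleD.
    - by rewrite -scalerAr; apply: submoduleZ.
  have /IH := hf i; apply: (span_min hp) => _ [G LG ->].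
  apply: sub_span; exists ('X_i * G); first exact: gen_mul hL _ _ _ LG.
  by rewrite rmorphM /= map_mpolyX.
apply: span_min; first by case: (gen_form hL' j.+1).
move=> _ [_ [f [hf ->]] ->]; rewrite rmorph_sum; exists (fun i => map_mpoly psi (f i)).
split=> [i|]; first by apply/IH/sub_span; exists (f i) => //; apply: hf.
by apply: eq_bigr => i _; rewrite rmorphM /= map_mpolyX.
Qed.

(** * Points of the Hilbert functor *)

Lemma addU_coeff0 n (R : comNzRingType) (i : 'I_n.+1) (F : {mpoly R[n.+1]}) (v : 'X_{1..n.+1}) :
  v i = 0%N -> ('X_i * F)@_v = 0.
Proof. by move=> vi; rewrite mcoeffXM vi. Qed.

(* Multiplying the element with initial monomial x_0 u by x_1 and reducing
   modulo the family in degree d + 1 shows that x_0 divides it. *)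
Lemma graph_descend n (R : comNzRingType) (I : nat -> {mpoly R[n.+1]} -> Prop)
    (T : pred (seq nat)) d : saturated_family I ->
  graph_over d.+1 (shift T) (I d.+1) -> graph_over d.+2 (shift (shift T)) (I d.+2) ->
  (forall F, I d F -> (forall v, mdeg v = d -> T v -> F@_v = 0) -> F = 0) ->
  graph_over d T (I d).
Proof.
move=> hI g1 g2 inj; split=> // u du Tu.
have sT (v : 'X_{1..n.+1}) S : shift S (U_(ord0) + v)%MM = S v by apply: shift_addU.
have du1 : mdeg (U_(ord0) + u) = d.+1 by rewrite mdegD mdeg1 du.
have Tu1 : shift T (U_(ord0) + u)%MM by rewrite sT.
have [F IF hF] := g1.1 (U_(ord0) + u)%MM du1 Tu1.
suff F0 (v : 'X_{1..n.+1}) : v ord0 = 0%N -> F@_v = 0.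
  have [|G eG hG] := @mulX_divide _ _ F U_(ord0).
    by move=> v Fv; rewrite lep1mP; apply: contraNneq Fv => /F0 ->.
  have Fh := (dhomogP_coeff d.+1 F).1 ((fam_form hI d.+1).2 F IF).
  exists G => [|v dv Tv]; last first.
    by rewrite hG hF ?sT ?eqm_add2l // mdegD mdeg1 dv.
  apply: (fam_sat hI) => [|i].
    apply/dhomogP_coeff => v; rewrite hG => /Fh; rewrite mdegD mdeg1; lia.
  apply: (graph_nzd (fam_form hI d.+1).1 (fam_form hI d.+2).1 (@fam_mul _ _ _ hI _ _) g1 g2.2).
  rewrite mulrCA -eG; exact: fam_mul.
move=> v0; have [/eqP dv|dv] := boolP (mdeg v == d.+1); last first.
  exact: dhomog_nemf_coeff ((fam_form hI d.+1).2 F IF) dv.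
(* With a single variable, a monomial of positive degree contains x_0. *)
case: n => [|n] in I T hI g1 g2 inj u du Tu sT du1 Tu1 F IF hF v v0 dv *.
  by move: dv; rewrite mdegE big_ord_recl big_ord0 v0.
pose i1 : 'I_n.+2 := lift ord0 ord0.
pose F0 := \sum_(m <- msupp F | m ord0 == 0%N) F@_m *: 'X_[R, m].
have F0E w : F0@_w = if w ord0 == 0%N then F@_w else 0.
  rewrite raddf_sum /=; have [wF|wF] := boolP (w \in msupp F).
    rewrite big_mkcond (bigD1_seq w) ?msupp_uniq //= big1 => [|m mw].
      by case: eqP => _; rewrite addr0 // mcoeffZ mcoeffX eqxx mulr1.
    by case: ifP => // _; rewrite mcoeffZ mcoeffX (negPf mw) mulr0.
  rewrite (memN_msupp_eq0 wF) if_same big_seq_cond big1 // => m /andP[mF _].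
  rewrite mcoeffZ mcoeffX; case: eqP => [e|]; last by rewrite mulr0.
  by rewrite e (negPf wF) in mF.
have [|F1 eF1 _] := @mulX_divide _ _ (F - F0) U_(ord0).
  move=> w; rewrite mcoeffB F0E lep1mP; case: (w ord0 =P 0%N) => [_|//].
  by rewrite subrr eqxx.
have [G IG hG] := graph_reduce ('X_i1 * F1) (fam_form hI d.+1).1 g1.
have eH : 'X_i1 * F - 'X_ord0 * G = 'X_i1 * F0 + 'X_ord0 * ('X_i1 * F1 - G).
  by rewrite -[in LHS](subrK F0 F) eF1; ring.
have IH : I d.+2 ('X_i1 * F - 'X_ord0 * G).
  by apply: (submoduleB (fam_form hI d.+2).1); apply: fam_mul.
(* The coefficients on the double shift vanish: for monomials without x_0 because F has no
   coefficient on T-columns other than x_0 u, for the others by the choice of G. So x_1 F = x_0 G,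
   and F has no monomial without x_0. *)
have H0 : 'X_i1 * F - 'X_ord0 * G = 0.
  apply: g2.2 => // w dw Tw; rewrite eH mcoeffD.
  have [w0|w0] := posnP (w ord0).
    rewrite (addU_coeff0 _ w0) addr0 mcoeffXM; case: ifP => // w1.
    have iw : (U_(i1) <= w)%MM by rewrite lep1mP -lt0n.
    have z0 : (w - U_(i1))%MM ord0 = 0%N by rewrite mnmBE w0.
    rewrite F0E z0 eqxx.
    have Tw' : shift T (w - U_(i1))%MM.
      rewrite -(@shift_addU _ _ i1); first by rewrite addmC submK.
      by move=> l; rewrite ltnS leqn0 => /eqP l0; have -> : l = ord0 by apply: val_inj.
    rewrite hF //; last by move: dw; rewrite -{1}(submK iw) mdegD mdeg1; lia.
    case: eqP => // e; move: z0; rewrite e mnmDE mnm1E eqxx //.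
  have iw : (U_(ord0) <= w)%MM by rewrite lep1mP -lt0n.
  have -> : ('X_i1 * F0)@_w = 0.
    rewrite mcoeffXM; case: ifP => // w1; rewrite F0E ifN // mnmBE mnm1E /=.
    by rewrite subn0 -lt0n.
  rewrite add0r mcoeffXM w0 hG //.
    by move: dw; rewrite -{1}(submK iw) mdegD mdeg1; lia.
  by rewrite -sT addmC submK.
have := congr1 (mcoeff (U_(i1) + v)%MM) H0; rewrite eH mcoeffD mcoeff0 mulX_coeff F0E v0 eqxx.
by rewrite addU_coeff0 ?addr0 // mnmDE mnm1E v0.
Qed.

(** * The intermediate condition on spaces of forms *)

Section Good.
Variables (k : fieldType) (n : nat) (a : nat -> nat) (r : nat).

(* After a change of coordinates over k, the ideal generated by L is in each
   degree the graph of a linear map, over monomials determined by T. *)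
Definition good_at (R : comNzRingType) (iota : {rmorphism k -> R})
    (L : {mpoly R[n.+1]} -> Prop) : Prop :=
  exists (g : 'M[k]_n.+1) (T : pred (seq nat)),
    [/\ g \in unitmx,
      forall j, colen n.+1 (r + j) (iter j shift T) = gbinom a r (r + j) &
      forall j, graph_over (r + j) (iter j shift T) (pre iota g (gen L j))].

(** Quantifying over all local A-algebras, and not only over the localizations of A, makes stability
    under base change immediate. *)
Definition good (A : comNzRingType) (iota : {rmorphism k -> A})
    (L : {mpoly A[n.+1]} -> Prop) : Prop :=
  forall (R : comNzRingType) (K : fieldType) (psi : {rmorphism A -> R})
    (chi : {rmorphism R -> K}), local_to chi -> good_at (psi \o iota) (image_span psi L).

Lemma eq_act (R : comNzRingType) (iota iota' : {rmorphism k -> R}) (g : 'M[k]_n.+1) :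
  iota =1 iota' -> act iota g =1 act iota' g.
Proof.
move=> e F; rewrite /act; congr (_ \mPo _); apply: eq_from_tnth => i.
by rewrite !tnth_mktuple; apply: eq_bigr => j _; rewrite e.
Qed.

Lemma gen_ext (R : comNzRingType) (L L' : {mpoly R[n.+1]} -> Prop) j :
  same L L' -> same (gen L j) (gen L' j).
Proof.
move=> e; elim: j => //= j IH F.
by split=> -[f [hf ->]]; exists f; split=> // i; apply/IH.
Qed.

Lemma eq_good_at (R : comNzRingType) (iota iota' : {rmorphism k -> R}) L L' :
  iota =1 iota' -> same L L' -> good_at iota L -> good_at iota' L'.
Proof.
move=> e eL [g [T [ug cT gT]]]; exists g, T; split=> // j.
apply: eq_graph (gT j) => F; rewrite /pre (eq_act g e); exact: gen_ext.
Qed.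

Lemma good_ext (A : comNzRingType) (iota : {rmorphism k -> A}) L L' :
  same L L' -> good iota L -> good iota L'.
Proof.
move=> e gL R K psi chi loc; apply: eq_good_at (gL R K psi chi loc) => //.
by move=> F; split; apply: image_spanS => G /e.
Qed.

Lemma pre_image (R S : comNzRingType) (f : {rmorphism R -> S})
    (iota : {rmorphism k -> R}) (iota' : {rmorphism k -> S}) (g : 'M[k]_n.+1) W :
  (forall c, iota' c = f (iota c)) -> g \in unitmx -> is_submodule W ->
  same (image_span f (pre iota g W)) (pre iota' g (image_span f W)).
Proof.
move=> e ug hW G; split.
  apply: span_min; first exact/pre_submodule/span_submodule.
  move=> _ [F WF ->]; rewrite /pre -(act_map (iR := iota)) //.
  by apply: sub_span; exists (act iota g F).
move=> WG; suff : pre iota' (invmx g) (image_span f (pre iota g W)) (act iota' g G).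
  by rewrite /pre act_mul mulmxV // act1.
have hs := pre_submodule iota' (invmx g) (span_submodule (fun G => exists2 F, pre iota g W F & G = map_mpoly f F)).
apply: (span_min hs _ WG) => _ [F WF ->]; rewrite /pre -(act_map (iR := iota)) //.
apply: sub_span; exists (act iota (invmx g) F) => //.
by rewrite /pre act_mul mulVmx // act1.
Qed.

Lemma good_at_base_change (R S : comNzRingType) (f : {rmorphism R -> S})
    (iota : {rmorphism k -> R}) (iota' : {rmorphism k -> S}) L :
  (forall c, iota' c = f (iota c)) -> form_space r L ->
  good_at iota L -> good_at iota' (image_span f L).
Proof.
move=> e hL [g [T [ug cT gT]]]; exists g, T; split=> // j.
have hj := (gen_form hL j).1.
apply: eq_graph (graph_base_change f (pre_submodule iota g hj) (gT j)) => F.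
split=> [/(pre_image e ug hj)|]; first by move/(gen_image f j hL).
by move/(gen_image f j hL) => h; apply/(pre_image e ug hj).
Qed.

End Good.

Section ChartIdeals.
Variables (n : nat) (R : comNzRingType) (J : chart_ideals R n).
Hypotheses (hJ : forall i, is_ideal (J i)) (hX : forall i, J i ('X_i - 1)).

Lemma chart_divX i e F : J i ('X_i ^+ e * F) -> J i F.
Proof.
elim: e F => [|e IH] F; first by rewrite mul1r.
rewrite exprSr -mulrA => /IH h; have -> : F = 'X_i * F - F * ('X_i - 1) by ring.
by apply: (idealB (hJ i)) => //; apply: (idealM (hJ i)).
Qed.

Lemma sections_saturated : saturated_family (sections J).
Proof.
split=> [d|d i F [hF JF]|d F hF h].
- split; last by move=> F [].
  split=> [|F G [hF JF] [hG JG]|c F [hF JF]]; split.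
  + exact: rpred0.
  + by move=> i; apply: ideal0.
  + exact: rpredD.
  + by move=> i; apply: (idealD (hJ i)).
  + exact: rpredZ.
  + by move=> i; rewrite -mul_mpolyC; apply: (idealM (hJ i)).
- by split; [exact: dhomogX_mul | move=> j; apply: (idealM (hJ j))].
- by split=> // i; apply: (@chart_divX i 1); rewrite expr1; case: (h i).
Qed.

End ChartIdeals.

Lemma image_span_ideal n (A R : comNzRingType) (psi : {rmorphism A -> R})
    (W : {mpoly A[n.+1]} -> Prop) : is_ideal W -> is_ideal (image_span psi W).
Proof.
move=> hW; have hs := span_submodule (fun G => exists2 F, W F & G = map_mpoly psi F).
split=> [|F G h1 h2|H G hG]; [exact: submodule0 | exact: submoduleD |].
elim/mpoly_ind_linear: H => [|F1 F2 h1 h2|c m].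
- by rewrite mul0r; apply: submodule0.
- by rewrite mulrDl; apply: submoduleD.
rewrite -scalerAl; apply: (submoduleZ hs).
have hp : is_submodule (fun G => image_span psi W ('X_[m] * G)).
  split=> [|F1 F2 h1 h2|b F1 h1].
  - by rewrite mulr0; apply: submodule0.
  - by rewrite mulrDr; apply: submoduleD.
  - by rewrite -scalerAr; apply: submoduleZ.
apply: (span_min hp _ hG) => _ [F WF ->]; apply: sub_span; exists ('X_[m] * F).
  exact: idealM.
by rewrite rmorphM /= map_mpolyX.
Qed.

Lemma base_change_image n (A R : comNzRingType) (psi : {rmorphism A -> R})
    (J : chart_ideals A n) i : is_ideal (J i) ->
  same (base_change psi J i) (image_span psi (J i)).
Proof.
move=> hJ G; split.
  apply: ideal_gen_min; first exact: image_span_ideal.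
  by move=> _ [F JF ->]; apply: sub_span; exists F.
have hs : is_submodule (base_change psi J i).
  have hi := ideal_gen_ideal (fun g => exists2 f, J i f & g = map_mpoly psi f).
  split=> [|F1 F2|c F]; [exact: ideal0 | exact: idealD | ].
  by rewrite -mul_mpolyC; apply: idealM.
by apply: (span_min hs) => _ [F JF ->]; apply: sub_ideal_gen; exists F.
Qed.

Lemma base_change_ideal n (A R : comNzRingType) (psi : {rmorphism A -> R})
    (J : chart_ideals A n) i : is_ideal (base_change psi J i).
Proof. exact: ideal_gen_ideal. Qed.

Lemma base_change_dehomog n (A R : comNzRingType) (psi : {rmorphism A -> R})
    (J : chart_ideals A n) i : J i ('X_i - 1) -> base_change psi J i ('X_i - 1).
Proof.
move=> JX; apply: sub_ideal_gen; exists ('X_i - 1) => //.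
by rewrite rmorphB /= map_mpolyX rmorph1.
Qed.

Lemma multiple_factor n (R : comNzRingType) r (T : pred (seq nat))
    (F : 'X_{1..n.+1} -> {mpoly R[n.+1]}) j w :
  mdeg w = (r + j)%N -> iter j shift T w -> exists al u,
    [/\ mdeg al = j, mdeg u = r, T u & multiple F j w = 'X_[al] * F u].
Proof.
elim: j w => [|j IH] w dw.
  by rewrite addn0 in dw => Tw; exists 0%MM, w; split=> //; rewrite ?mdeg0 // mpolyX0 mul1r.
rewrite iterS => /shift_mnmP[i [v [e Tv vi]]]; rewrite {}e in dw *.
have dv : mdeg v = (r + j)%N by move: dw; rewrite mdegD mdeg1; lia.
have [al [u [dal du Tu e]]] := IH v dv Tv; exists (U_(i) + al)%MM, u; split=> //.
  by rewrite mdegD mdeg1 dal.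
by rewrite multipleS // e mulrA mpolyXD.
Qed.

Lemma residue_clear n (A : comNzRingType) (K : fieldType) (phi : {rmorphism A -> K})
    (W : {mpoly A[n.+1]} -> Prop) G : is_residue_field phi -> is_submodule W ->
  image_span phi W G -> exists s F, [/\ phi s != 0, W F & map_mpoly phi F = phi s *: G].
Proof.
move=> hphi hW; apply: (clear_span (S := fun s => phi s != 0)) => //.
- by rewrite rmorph1 oner_neq0.
- by move=> x y; rewrite rmorphM mulf_eq0 negb_or => -> ->.
- move=> z; have [b [s [s0 ->]]] := hphi z; exists b, s; split=> //.
  by rewrite mulrCA mulfV ?mulr1.
Qed.

(** * Sections of a flat family near a point of the base *)

Section HilbertPoint.
Variables (k : fieldType) (n : nat) (A : comNzRingType) (iota : {rmorphism k -> A}).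
Variables (J : chart_ideals A n) (K : fieldType) (phi : {rmorphism A -> K}).
Hypotheses (hJ : is_closed_subscheme J) (flatJ : flat_subscheme J)
  (hphi : is_residue_field phi).

Let JK := base_change phi J.
Let hJi := chart_is_ideal hJ.
Let hX := chart_dehomog hJ.
Let satA := sections_saturated hJi hX.
Let satK : saturated_family (sections JK) :=
  sections_saturated (fun i => base_change_ideal phi J i) (fun i => base_change_dehomog phi (hX i)).

(** A section on D_+(x_i) extends after multiplication by a power of x_i: gluing yields one exponent
    per chart, and their sum serves for all. *)
Lemma glue_section i d F : F \is d.-homog -> J i F ->
  exists e0, forall e, (e0 <= e)%N -> sections J (d + e) ('X_i ^+ e * F).
Proof.
move=> hF JF.
have /choice[m hm] : forall j, exists m, J j ('X_i ^+ m * F).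
  by move=> j; apply/(chart_glue hJ i j hF); exists 0%N; rewrite mul1r.
exists (\sum_j m j)%N => e he; split=> [|j].
  rewrite addnC; apply: dhomogM hF.
  by have := dhomogMn e (_ : 'X_i \is 1.-homog); rewrite mul1n; apply; rewrite dhomogX /= mdeg1.
have mj : (m j <= e)%N by apply: leq_trans he; rewrite (bigD1 j) //= leq_addr.
by rewrite -(subnK mj) exprD -mulrA; apply: (idealM (hJi j)).
Qed.

(** On the chart of x_i the ideal of the fibre is spanned by the image of the ideal of the family,
    so F lifts up to a scalar. The lift is then homogenized and extended by a power of x_i. *)
Lemma lift_section i d F : sections JK d F -> exists e0, forall e, (e0 <= e)%N ->
  image_span phi (sections J (d + e)) ('X_i ^+ e * F).
Proof.
move=> [hF /(_ i)/(base_change_image phi (hJi i))].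
have hsub : is_submodule (J i).
  split=> [|F1 F2|c F1]; [exact: ideal0 | exact: idealD | ].
  by rewrite -mul_mpolyC; apply: idealM.
case/(residue_clear hphi hsub) => s [F' [s0 JF' e]].
pose D := maxn d (msize F'); have dD : (d <= D)%N by rewrite leq_maxl.
have sD : (msize F' <= D.+1)%N by rewrite leqW // leq_maxr.
have JH : J i (homogenize i D F') by apply/homogenize_in.
have [e0 he0] := glue_section (homogenize_homog i sD) JH.
exists (e0 + (D - d))%N => e1 he1.
have {}he0 := he0 (e1 - (D - d))%N ltac:(lia).
have E : (D + (e1 - (D - d)) = d + e1)%N by lia.
rewrite E in he0.
have -> : 'X_i ^+ e1 * F = (phi s)^-1 *: map_mpoly phi ('X_i ^+ (e1 - (D - d)) * homogenize i D F').
  rewrite rmorphM rmorphXn /= map_mpolyX map_homogenize e.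
  rewrite (@homogenize_dhomog _ _ i d D) //; last exact: rpredZ.
  rewrite mulrA -exprD -scalerAr scalerA mulVf // scale1r.
  by congr (_ ^+ _ * _); lia.
apply: (submoduleZ (span_submodule _)); apply: sub_span; by exists ('X_i ^+ (e1 - (D - d)) * homogenize i D F').
Qed.

Lemma image_mulX d m (e : nat) F : mdeg m = e -> image_span phi (sections J d) F ->
  image_span phi (sections J (d + e)) ('X_[m] * F).
Proof.
move=> dm; have hs := span_submodule (fun G => exists2 F, sections J (d + e) F & G = map_mpoly phi F).
have hp : is_submodule (fun F => image_span phi (sections J (d + e)) ('X_[m] * F)).
  split=> [|F1 F2 h1 h2|b F1 h1].
  - by rewrite mulr0; apply: submodule0.
  - by rewrite mulrDr; apply: submoduleD.
  - by rewrite -scalerAr; apply: submoduleZ.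
apply: (span_min hp) => _ [G JG ->]; apply: sub_span; exists ('X_[m] * G).
  exact: fam_mulX.
by rewrite rmorphM /= map_mpolyX.
Qed.

Section Coordinates.
Variables (r : nat) (g : 'M[k]_n.+1) (T : pred (seq nat)).
Let iK : {rmorphism k -> K} := phi \o iota.
Hypotheses (ug : g \in unitmx)
  (gT : forall j, graph_over (r + j) (iter j shift T) (pre iK g (sections JK (r + j))))
  (tri : triangular r T (pre iK g (sections JK r))).

Lemma fiber_multiples : exists E : 'X_{1..n.+1} -> {mpoly K[n.+1]},
  (forall u, mdeg u = r -> T u -> pre iK g (sections JK r) (E u) /\
     forall v, mdeg v = r -> T v -> (E u)@_v = (v == u)%:R) /\
  forall j, same (multiples r T E j) (pre iK g (sections JK (r + j))).
Proof.
have g0 := gT 0; rewrite addn0 in g0.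
have [E hE] := graph_basis g0; exists E; split=> // j.
have hI := pre_saturated iK ug satK.
have F1 u : mdeg u = r -> T u -> (idfun : {rmorphism K -> K}) (E u)@_u = 1.
  by move=> du Tu; rewrite /= (hE u du Tu).2 // eqxx.
have Ft u v : mdeg u = r -> T u -> (idfun : {rmorphism K -> K}) (E u)@_v <> 0 -> v = u \/ (u < v)%O.
  by move=> du Tu /eqP; apply: tri => //; case: (hE u du Tu).
apply: (graph_sub_eq (multiples_submodule _ _ _ _) (graph_multiples F1 Ft j (@field_local K)) (gT j)).
  exact: (fam_form hI (r + j)%N).1.
move=> F; apply: multiples_min; first exact: (fam_form hI (r + j)%N).1.
move=> w dw Tw; apply: (multiple_in (I := fun d => pre iK g (sections JK d)) (T := T)) dw Tw.
  exact: fam_mul.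
by move=> u du Tu; case: (hE u du Tu).
Qed.

(** This takes the place of a vanishing theorem for cohomology. The sections of the fibre are
    combinations of monomials of degree j times finitely many forms of degree r; if j is at least (n
    + 1) e0, each such monomial contains some x_i to the power e0, which lifts any of these
    forms. *)
Lemma lift_all : exists D, forall j, (D <= j)%N -> forall F,
  sections JK (r + j) F -> image_span phi (sections J (r + j)) F.
Proof.
have [E [hE mE]] := fiber_multiples.
have /choice[e he] : forall x : 'X_{1..n.+1} * 'I_n.+1, exists e0, mdeg x.1 = r -> T x.1 ->
    forall e, (e0 <= e)%N -> image_span phi (sections J (r + e)) ('X_x.2 ^+ e * act iK g (E x.1)).
  move=> [u i] /=; have [[du Tu]|N] := pselect (mdeg u = r /\ T u); last by exists 0%N => ? ?; case: N.
  have [e0 h0] := lift_section i (hE u du Tu).1; by exists e0.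
pose e0 := (\sum_(u <- cols n r T) \sum_i e (u, i))%N.
have le0 u i : mdeg u = r -> T u -> (e (u, i) <= e0)%N.
  move=> du Tu; rewrite /e0 (bigD1_seq u) ?uniq_cols ?mem_cols ?du ?eqxx //= (bigD1 i) //=.
  by rewrite -addnA leq_addr.
exists (n.+1 * e0)%N => j hj F JF.
pose Q G := image_span phi (sections J (r + j)) (act iK g G).
suff : Q (act iK (invmx g) F) by rewrite /Q act_mul mulVmx // act1.
have hQ : is_submodule Q := pre_submodule iK g (span_submodule _).
have : pre iK g (sections JK (r + j)) (act iK (invmx g) F) by rewrite /pre act_mul mulVmx // act1.
move/(mE j); apply: (multiples_min hQ) => w dw Tw.
have [al [u [dal du Tu ->]]] := multiple_factor E dw Tw.
have hom : act iK g 'X_[al] \is j.-homog by apply: act_homog; rewrite dhomogX /= dal.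
rewrite /Q actM (mpolyE (act iK g 'X_[al])) mulr_suml big_seq.
apply: (submodule_sum (span_submodule _)) => be beP.
rewrite -scalerAl; apply: (submoduleZ (span_submodule _)).
have dbe : mdeg be = j := dhomog_mf hom beP.
have [i ei] : exists i, (e0 <= be i)%N.
  apply: contrapT => /forallNP h.
  have : (\sum_i be i <= \sum_(i < n.+1) e0)%N.
    by apply: leq_sum => i _; have := h i; lia.
  have [e00|e00] := posnP e0; first by have := h ord0; rewrite e00.
  have lt : (\sum_i be i < \sum_(i < n.+1) e0)%N.
    rewrite [X in (X < _)%N]big_ord_recl [X in (_ < X)%N]big_ord_recl -addSn leq_add //.
      by have := h ord0; lia.
    by apply: leq_sum => i _; have := h (lift ord0 i); lia.
  by move=> _; move: lt; rewrite -mdegE dbe sum_nat_const card_ord; lia.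
have ib : (U_(i) *+ e0 <= be)%MM.
  by apply/mnm_lepP => l; rewrite mulmnE mnm1E; case: eqP => [<-|_]; rewrite ?mul1n.
have db : (e0 + mdeg (be - U_(i) *+ e0) = j)%N.
  by rewrite -dbe -[in RHS](submK ib) mdegD mdegMn mdeg1 mul1n addnC.
rewrite -(submK ib) mpolyXD -mpolyXn -mulrA -db addnA.
apply: image_mulX => //; exact: (he (u, i) du Tu e0 (le0 u i du Tu)).
Qed.

(** If the coefficients of F are not all zero near the point, [minimal_generators] replaces them by
    coefficients al, not all zero in K and subject to the same relations. By flatness the new form
    vanishes on the fibre, and it still has no coefficient on T, which contradicts the graph
    property of the fibre. *)
Lemma flat_unique j F : pre iota g (sections J (r + j)) F ->
  (forall v, mdeg v = (r + j)%N -> iter j shift T v -> F@_v = 0) ->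
  exists2 s, phi s != 0 & s *: F = 0.
Proof.
set d := (r + j)%N; set Tj := iter j shift T => -[hF JF] h0.
have hF' : F \is d.-homog := unit_act_homog ug hF.
pose q := size (mons n d); pose c (v : 'I_q) := F@_(nth 0%MM (mons n d) v).
have FE : F = \sum_v c v *: 'X_[nth 0%MM (mons n d) v].
  rewrite {1}[F]mpolyE -[LHS]/(lin_ext (fun m => 'X_[m]) F) (@lin_ext_seq _ _ _ _ (mons n d)) ?uniq_mons //.
    by rewrite (big_nth 0%MM) big_mkord.
  by move=> m mF; rewrite mem_mons; apply/eqP; apply: (dhomog_mf hF').
have [[s s0 hs]|[al [v0 hv0] rel]] := minimal_generators phi c.
  exists s => //; rewrite FE scaler_sumr big1 // => v _.
  by rewrite scalerA hs scale0r.
exfalso; case/negP: hv0; apply/eqP.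
pose G : {mpoly K[n.+1]} := \sum_v phi (al v) *: 'X_[nth 0%MM (mons n d) v].
have Gc (v : 'I_q) : G@_(nth 0%MM (mons n d) v) = phi (al v).
  rewrite raddf_sum /= (bigD1 v) //= mcoeffZ mcoeffX eqxx mulr1 big1 ?addr0 // => w wv.
  by rewrite mcoeffZ mcoeffX nth_uniq ?uniq_mons // (inj_eq val_inj) (negPf wv) mulr0.
suff G0 : G = 0 by rewrite -Gc G0 mcoeff0.
apply: (gT j).2; last first.
  move=> v dv Tv; have vm : v \in mons n d by rewrite mem_mons dv.
  have vi : (index v (mons n d) < q)%N by rewrite index_mem.
  have -> : v = nth 0%MM (mons n d) (Ordinal vi) by rewrite /= nth_index.
  have pick (f : 'I_q -> A) : \sum_w (w == Ordinal vi)%:R * f w = f (Ordinal vi).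
    rewrite (bigD1 (Ordinal vi)) //= eqxx mul1r big1 ?addr0 // => w wv.
    by rewrite (negPf wv) mul0r.
  rewrite Gc; have := rel (fun w => (w == Ordinal vi)%:R); rewrite !pick; apply.
  by rewrite /c /= nth_index //; apply: h0.
have actG : act iK g G = map_mpoly phi (\sum_v al v *: act iota g 'X_[nth 0%MM (mons n d) v]).
  rewrite rmorph_sum act_sum /=; apply: eq_bigr => v _.
  by rewrite actZ map_mpolyZ /= (act_map (iS := iK)) // map_mpolyX.
split=> [|i].
  apply: act_homog; apply: rpred_sum => v _; apply: rpredZ; rewrite dhomogX /=.
  by rewrite -mem_mons mem_nth.
rewrite actG.
have hi := base_change_ideal phi J i.
apply: (@flat_push A {mpoly A[n.+1]} (J i) (fun y => JK i (map_mpoly phi y)) q c al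
  (fun v => act iota g 'X_[nth 0%MM (mons n d) v])).
- split=> [|y z hy hz|b y hy].
  + by rewrite rmorph0; apply: ideal0.
  + by rewrite rmorphD; apply: idealD.
  + by rewrite map_mpolyZ -mul_mpolyC; apply: idealM.
- exact: flatJ.
- by move=> y Jy; apply: sub_ideal_gen; exists y.
- have := JF i; rewrite FE act_sum; under eq_bigr do rewrite actZ; exact.
- move=> x /rel e y; rewrite map_mpolyZ /= e scale0r; exact: ideal0.
Qed.

End Coordinates.
End HilbertPoint.

Section LocalDenominators.
Variables (A R : comNzRingType) (K : fieldType) (phi : {rmorphism A -> K})
  (psi : {rmorphism A -> R}) (chi : {rmorphism R -> K}).
Hypothesis loc : localizes_at phi psi chi.

Lemma loc_unit s : phi s != 0 -> exists t, psi s * t = 1.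
Proof. by case: loc => e lc _ _ s0; apply: lc; rewrite e. Qed.

Lemma loc_kill (xs : seq A) : (forall x, x \in xs -> psi x = 0) ->
  exists2 t, phi t != 0 & forall x, x \in xs -> t * x = 0.
Proof.
elim: xs => [|x xs IH] h; first by exists 1; rewrite ?rmorph1 ?oner_neq0.
have [|t t0 ht] := IH; first by move=> y yx; apply: h; rewrite inE yx orbT.
case: loc => _ _ _ /(_ x)[/(_ (h x (mem_head _ _)))[s s0 hs] _].
exists (s * t) => [|y]; first by rewrite rmorphM mulf_neq0.
by rewrite inE => /orP[/eqP->|/ht e]; [rewrite mulrAC hs mul0r | rewrite -mulrA e mulr0].
Qed.

Lemma loc_kill_mpoly n (F : {mpoly A[n]}) : map_mpoly psi F = 0 ->
  exists2 t, phi t != 0 & t *: F = 0.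
Proof.
move=> e; have [|t t0 ht] := @loc_kill [seq F@_m | m <- msupp F].
  by move=> x /mapP[m _ ->]; have := congr1 (mcoeff m) e; rewrite mcoeff_map_mpoly mcoeff0.
exists t => //; apply/mpolyP => m; rewrite mcoeffZ mcoeff0.
have [mF|/memN_msupp_eq0 ->] := boolP (m \in msupp F); last by rewrite mulr0.
by apply: ht; apply: map_f.
Qed.

Lemma loc_clear n (W : {mpoly A[n.+1]} -> Prop) G : is_submodule W ->
  image_span psi W G -> exists s F, [/\ phi s != 0, W F & map_mpoly psi F = psi s *: G].
Proof.
move=> hW; apply: (clear_span (S := fun s => phi s != 0)) => //.
- by rewrite rmorph1 oner_neq0.
- by move=> x y; rewrite rmorphM mulf_eq0 negb_or => -> ->.
- by case: loc.
Qed.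

Lemma loc_image n (W : {mpoly A[n.+1]} -> Prop) s F G : phi s != 0 -> W F ->
  map_mpoly psi F = psi s *: G -> image_span psi W G.
Proof.
move=> /loc_unit[t ht] WF e; have -> : G = t *: map_mpoly psi F.
  by rewrite e scalerA mulrC ht scale1r.
by apply: (submoduleZ (span_submodule _)); apply: sub_span; exists F.
Qed.

Lemma loc_eq0 n s (G : {mpoly R[n]}) : phi s != 0 -> psi s *: G = 0 -> G = 0.
Proof.
move=> /loc_unit[t ht] e; have : t *: (psi s *: G) = 0 by rewrite e scaler0.
by rewrite scalerA mulrC ht scale1r.
Qed.

Lemma homog_clear n d (G : {mpoly R[n.+1]}) : G \is d.-homog ->
  exists s (F : {mpoly A[n.+1]}), [/\ phi s != 0, F \is d.-homog & map_mpoly psi F = psi s *: G].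
Proof.
move=> hG; apply: (loc_clear (W := fun F => F \is d.-homog)).
  by split=> [|F1 F2|c F]; [exact: rpred0 | exact: rpredD | exact: rpredZ].
rewrite [G]mpolyE big_seq; apply: (submodule_sum (span_submodule _)) => m mG.
apply: (submoduleZ (span_submodule _)); apply: sub_span; exists 'X_[m].
  by rewrite dhomogX; apply/eqP; apply: (dhomog_mf hG).
by rewrite map_mpolyX.
Qed.

End LocalDenominators.

Lemma image_map n (A B C : comNzRingType) (f : {rmorphism A -> B}) (g : {rmorphism B -> C})
    (h : {rmorphism A -> C}) (W : {mpoly A[n.+1]} -> Prop) (W' : {mpoly C[n.+1]} -> Prop) G :
  (forall a, g (f a) = h a) -> is_submodule W' -> (forall F, W F -> W' (map_mpoly h F)) ->
  image_span f W G -> W' (map_mpoly g G).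
Proof.
move=> e hW' sub; have hp : is_submodule (fun F => W' (map_mpoly g F)).
  split=> [|F1 F2 h1 h2|c F h1].
  - by rewrite rmorph0; apply: submodule0.
  - by rewrite rmorphD; apply: submoduleD.
  - by rewrite map_mpolyZ; apply: submoduleZ.
apply: (span_min hp) => _ [F WF ->].
have -> : map_mpoly g (map_mpoly f F) = map_mpoly h F by apply/mpolyP => m; rewrite !mcoeff_map_mpoly /= e.
exact: sub.
Qed.

Lemma pre_gen_mulX (k : fieldType) n (R : comNzRingType) (iota : {rmorphism k -> R})
    (g : 'M[k]_n.+1) r (L : {mpoly R[n.+1]} -> Prop) al j F : form_space r L -> mdeg al = j ->
  pre iota g L F -> pre iota g (gen L j) ('X_[al] * F).
Proof.
move=> hL dal LF; have hom : act iota g 'X_[al] \is j.-homog.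
  by apply: act_homog; rewrite dhomogX /= dal.
rewrite /pre actM (mpolyE (act iota g 'X_[al])) mulr_suml big_seq.
apply: (submodule_sum (gen_form hL j).1) => be beP.
rewrite -scalerAl; apply: (submoduleZ (gen_form hL j).1).
by have := gen_mulX (j := 0%N) hL (dhomog_mf hom beP) LF; rewrite add0n.
Qed.

Section HilbertLocal.
Variables (k : fieldType) (n : nat) (A : comNzRingType) (iota : {rmorphism k -> A}).
Variables (J : chart_ideals A n) (K : fieldType) (phi : {rmorphism A -> K}).
Variables (R : comNzRingType) (psi : {rmorphism A -> R}) (chi : {rmorphism R -> K}).
Hypotheses (hJ : is_closed_subscheme J) (flatJ : flat_subscheme J)
  (hphi : is_residue_field phi) (loc : localizes_at phi psi chi).
Variables (a : nat -> nat) (r d1 : nat).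
Hypotheses (hk : [pchar k] =i pred0) (na : noninc a)
  (codim : forall d, (d1 <= d)%N -> quotient_dim d (sections (base_change phi J) d) (gbinom a r d)).

Let hJi := chart_is_ideal hJ.
Let hX := chart_dehomog hJ.
Let satA := sections_saturated hJi hX.
Let JK := base_change phi J.
Let satK : saturated_family (sections JK) :=
  sections_saturated (fun i => base_change_ideal phi J i) (fun i => base_change_dehomog phi (hX i)).
Let IR d := image_span psi (sections J d).

(** Saturation at a form involves one membership for each variable, so that a common denominator
    exists. *)
Lemma local_sections_saturated : saturated_family IR.
Proof.
have form d : form_space d (IR d) by apply: image_span_homog => F [].
split=> // [d i F|d F hF h].
  have hp : is_submodule (fun F => IR d.+1 ('X_i * F)).
    split=> [|F1 F2 h1 h2|b F1 h1].
    - by rewrite mulr0; apply: submodule0 (form d.+1).1.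
    - by rewrite mulrDr; apply: submoduleD (form d.+1).1 _ _ _ _.
    - by rewrite -scalerAr; apply: submoduleZ (form d.+1).1 _ _ _.
  apply: (span_min hp) => _ [G JG ->]; apply: sub_span; exists ('X_i * G).
    exact: fam_mul.
  by rewrite rmorphM /= map_mpolyX.
have [s [F' [s0 hF' e]]] := homog_clear loc hF.
have /choice[b hb] : forall i, exists b, phi b != 0 /\ J i ('X_i * (b *: F')).
  move=> i; have [t [G [t0 [_ JG] eG]]] := loc_clear loc (fam_form satA d.+1).1 (h i).
  have [|c c0 hc] := @loc_kill_mpoly _ _ _ _ _ _ loc n.+1 (t *: ('X_i * F') - s *: G).
    rewrite rmorphB /= !map_mpolyZ /= rmorphM /= map_mpolyX e eG -!scalerAr !scalerA.
    by rewrite mulrC subrr.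
  exists (c * t); split; first by rewrite rmorphM mulf_neq0.
  move/eqP: hc; rewrite scalerBr subr_eq0 !scalerA -scalerAr => /eqP ->.
  by rewrite -mul_mpolyC; apply: (idealM (hJi i)).
pose c := \prod_i b i.
have c0 : phi c != 0.
  by rewrite rmorph_prod; apply/prodf_neq0 => i _; case: (hb i).
apply: (@loc_image _ _ _ _ _ _ loc _ _ (c * s) (c *: F')).
- by rewrite rmorphM mulf_neq0.
- split=> [|i]; first exact: rpredZ.
  apply: (@chart_divX _ _ J hJi hX i 1); rewrite expr1.
  rewrite /c (bigD1 i) //= [b i * _]mulrC -scalerA -scalerAr -mul_mpolyC.
  by apply: (idealM (hJi i)); case: (hb i).
- by rewrite map_mpolyZ /= e scalerA rmorphM.
Qed.

Lemma hilb_good_local :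
  good_at a r (psi \o iota) (IR r) /\ forall j F, IR (r + j) F -> gen (IR r) j F.
Proof.
pose iK : {rmorphism k -> K} := phi \o iota.
pose iR : {rmorphism k -> R} := psi \o iota.
have chiE c : chi (iR c) = iK c by case: loc => e _ _ _; rewrite /= e.
have [g [T [ug bT cT gT tri]]] := field_regular iK hk na satK codim.
have satR := local_sections_saturated.
have uniq j F : pre iR g (IR (r + j)) F ->
    (forall v, mdeg v = (r + j)%N -> iter j shift T v -> F@_v = 0) -> F = 0.
  move=> WF h0.
  have /(pre_image (f := psi) (iota := iota) (iota' := iR) (fun c => erefl) ug (fam_form satA (r + j)%N).1) := WF.
  case/(loc_clear loc (pre_submodule iota g (fam_form satA (r + j)%N).1)) => s [F' [s0 WF' e]].
  have [|t t0 ht] := @loc_kill _ _ _ _ _ _ loc [seq F'@_v | v <- cols n (r + j) (iter j shift T)].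
    move=> x /mapP[v]; rewrite mem_cols => /andP[/eqP dv Tv] ->.
    have := congr1 (mcoeff v) e; rewrite mcoeff_map_mpoly mcoeffZ /= => ->.
    by rewrite h0 // mulr0.
  have [||t' t'0 ht'] := @flat_unique _ _ _ _ _ _ _ flatJ _ _ _ ug gT j (t *: F').
  - by apply: (submoduleZ (pre_submodule iota g (fam_form satA (r + j)%N).1)).
  - move=> v dv Tv; rewrite mcoeffZ; apply: ht; apply/mapP; exists v => //.
    by rewrite mem_cols dv eqxx.
  apply: (@loc_eq0 _ _ _ _ _ _ loc _ (t' * t * s)); first by rewrite !rmorphM !mulf_neq0.
  by rewrite rmorphM -scalerA -e -map_mpolyZ -scalerA ht' rmorph0.
have [D hD] := lift_all hJ hphi ug gT tri.
pose P j := graph_over (r + j) (iter j shift T) (pre iR g (IR (r + j)%N)).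
(* In high degree the basis of the fibre lifts, and its matrix on the columns is the identity over
   K, hence invertible over R. *)
have big j : (D <= j)%N -> P j.
  move=> Dj; split; last by move=> F; apply: uniq.
  have [E hE] := graph_basis (gT j).
  have /choice[E' hE'] : forall u, exists F, mdeg u = (r + j)%N -> iter j shift T u ->
      pre iR g (IR (r + j)%N) F /\ map_mpoly chi F = E u.
    move=> u; have [[du Tu]|N] := pselect (mdeg u = (r + j)%N /\ iter j shift T u); last first.
      by exists 0 => ? ?; case: N.
    have /(hD j Dj)/(residue_clear hphi (fam_form satA (r + j)%N).1)[s [F [s0 JF e]]] := (hE u du Tu).1.
    have [t ht] := loc_unit loc s0.
    exists (t *: act iR (invmx g) (map_mpoly psi F)) => _ _; split.
      rewrite /pre actZ act_mul mulVmx // act1; apply: (submoduleZ (span_submodule _)).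
      by apply: sub_span; exists F.
    rewrite map_mpolyZ /= (act_map (iS := iK)) //.
    have -> : map_mpoly chi (map_mpoly psi F) = map_mpoly phi F.
      by apply/mpolyP => m; rewrite !mcoeff_map_mpoly /=; case: loc => ->.
    rewrite e actZ act_mul mulmxV // act1 scalerA.
    by case: loc => <- _ _ _; rewrite -rmorphM mulrC ht rmorph1 scale1r.
  pose W (F : {mpoly R[n.+1]}) := exists c : 'rV[R]_(size (cols n (r + j) (iter j shift T))),
    F = lincomb (fun i => E' (nth 0%MM (cols n (r + j) (iter j shift T)) i)) c.
  have lcu : local_to chi by case: loc.
  have hW F : W F <-> exists c : 'rV[R]_(size (cols n (r + j) (iter j shift T))),
    F = lincomb (fun i => E' (nth 0%MM (cols n (r + j) (iter j shift T)) i)) c by [].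
  have [|h _] := graph_lift lcu hW.
  - move=> c hc; apply/matrixP => x i; rewrite ord1 mxE.
    have [di Ti] := nth_cols i; have := hc _ di Ti.
    rewrite /lincomb raddf_sum /= (bigD1 i) //= big1 => [|l li].
      by rewrite addr0 mcoeffZ (hE' _ di Ti).2 (hE _ di Ti).2 // eqxx mulr1.
    have [dl Tl] := nth_cols l.
    rewrite mcoeffZ (hE' _ dl Tl).2 (hE _ dl Tl).2 // nth_uniq ?uniq_cols //.
    by rewrite (inj_eq val_inj) eq_sym (negPf li) mulr0.
  move=> u du Tu; have [F [c ->] hF] := h u du Tu.
  exists (lincomb (fun i => E' (nth 0%MM (cols n (r + j) (iter j shift T)) i)) c) => //.
  apply: lincomb_in => [|i]; first exact/pre_submodule/span_submodule.
  by have [di Ti] := nth_cols i; case: (hE' _ di Ti).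
have satg := pre_saturated iR ug satR.
(* Descending induction on pairs of consecutive degrees, as [graph_descend] consumes two of them. *)
have all j : P j.
  have [Dj|jD] := leqP D j; first exact: big.
  suff : P j /\ P j.+1 by case.
  have := ltnW jD; apply: (@down_ind 0 D (fun j => P j /\ P j.+1)) => // [|l _ lD [P1 P2]].
    by split; apply: big => //; exact: leqW.
  split=> //; have P1' : graph_over (r + l).+1 (shift (iter l shift T)) (pre iR g (IR (r + l).+1)).
    by have := P1; rewrite /P addnS.
  have P2' : graph_over (r + l).+2 (shift (shift (iter l shift T))) (pre iR g (IR (r + l).+2)).
    by have := P2; rewrite /P !addnS.
  by apply: (graph_descend satg P1' P2') => F; apply: uniq.
have [E hE] : exists E : 'X_{1..n.+1} -> {mpoly R[n.+1]}, forall u, mdeg u = r -> T u ->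
   pre iR g (IR r) (E u) /\ forall v, mdeg v = r -> T v -> (E u)@_v = (v == u)%:R.
  by apply: graph_basis; have := all 0%N; rewrite /P addn0.
have F1 u : mdeg u = r -> T u -> chi (E u)@_u = 1.
  by move=> du Tu; rewrite (hE u du Tu).2 // eqxx rmorph1.
have Ft u v : mdeg u = r -> T u -> chi (E u)@_v <> 0 -> v = u \/ (u < v)%O.
  move=> du Tu nz; apply: (tri u (map_mpoly chi (E u)) du Tu).
  - rewrite /pre -(act_map (iR := iR)) //.
    apply: (image_map (h := phi)) (hE u du Tu).1; first by case: loc.
      exact: (fam_form satK r).1.
    move=> F [hF JF]; split=> [|i]; last by apply: sub_ideal_gen; exists F.
    have h2 : form_space r (image_span phi (sections J r)) by apply: image_span_homog => ? [].
    by apply: h2.2; apply: sub_span; exists F.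
  - move=> w dw Tw; rewrite mcoeff_map_mpoly /= (hE u du Tu).2 //.
    by rewrite rmorph_nat.
  - by rewrite mcoeff_map_mpoly /=; apply/eqP.
have lc : local_to chi by case: loc.
have formR := fam_form satR r.
have sub1 j F : multiples r T E j F -> pre iR g (gen (IR r) j) F.
  apply: multiples_min; first exact: (pre_submodule iR g (gen_form formR j).1).
  move=> w dw Tw; have [al [u [dal du Tu ->]]] := multiple_factor E dw Tw.
  apply: (pre_gen_mulX formR dal); by case: (hE u du Tu).
have sub2 j F : gen (IR r) j F -> IR (r + j)%N F.
  apply: gen_min => // [d|d i G]; first exact: (fam_form satR d).1.
  exact: (fam_mul satR).
(* The products of the basis in degree r lie in the ideal generated in degree r, and this ideal lies
   in the family. The outer two are graphs over the same set, so all three agree. *)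
have eqm j : same (multiples r T E j) (pre iR g (IR (r + j)%N)).
  apply: (graph_sub_eq (multiples_submodule _ _ _ _) (graph_multiples F1 Ft j lc) (all j)).
    exact: (fam_form satg (r + j)%N).1.
  by move=> F /sub1; apply: sub2.
have eqg j : same (pre iR g (IR (r + j)%N)) (pre iR g (gen (IR r) j)).
  by move=> F; split=> [/eqm/sub1//|]; apply: sub2.
split; last first.
  move=> j F IF; have : pre iR g (IR (r + j)%N) (act iR (invmx g) F).
    by rewrite /pre act_mul mulVmx // act1.
  by move/eqg; rewrite /pre act_mul mulVmx // act1.
exists g, T; split=> // j; apply: eq_graph (all j); exact: eqg.
Qed.

End HilbertLocal.

Lemma binomial_poly_nat a m d i : (d + a = m + i)%N -> (a <= m)%N ->
  (binomial_poly (a%:R - i%:R) a).[d%:R] = ('C(m, a))%:R.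
Proof.
move=> e am; rewrite /binomial_poly hornerZ horner_prod.
have -> : \prod_(j < a) ('X + (a%:R - i%:R - j%:R)%:P).[d%:R] = (m ^_ a)%:R :> rat.
  rewrite ffact_prod [RHS]natr_prod; apply: eq_bigr => j _.
  rewrite hornerD hornerX hornerC natrB; last by have := ltn_ord j; lia.
  by rewrite !addrA -natrD e natrD addrK.
by rewrite -bin_ffact natrM mulrC mulfK // pnatr_eq0 -lt0n fact_gt0.
Qed.

Lemma gotzmann_gbinom P r : gotzmann_number P r -> exists a : nat -> nat,
  noninc a /\ forall d, (r <= d)%N -> P.[d%:R] = (gbinom a r d)%:R.
Proof.
move=> [s [sr ss ->]]; exists (gotz s); split=> [i j ij|d rd].
  rewrite /gotz; have [js|/(nth_default 0%N)->//] := ltnP j (size s).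
  by have := sorted_leq_nth (fun x y z xy yz => leq_trans yz xy) (fun x => leqnn x) 0%N ss i j; apply; rewrite ?inE // (leq_ltn_trans ij).
rewrite /gbinom big_mkord horner_sum natr_sum; apply: eq_bigr => i _.
by have := ltn_ord i; move=> ir; apply: binomial_poly_nat; rewrite /gotz; lia.
Qed.

Lemma hilbert_gbinom (K : fieldType) n (J : chart_ideals K n) P r (a : nat -> nat) :
  (forall d, (r <= d)%N -> P.[d%:R] = (gbinom a r d)%:R) -> hilbert_polynomial J P ->
  exists d1, forall d, (d1 <= d)%N -> quotient_dim d (sections J d) (gbinom a r d).
Proof.
move=> hP [d0 h]; exists (maxn d0 r) => d; rewrite geq_max => /andP[d0d rd].
have [q [Pq hq]] := h d d0d.
by move: Pq; rewrite hP // => /eqP; rewrite eqr_nat => /eqP->.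
Qed.

Lemma loc_member n (A R : comNzRingType) (K : fieldType) (phi : {rmorphism A -> K})
    (psi : {rmorphism A -> R}) (chi : {rmorphism R -> K}) (W : {mpoly A[n.+1]} -> Prop) F :
  localizes_at phi psi chi -> is_submodule W -> image_span psi W (map_mpoly psi F) ->
  exists2 s, phi s != 0 & W (s *: F).
Proof.
move=> loc hW h; have [s [G [s0 WG e]]] := loc_clear loc hW h.
have [|t t0 ht] := @loc_kill_mpoly _ _ _ _ _ _ loc n.+1 (s *: F - G).
  by rewrite rmorphB /= map_mpolyZ /= e subrr.
exists (t * s); first by rewrite rmorphM mulf_neq0.
rewrite -scalerA; move/eqP: ht; rewrite scalerBr subr_eq0 => /eqP->; exact: submoduleZ.
Qed.

(** The c with c F in W form an ideal, and each localization provides such a c outside its prime. *)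
Lemma local_membership n (A : comNzRingType) (W : {mpoly A[n.+1]} -> Prop) F : is_submodule W ->
  (forall (K : fieldType) (phi : {rmorphism A -> K}) (R : comNzRingType)
     (psi : {rmorphism A -> R}) (chi : {rmorphism R -> K}),
     is_residue_field phi -> localizes_at phi psi chi -> image_span psi W (map_mpoly psi F)) ->
  W F.
Proof.
move=> hW h; rewrite -[F]scale1r; apply: (@locally_unit A (fun c => W (c *: F))).
  split=> [|x y h1 h2|b x h1].
  - by rewrite scale0r; apply: submodule0.
  - by rewrite scalerDl; apply: submoduleD.
  - by rewrite -scalerA; apply: submoduleZ.
move=> K phi hphi; have [R [psi [chi loc]]] := localize_at phi.
have [s s0 Ws] := loc_member loc hW (h K phi R psi chi hphi loc); by exists s.
Qed.

Section Hilb.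
Variables (k : fieldType) (n : nat) (A : comNzRingType) (iota : {rmorphism k -> A}).
Variables (P : {poly rat}) (a : nat -> nat) (r : nat).
Hypotheses (hk : [pchar k] =i pred0) (na : noninc a)
  (hP : forall d, (r <= d)%N -> P.[d%:R] = (gbinom a r d)%:R).
Variable J : chart_ideals A n.
Hypothesis hJ : in_Hilb P J.

(** A map from A to a local ring factors through the localization of A at the prime below its closed
    point, where the result is known; the condition then passes along the base change. *)
Lemma hilb_good : good a r iota (sections J r).
Proof.
move=> R' K' psi' chi' loc'; case: hJ => closed flat fib.
have [K [phi [hphi hq]]] := residue_at (ker_prime (chi' \o psi')).
have [R [psi [chi loc]]] := localize_at phi.
have [d1 codim] := hilbert_gbinom hP (fib K phi hphi).
have [gR _] := hilb_good_local iota closed flat hphi loc hk na codim.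
have un s : phi s != 0 -> exists t, psi' s * t = 1.
  by move=> s0; apply: loc'; apply: contraNneq s0 => /hq ->.
have [h hh] : exists h : {rmorphism R -> R'}, forall x, h (psi x) = psi' x.
  apply: ring_lift => [b|x]; case: loc => _ _ l3 l4.
    by have [x [s [/un[t ht] e]]] := l3 b; exists x, s, t.
  move=> /l4[s /un[t ht] e]; have := congr1 psi' e; rewrite rmorphM rmorph0 => e'.
  by rewrite -[psi' x]mul1r -ht mulrAC e' mul0r.
have formS : form_space r (image_span psi (sections J r)) by apply: image_span_homog => ? [].
apply: eq_good_at (good_at_base_change (f := h) (iota' := psi' \o iota) _ formS gR) => //.
- by apply: image_span_comp => x; rewrite hh.
- by move=> c; rewrite /= hh.
Qed.

Lemma sections_gen j F : sections J (r + j) F <-> gen (sections J r) j F.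
Proof.
case: hJ => closed flat fib.
have sat := sections_saturated (chart_is_ideal closed) (chart_dehomog closed).
split; last first.
  by apply: gen_min => // [d|d i G]; [exact: (fam_form sat d).1 | exact: fam_mul].
move=> JF; apply: (local_membership (gen_form (fam_form sat r) j).1) => K phi R psi chi hphi loc.
have [d1 codim] := hilbert_gbinom hP (fib K phi hphi).
have [_ gR] := hilb_good_local iota closed flat hphi loc hk na codim.
apply/(gen_image psi j (fam_form sat r)); apply: gR; apply: sub_span; by exists F.
Qed.

End Hilb.

(** * The subscheme defined by a space of forms *)

Lemma dhomog_msize n (R : comNzRingType) d (F : {mpoly R[n]}) : F \is d.-homog ->
  (msize F <= d.+1)%N.
Proof. by move=> hF; rewrite msizeE; apply/bigmax_leqP_seq => m mF _; rewrite (dhomog_mf hF mF). Qed.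

Lemma exprX_homog n (R : comNzRingType) (i : 'I_n) e d (F : {mpoly R[n]}) : F \is d.-homog ->
  'X_i ^+ e * F \is (e + d).-homog.
Proof.
by move=> hF; rewrite mpolyXn; apply: dhomogM hF; rewrite dhomogX /= mdegMn mdeg1 mul1n.
Qed.

Lemma expX_mnm n (R : comNzRingType) (i : 'I_n.+1) e (F : {mpoly R[n.+1]}) :
  'X_i ^+ e * F = 'X_[U_(i) *+ e] * F.
Proof. by rewrite mpolyXn. Qed.

Section SubschemeOf.
Variables (n r : nat) (R : comNzRingType) (L : {mpoly R[n.+1]} -> Prop).
Hypothesis hL : form_space r L.

(** The ideal generated by L, dehomogenized at x_i = 1. Asking for all large degrees D avoids the
    junk values of [homogenize] in low degrees and makes stability under sums immediate. *)
Definition subscheme_of : chart_ideals R n := fun i f =>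
  exists D0, forall D, (D0 <= D)%N -> gen L D (homogenize i (r + D) f).

Lemma gen_expX i e D F : gen L D F -> gen L (D + e) ('X_i ^+ e * F).
Proof. by rewrite expX_mnm; apply: (gen_mulX hL); rewrite mdegMn mdeg1 mul1n. Qed.

Lemma subscheme_ofP i f D : (msize f <= (r + D).+1)%N ->
  gen L D (homogenize i (r + D) f) -> subscheme_of i f.
Proof.
move=> sf h; exists D => D' DD'; rewrite -(subnKC DD') addnA homogenize_addn //.
exact: gen_expX.
Qed.

Lemma subscheme_of_homog i f d D : f \is d.-homog -> (d <= r + D)%N ->
  gen L D ('X_i ^+ (r + D - d) * f) -> subscheme_of i f.
Proof.
move=> hf dD h; apply: (@subscheme_ofP i f D).
  by apply: leq_trans (dhomog_msize hf) _.
by rewrite (homogenize_dhomog i hf dD).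
Qed.

Lemma subscheme_of_gen i j F : gen L j F -> subscheme_of i F.
Proof.
move=> LF; apply: (@subscheme_of_homog i F (r + j) j); rewrite ?subnn ?mul1r //.
exact: (gen_form hL j).2.
Qed.

Lemma subscheme_of_ideal i : is_ideal (subscheme_of i).
Proof.
have hs D := (gen_form hL D).1; split.
- by exists 0%N => D _; rewrite /homogenize lin_ext0; apply: submodule0.
- move=> f g [D1 h1] [D2 h2]; exists (maxn D1 D2) => D; rewrite geq_max => /andP[l1 l2].
  by rewrite /homogenize lin_extD; apply: (submoduleD (hs D)); [apply: h1 | apply: h2].
move=> h f [D0 hf]; elim/mpoly_ind_linear: h => [|h1 h2 [D1 e1] [D2 e2]|c m].
- by exists 0%N => D _; rewrite mul0r /homogenize lin_ext0; apply: submodule0.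
- exists (maxn D1 D2) => D; rewrite geq_max => /andP[l1 l2].
  by rewrite mulrDl /homogenize lin_extD; apply: (submoduleD (hs D)); [apply: e1 | apply: e2].
pose D1 := maxn D0 (msize f); exists (D1 + mdeg m)%N => D lD.
rewrite -scalerAl /homogenize lin_extZ; apply: (submoduleZ (hs D)).
have e : D = (D - mdeg m + mdeg m)%N by lia.
rewrite -[lin_ext _ _]/(homogenize i (r + D) ('X_[m] * f)) e addnA homogenize_mulX; last by rewrite /D1 in lD *; lia.
by apply: (gen_mulX hL) => //; apply: hf; rewrite /D1 in lD *; lia.
Qed.

Lemma subscheme_of_dehomog i : subscheme_of i ('X_i - 1).
Proof.
exists 1%N => D lD; suff -> : homogenize i (r + D) ('X_i - 1) = 0 :> {mpoly R[n.+1]}.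
  exact: submodule0 (gen_form hL D).1.
have -> : 'X_i - 1 = 'X_i + (-1) *: 'X_[0%MM] :> {mpoly R[n.+1]} by rewrite mpolyX0 scaleN1r.
rewrite /homogenize lin_extD lin_extZ !lin_extX scaleN1r mdeg1 mdeg0 subn0 add0m.
have -> : (U_(i) + U_(i) *+ (r + D - 1) = U_(i) *+ (r + D))%MM.
  by rewrite -mulmS; congr (_ *+ _)%MM; lia.
by rewrite subrr.
Qed.

Lemma subscheme_of_closed : is_closed_subscheme subscheme_of.
Proof.
split; [exact: subscheme_of_ideal | exact: subscheme_of_dehomog |].
have glue i j d f : f \is d.-homog -> (exists m, subscheme_of i ('X_j ^+ m * f)) ->
    exists m, subscheme_of j ('X_i ^+ m * f).
  move=> hf [m [D0 h]]; pose D := (D0 + m + d)%N.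
  have := h D; rewrite (homogenize_dhomog i (exprX_homog j m hf)); last by lia.
  move=> /(_ ltac:(lia)) hD; exists (r + D - (m + d))%N.
  apply: (@subscheme_of_homog j _ (r + D - (m + d) + d) D); first exact: exprX_homog.
    by lia.
  have -> : (r + D - (r + D - (m + d) + d) = m)%N by lia.
  by rewrite mulrCA.
by move=> i j d f hf; split; exact: (glue _ _ _ _ hf).
Qed.

Lemma sections_gen_sub j F : gen L j F -> sections subscheme_of (r + j) F.
Proof. by move=> LF; split=> [|i]; [exact: (gen_form hL j).2 | exact: subscheme_of_gen LF]. Qed.

End SubschemeOf.

Lemma subscheme_of_ext n r (R : comNzRingType) (L L' : {mpoly R[n.+1]} -> Prop) :
  same L L' -> same_subscheme (subscheme_of r L) (subscheme_of r L').
Proof.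
by move=> e i f; split=> -[D0 h]; exists D0 => D /h; [apply: (gen_ext D e _).1 | apply: (gen_ext D e _).2].
Qed.

Lemma base_change_subscheme_of n r (A B : comNzRingType) (phi : {rmorphism A -> B})
    (L : {mpoly A[n.+1]} -> Prop) : form_space r L ->
  same_subscheme (base_change phi (subscheme_of r L)) (subscheme_of r (image_span phi L)).
Proof.
move=> hL i g; have hL' : form_space r (image_span phi L) by apply: image_span_homog; case: hL.
split.
  apply: ideal_gen_min; first exact: subscheme_of_ideal.
  move=> _ [f [D0 hf] ->]; exists D0 => D /hf h; rewrite -map_homogenize.
  by apply/(gen_image phi D hL); apply: sub_span; exists (homogenize i (r + D) f).
move=> [D0 h]; pose D := (D0 + msize g)%N.
have hi := base_change_ideal phi (subscheme_of r L) i.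
have hX := base_change_dehomog phi (subscheme_of_dehomog hL i).
apply/(homogenize_in (r + D) g hi hX).
have := h D (leq_addr _ _) => /(gen_image phi D hL).
apply: span_min.
  split=> [|F1 F2|c F]; [exact: ideal0 | exact: idealD | rewrite -mul_mpolyC; exact: idealM].
by move=> _ [F LF ->]; apply: sub_ideal_gen; exists F => //; apply: subscheme_of_gen LF.
Qed.

Lemma subscheme_of_sections n r (A : comNzRingType) (J : chart_ideals A n) :
  is_closed_subscheme J -> (forall j F, sections J (r + j) F <-> gen (sections J r) j F) ->
  same_subscheme J (subscheme_of r (sections J r)).
Proof.
move=> hJ hS i f; have hJi := chart_is_ideal hJ i; have hX := chart_dehomog hJ i.
split=> [Jf|[D0 h]].
  pose D := msize f; have sf : (msize f <= (r + D).+1)%N by rewrite /D; lia.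
  have JH : J i (homogenize i (r + D) f) by apply/homogenize_in.
  have [e0 he] := glue_section hJ (homogenize_homog i sf) JH.
  have sat := sections_saturated (chart_is_ideal hJ) (chart_dehomog hJ).
  apply: (subscheme_ofP (fam_form sat r) (D := D + e0)); first by lia.
  by apply/hS; rewrite addnA homogenize_addn //; apply: he.
have [_ /(_ i)] := (hS D0 _).2 (h D0 (leqnn _)).
by move/(homogenize_in (r + D0) f hJi hX).
Qed.

Section GoodSections.
Variables (k : fieldType) (n : nat) (a : nat -> nat) (r : nat).

Lemma good_at_nzd (R : comNzRingType) (iota : {rmorphism k -> R}) L
    (g : 'M[k]_n.+1) (T : pred (seq nat)) : form_space r L -> g \in unitmx ->
  (forall j, graph_over (r + j) (iter j shift T) (pre iota g (gen L j))) ->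
  forall j M G, pre iota g (gen L (j + M)) ('X_[U_(ord0) *+ M] * G) -> pre iota g (gen L j) G.
Proof.
move=> hL ug gT j M; have hs i := pre_submodule iota g (gen_form hL i).1.
elim: M => [|M IH] G; first by rewrite addn0 mulm0n mpolyX0 mul1r.
rewrite mulmS mpolyXD -mulrA addnS => h; apply: IH.
apply: (graph_nzd (hs (j + M)%N) (hs (j + M).+1) _ (gT (j + M)%N)) h => [G'|G'].
  rewrite /pre actM actX mulr_suml => h; apply: (submodule_sum (gen_form hL (j + M).+1).1) => i _.
  by rewrite -scalerAl; apply: (submoduleZ (gen_form hL (j + M).+1).1); apply: (gen_mul hL).
by have := (gT (j + M).+1).2 G'; rewrite addnS.
Qed.

(** The ideal generated by L is saturated from degree r on. A section is brought into the ideal by a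
    power of each x_i, hence by all monomials of some degree N, hence by the N-th power of x_0 in
    the good coordinates of a local ring; and there x_0 is not a zero divisor. *)
Lemma sections_subscheme_of (A : comNzRingType) (iota : {rmorphism k -> A})
    (L : {mpoly A[n.+1]} -> Prop) j F :
  form_space r L -> good a r iota L ->
  sections (subscheme_of r L) (r + j) F <-> gen L j F.
Proof.
move=> hL gL; split; last exact: sections_gen_sub.
move=> [hF JF]; apply: (local_membership (gen_form hL j).1) => K phi R psi chi hphi loc.
have loc' : local_to chi by case: loc.
have [g [T [ug _ gT]]] := gL R K psi chi loc'.
have hL' : form_space r (image_span psi L) by apply: image_span_homog; case: hL.
apply/(gen_image psi j hL); pose iR : {rmorphism k -> R} := psi \o iota.
have /choice[e he] : forall i, exists e, forall e', (e <= e')%N -> gen L (j + e') ('X_i ^+ e' * F).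
  move=> i; have [D0 h] := JF i; exists (D0 - j)%N => e' he'.
  have := h (j + e')%N ltac:(lia); rewrite (homogenize_dhomog i hF); last by lia.
  by rewrite addnA addKn.
pose M := (\sum_i e i)%N.
(* By the pigeonhole principle some exponent w i is at least e i, as M is the sum of the e i. *)
have hM w : mdeg w = (M + M * n.+1)%N -> gen L (j + mdeg w) ('X_[w] * F).
  move=> dw; have [i iw] : exists i, (e i <= w i)%N.
    apply/existsP; rewrite -[[exists _, _]]negbK negb_exists; apply/negP => /forallP h.
    have : (mdeg w <= M)%N.
      by rewrite mdegE /M; apply: leq_sum => i _; have := h i; rewrite -ltnNge => /ltnW.
    rewrite dw; case: (posnP M) => [M0|]; last by lia.
    have := h ord0; move: M0; rewrite /M => /eqP; rewrite sum_nat_eq0 => /forallP/(_ ord0)/eqP -> //.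
  have iw' : (U_(i) *+ e i <= w)%MM.
    by apply/mnm_lepP => l; rewrite mulmnE mnm1E; case: eqP => [<-|_]; rewrite ?mul0n ?mul1n.
  have := submK iw'; set w' := (w - _)%MM => <-.
  rewrite mpolyXD -mulrA mdegD mdegMn mdeg1 mul1n [(mdeg w' + _)%N]addnC addnA.
  by apply: (gen_mulX hL) => //; rewrite -expX_mnm; apply: he.
pose N := (M + M * n.+1)%N.
suff : pre iR g (gen (image_span psi L) j) (act iR (invmx g) (map_mpoly psi F)).
  by rewrite /pre act_mul mulVmx // act1.
apply: (good_at_nzd hL' ug gT (M := N)).
rewrite /pre actM act_mul mulVmx // act1.
have hom : act iR g 'X_[R, U_(ord0) *+ N] \is N.-homog.
  by apply: act_homog; rewrite dhomogX /= mdegMn mdeg1 mul1n.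
rewrite (mpolyE (act iR g _)) mulr_suml big_seq.
apply: (submodule_sum (gen_form hL' _).1) => w wP.
rewrite -scalerAl; apply: (submoduleZ (gen_form hL' _).1).
have dw : mdeg w = N by exact: (dhomog_mf hom wP).
apply/(gen_image psi _ hL); apply: sub_span; exists ('X_[w] * F).
  by rewrite -dw; apply: hM.
by rewrite rmorphM /= map_mpolyX.
Qed.

End GoodSections.

(** * Flatness of the subscheme *)

Module FunctionModule.
Import functions.
Definition functions_into (A : comNzRingType) (N : lmodType A) (T : Type) : lmodType A :=
  (T -> N)%type.
End FunctionModule.
Import FunctionModule.

(** * Coordinates modulo a space of forms, near a point *)

Section LocalCoordinates.
Variables (A R : comNzRingType) (K : fieldType) (phi : {rmorphism A -> K})
  (psi : {rmorphism A -> R}) (chi : {rmorphism R -> K}).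
Hypothesis loc : localizes_at phi psi chi.

Lemma common_denominator (xs : seq R) :
  exists2 s, phi s != 0 & forall x, x \in xs -> exists a, psi s * x = psi a.
Proof.
elim: xs => [|x xs [t t0 ht]]; first by exists 1; rewrite ?rmorph1 ?oner_neq0.
have [b [s [s0 e]]] : exists b s, phi s != 0 /\ psi s * x = psi b by case: loc.
exists (s * t) => [|y]; first by rewrite rmorphM mulf_neq0.
rewrite inE => /orP[/eqP->|/ht[c hc]]; first by exists (t * b); rewrite mulrC !rmorphM -e /=; ring.
by exists (s * c); rewrite !rmorphM -mulrA hc.
Qed.

Lemma common_multiple (T : eqType) (xs : seq T) (Q : T -> A -> Prop) :
  (forall x s t, Q x s -> Q x (t * s)) ->
  (forall x, x \in xs -> exists2 s, phi s != 0 & Q x s) ->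
  exists2 s, phi s != 0 & forall x, x \in xs -> Q x s.
Proof.
move=> hQ; elim: xs => [|x xs IH] h; first by exists 1; rewrite ?rmorph1 ?oner_neq0.
have [|t t0 ht] := IH; first by move=> y yx; apply: h; rewrite inE yx orbT.
have [s s0 hs] := h x (mem_head _ _).
exists (t * s) => [|y]; first by rewrite rmorphM mulf_neq0.
by rewrite inE => /orP[/eqP->|/ht]; [exact: hQ | rewrite mulrC; exact: hQ].
Qed.

Lemma homog_cols n d (S : comNzRingType) (T : pred (seq nat)) (F : {mpoly S[n.+1]}) :
  F \is d.-homog -> (forall v, mdeg v = d -> T v -> F@_v = 0) ->
  F = \sum_(v <- cols n d (predC T)) F@_v *: 'X_[v].
Proof.
move=> hF h0; apply/mpolyP => m; rewrite raddf_sum /=.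
have [mT|mT] := boolP (m \in cols n d (predC T)).
  rewrite (bigD1_seq m) ?uniq_cols //= big1 => [|v vm]; last first.
    by rewrite mcoeffZ mcoeffX (negPf vm) mulr0.
  by rewrite addr0 mcoeffZ mcoeffX eqxx mulr1.
rewrite big_seq big1 => [|v vT]; last first.
  by rewrite mcoeffZ mcoeffX; case: eqP => [e|]; rewrite ?mulr0 // -e vT in mT *.
have [/eqP dm|dm] := boolP (mdeg m == d); last exact: dhomog_nemf_coeff hF dm.
by apply: h0 => //; move: mT; rewrite mem_cols dm eqxx /= negbK.
Qed.

(** Over R the monomials outside T are a basis modulo W. Multiplied by a common denominator s, the
    coordinates of the finitely many monomials come from A and define linear maps [co v] over A.
    Each expected identity then holds over R, that is, over A after multiplication by some s1
    outside the prime. *)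
Lemma local_coordinates n d (T : pred (seq nat)) (W : {mpoly A[n.+1]} -> Prop) :
  form_space d W -> graph_over d T (image_span psi W) ->
  exists s (co : 'X_{1..n.+1} -> {mpoly A[n.+1]} -> A),
  [/\ phi s != 0, forall v c F G, co v (c *: F + G) = c * co v F + co v G,
    forall F, F \is d.-homog -> exists2 s1, phi s1 != 0 &
      W (s1 *: (s *: F - \sum_(v <- cols n d (predC T)) co v F *: 'X_[v])),
    forall F v, v \in cols n d (predC T) -> W F -> exists2 s1, phi s1 != 0 & s1 * co v F = 0 &
    forall v w, v \in cols n d (predC T) -> w \in cols n d (predC T) ->
      exists2 s1, phi s1 != 0 & s1 * (co v 'X_[w] - s * (v == w)%:R) = 0].
Proof.
move=> hW gT; have hWR : form_space d (image_span psi W) by apply: image_span_homog; case: hW.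
have /choice[G hG] : forall m, exists G, image_span psi W G /\
    forall v, mdeg v = d -> T v -> ('X_[m] - G)@_v = 0.
  by move=> m; have [G ? ?] := graph_reduce 'X_[m] hWR.1 gT; exists G.
set cs := cols n d (predC T); set ms := mons n d.
have [s s0 hs] := common_denominator [seq ('X_[m] - G m)@_v | m <- ms, v <- cs].
have /choice[c hc] : forall mv : 'X_{1..n.+1} * 'X_{1..n.+1}, exists c, mv.1 \in ms -> mv.2 \in cs ->
    psi s * ('X_[mv.1] - G mv.1)@_mv.2 = psi c.
  move=> [m v]; have [[mm vc]|N] := pselect (m \in ms /\ v \in cs); last first.
    by exists 0 => /= h1 h2; case: N.
  by have [|b hb] := hs ('X_[m] - G m)@_v; [apply: allpairs_f | exists b].
pose co v (F : {mpoly A[n.+1]}) := \sum_(m <- ms) F@_m * c (m, v).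
have E F : F \is d.-homog -> map_mpoly psi (s *: F - \sum_(v <- cs) co v F *: 'X_[v]) =
    psi s *: \sum_(m <- ms) psi F@_m *: G m.
  move=> hF; rewrite rmorphB /= map_mpolyZ /= rmorph_sum /=.
  have eF : map_mpoly psi F = \sum_(m <- ms) psi F@_m *: 'X_[m].
    have h : map_mpoly psi F \is d.-homog.
      by apply/dhomogP_coeff => v; rewrite mcoeff_map_mpoly /= => h; apply: ((dhomogP_coeff d F).1 hF); apply: contraNneq h => ->; rewrite rmorph0.
    rewrite (@homog_cols _ _ _ pred0 _ h) //.
    have -> : cols n d (predC pred0) = ms by apply: filter_predT.
    by apply: eq_bigr => m _; rewrite mcoeff_map_mpoly.
  have -> : \sum_(v <- cs) map_mpoly psi (co v F *: 'X_[v]) =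
      psi s *: \sum_(m <- ms) psi F@_m *: ('X_[m] - G m).
    under eq_bigr => v _ do rewrite map_mpolyZ /= map_mpolyX rmorph_sum /= scaler_suml.
    rewrite exchange_big /= scaler_sumr big_seq [RHS]big_seq; apply: eq_bigr => m mm.
    have hm : 'X_[m] - G m \is d.-homog.
      by apply: rpredB; [rewrite dhomogX /= -mem_mons | apply: hWR.2; case: (hG m)].
    rewrite (homog_cols hm (hG m).2) !scaler_sumr big_seq [RHS]big_seq; apply: eq_bigr => v vc.
    by rewrite rmorphM -hc //= !scalerA; congr (_ *: _); ring.
  rewrite eF -scalerBr; congr (_ *: _); rewrite -sumrB; apply: eq_bigr => m _.
  by rewrite -scalerBr opprB addrC subrK.
have WR F : F \is d.-homog -> image_span psi W (map_mpoly psi (s *: F - \sum_(v <- cs) co v F *: 'X_[v])).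
  move=> hF; rewrite E //; apply: (submoduleZ hWR.1); apply: (submodule_sum hWR.1) => m _.
  by apply: (submoduleZ hWR.1); case: (hG m).
have kill x : psi x = 0 -> exists2 s1, phi s1 != 0 & s1 * x = 0.
  by case: loc => _ _ _ /(_ x)[h _] /h[s1 ? ?]; exists s1.
exists s, co; split=> //.
- move=> v b F1 F2; rewrite /co mulr_sumr -big_split; apply: eq_bigr => m _ /=.
  by rewrite mcoeffD mcoeffZ; ring.
- by move=> F hF; exact: (loc_member loc hW.1 (WR F hF)).
- move=> F v vc WF; have : map_mpoly psi (\sum_(v <- cs) co v F *: 'X_[v]) = 0.
    apply: gT.2.
      rewrite -[X in map_mpoly psi X](subKr (s *: F)) rmorphB /=; apply: submoduleB; first exact: hWR.1.
        by apply: sub_span; exists (s *: F) => //; apply: (submoduleZ hW.1).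
      by apply: WR; apply: hW.2.
    move=> w dw Tw; rewrite mcoeff_map_mpoly /= raddf_sum /= big_seq big1 ?rmorph0 // => u.
    rewrite mem_cols => /andP[_ /= Tu]; rewrite mcoeffZ mcoeffX; case: eqP => [e|]; rewrite ?mulr0 //.
    by rewrite e Tw in Tu.
  move=> /(congr1 (mcoeff v)); rewrite mcoeff_map_mpoly mcoeff0 /= raddf_sum /=.
  rewrite (bigD1_seq v) ?uniq_cols //= big1 => [|w wv]; last by rewrite mcoeffZ mcoeffX (negPf wv) mulr0.
  by rewrite addr0 mcoeffZ mcoeffX eqxx mulr1 => /kill.
move=> v w vc wc; apply: kill.
have wm : w \in ms by move: wc; rewrite mem_cols mem_mons => /andP[].
have Gw : G w = 0.
  apply: gT.2 => [|u du Tu]; first by case: (hG w).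
  have := (hG w).2 u du Tu; rewrite mcoeffB mcoeffX; case: eqP => [e|_]; last first.
    by move/eqP; rewrite sub0r oppr_eq0 => /eqP.
  by move: wc; rewrite mem_cols /= e Tu andbF.
have -> : co v 'X_[w] = c (w, v).
  rewrite /co (bigD1_seq w) ?uniq_mons //= big1 => [|m mw]; last first.
    by rewrite mcoeffX eq_sym (negPf mw) mul0r.
  by rewrite mcoeffX eqxx mul1r addr0.
by rewrite rmorphB rmorphM rmorph_nat -hc //= Gw subr0 mcoeffX eq_sym subrr.
Qed.

End LocalCoordinates.

Lemma graph_quotient_dim (K : fieldType) n d (T : pred (seq nat)) (W : {mpoly K[n.+1]} -> Prop) :
  form_space d W -> graph_over d T W -> quotient_dim d W (colen n.+1 d T).
Proof.
move=> hW gT; set cs := cols n d (predC T).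
have <- : size cs = colen n.+1 d T by rewrite size_filter; exact: (count_mons n d T).
pose b (i : 'I_(size cs)) : {mpoly K[n.+1]} := 'X_[nth 0%MM cs i].
have bE (c : 'rV[K]_(size cs)) (j : 'I_(size cs)) : (\sum_i c 0 i *: b i)@_(nth 0%MM cs j) = c 0 j.
  rewrite raddf_sum /= (bigD1 j) //= big1 => [|i ij].
    by rewrite addr0 mcoeffZ mcoeffX eqxx mulr1.
  by rewrite mcoeffZ mcoeffX nth_uniq ?uniq_cols // (inj_eq val_inj) (negPf ij) mulr0.
have bT (c : 'rV[K]_(size cs)) (v : 'X_{1..n.+1}) : T v -> (\sum_i c 0 i *: b i)@_v = 0.
  move=> Tv; rewrite raddf_sum /= big1 // => i _; rewrite mcoeffZ mcoeffX.
  have [_ /= Ti] := nth_cols i; case: eqP => [e|]; rewrite ?mulr0 //.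
  by rewrite /cs e Tv in Ti.
exists b; split=> [i|F hF].
  by rewrite /b dhomogX; apply/eqP; case: (nth_cols i).
have [G WG h0] := graph_reduce F hW.1 gT.
have hFG : F - G \is d.-homog by apply: rpredB => //; apply: hW.2.
pose c : 'rV[K]_(size cs) := \row_i (F - G)@_(nth 0%MM cs i).
have e : F - G = \sum_i c 0 i *: b i.
  rewrite (homog_cols hFG h0) (big_nth 0%MM) big_mkord; apply: eq_bigr => i _.
  by rewrite mxE.
exists c; split=> [|c' Wc']; first by rewrite -e opprB addrC subrK.
suff z : \sum_i (c' - c) 0 i *: b i = 0.
  by apply/rowP => i; apply/eqP; rewrite eq_sym -subr_eq0; have := bE (c' - c) i; rewrite z mcoeff0 !mxE => <-.
apply: gT.2 => [|v _ Tv]; last exact: bT.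
have -> : \sum_i (c' - c) 0 i *: b i = G - (F - \sum_i c' 0 i *: b i).
  have -> : \sum_i (c' - c) 0 i *: b i = \sum_i c' 0 i *: b i - \sum_i c 0 i *: b i.
    by rewrite -sumrB; apply: eq_bigr => i _; rewrite !mxE scalerBl.
  rewrite -e; ring.
exact: submoduleB hW.1 _ _ WG Wc'.
Qed.

Lemma eq_quotient_dim (K : fieldType) n d (W W' : {mpoly K[n.+1]} -> Prop) q : same W W' ->
  quotient_dim d W q -> quotient_dim d W' q.
Proof.
move=> e [b [bh h]]; exists b; split=> // F hF; have [c [hc u]] := h F hF.
by exists c; split=> [|c' hc']; [apply/e | apply/u/e].
Qed.

Section GoodHilb.
Variables (k : fieldType) (n : nat) (a : nat -> nat) (r : nat).

Lemma good_base_change (A B : comNzRingType) (iota : {rmorphism k -> A})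
    (phi : {rmorphism A -> B}) (iota' : {rmorphism k -> B}) L :
  (forall c, iota' c = phi (iota c)) -> good a r iota L -> good (n := n) a r iota' (image_span phi L).
Proof.
move=> e gL R K psi chi loc; have := gL R K (psi \o phi) chi loc.
apply: eq_good_at => [c|F]; first by rewrite /= e.
by apply: iff_sym; apply: image_span_comp.
Qed.

Variables (A : comNzRingType) (iota : {rmorphism k -> A}) (L : {mpoly A[n.+1]} -> Prop).
Hypotheses (hL : form_space r L) (gL : good a r iota L).

(** Near a point, forms of large degree modulo the ideal are free on the monomials outside T, so
    that a tensor is determined by its coordinates there; an injective map detects whether these are
    zero. The local conclusions combine since the annihilator of z is an ideal. *)
Lemma flat_subscheme_of : flat_subscheme (subscheme_of r L).
Proof.
move=> i N' N f injf s hs P b hb; set z := \sum_(t <- s) _.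
have hi := subscheme_of_ideal hL i; have hX := subscheme_of_dehomog hL i.
rewrite -[z]scale1r; apply: (@locally_unit A (fun c => c *: z = 0)).
  split=> [|x y h1 h2|c x h1]; first by rewrite scale0r.
    by rewrite scalerDl h1 h2 addr0.
  by rewrite -scalerA h1 scaler0.
move=> K phi hphi; have [R [psi [chi loc]]] := localize_at phi.
have loc' : local_to chi by case: loc.
have [g [T [ug _ gT]]] := @gL R K psi chi loc'.
pose TD D := iter D shift T; pose WD D := pre iota g (gen L D).
have formW D : form_space (r + D) (WD D) by apply: pre_form_space => //; exact: gen_form.
have gTD D : graph_over (r + D) (TD D) (image_span psi (WD D)).
  apply: eq_graph (gT D) => F; split.
    by move=> h; apply/(pre_image (iota' := psi \o iota) _ ug (gen_form hL D).1) => //; apply/(gen_image psi D hL).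
  by move=> /(pre_image (iota' := psi \o iota) (fun _ => erefl) ug (gen_form hL D).1) h; apply/(gen_image psi D hL).
have /choice[sD /choice[co hco]] := fun D => local_coordinates loc (formW D) (gTD D).
pose h D (m : {mpoly A[n.+1]}) : {mpoly A[n.+1]} := act iota (invmx g) (homogenize i (r + D) m).
have h_lin D c (F G : {mpoly A[n.+1]}) : h D (c *: F + G) = c *: h D F + h D G.
  by rewrite /h /homogenize lin_extD lin_extZ actD actZ.
(* The degree from which the homogenization of an element of the chart ideal lies in the ideal of L
   depends on the element. So the coordinates in all degrees are recorded together, modulo the
   families Z that vanish near the point for large D; only then is the map bilinear modulo the chart
   ideal. *)
pose V := functions_into (functions_into N 'X_{1..n.+1}) nat.
pose Z (u : V) := exists D0, forall D v, (D0 <= D)%N -> v \in cols n (r + D) (predC (TD D)) ->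
  exists2 c, phi c != 0 & c *: u D v = 0.
have hZ : is_submodule Z.
  split=> [|u v [D1 h1] [D2 h2]|c u [D1 h1]].
  - by exists 0%N => D v _ _; exists 1; rewrite ?rmorph1 ?oner_neq0 ?scaler0.
  - exists (maxn D1 D2) => D w; rewrite geq_max => /andP[l1 l2] wD.
    have [c1 c10 e1] := h1 D w l1 wD; have [c2 c20 e2] := h2 D w l2 wD.
    exists (c1 * c2); first by rewrite rmorphM mulf_neq0.
    by rewrite -[(u + v) D w]/(u D w + v D w) scalerDr -[X in _ + X]scalerA e2 mulrC -scalerA e1 !scaler0 addr0.
  - exists D1 => D w l1 wD; have [c1 c10 e1] := h1 D w l1 wD; exists c1 => //.
    by rewrite -[(c *: u) D w]/(c *: u D w) scalerA mulrC -scalerA e1 scaler0.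
have [Q [pr [_ prE]]] := quotient_module hZ.
pose B0 (x : N) (m : {mpoly A[n.+1]}) : V := fun D v => co D v (h D m) *: x.
have hB : bilinear_mod (subscheme_of r L i) (fun x m => pr (B0 x m)).
  split=> [c x y m|c x m m'|x m [D0 Jm]].
  - rewrite -linearP; congr (pr _); apply/funext => D; apply/funext => v.
    rewrite -[RHS]/(c *: (co D v (h D m) *: x) + co D v (h D m) *: y).
    by rewrite /B0 scalerDr !scalerA mulrC.
  - rewrite -linearP; congr (pr _); apply/funext => D; apply/funext => v.
    rewrite -[RHS]/(c *: (co D v (h D m) *: x) + co D v (h D m') *: x).
    by rewrite /B0 h_lin; case: (hco D) => _ -> _ _ _; rewrite scalerDl scalerA.
  - apply/prE; exists D0 => D v lD vD; case: (hco D) => _ _ _ /(_ (h D m) v vD)[] //.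
      by rewrite /WD /pre /h act_mul mulVmx // act1; apply: Jm.
    by move=> s1 s10 e; exists s1 => //; rewrite /B0 scalerA e scale0r.
have := hs Q _ hB; rewrite big_map /= -linear_sum => /prE[D0 hD0].
(* A single degree in which all the t.2 homogenize without junk and the coordinates of the image
   already vanish. *)
pose D := (D0 + \sum_(t <- s) msize t.2)%N; have lD : (D0 <= D)%N := leq_addr _ _.
have msz t : t \in s -> (msize t.2 <= (r + D).+1)%N.
  by move=> ts; rewrite /D (big_rem t) //=; lia.
set cs := cols n (r + D) (predC (TD D)) in hco.
have [c c0 hc] : exists2 c, phi c != 0 & forall v, v \in cs ->
    c *: \sum_(t <- s) co D v (h D t.2) *: t.1 = 0.
  apply: common_multiple => [v s1 t1 e|v vc]; first by rewrite -scalerA e scaler0.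
  have [c c0 e] := hD0 D v lD vc; exists c => //; apply: injf.
  rewrite linear0 linearZ /= linear_sum -[RHS]e; congr (_ *: _).
  have -> : (\sum_(t <- s) B0 (f t.1) t.2) D v = \sum_(t <- s) B0 (f t.1) t.2 D v.
    by elim: (s) => [|t s' IH]; rewrite ?big_nil // !big_cons -IH.
  by apply: eq_bigr => t _; rewrite linearZ.
have [s0 hlin hred _ _] := hco D.
have [b1 b2 b3] := hb.
have b0r x : b x 0 = 0 by have := b2 (-1) x 0 0; rewrite scaler0 add0r scaleN1r addNr.
have bZr x c' m : b x (c' *: m) = c' *: b x m by have := b2 c' x m 0; rewrite !addr0 b0r addr0.
have bDr x m m' : b x (m + m') = b x m + b x m' by have := b2 1 x m m'; rewrite !scale1r.
have b0l m : b 0 m = 0 by have := b1 (-1) 0 0 m; rewrite scaler0 add0r scaleN1r addNr.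
have bZl x c' m : b (c' *: x) m = c' *: b x m by have := b1 c' x 0 m; rewrite /= !addr0 b0l addr0.
have bDl x y m : b (x + y) m = b x m + b y m by have := b1 1 x y m; rewrite /= !scale1r.
have bsr x (I : eqType) (xs : seq I) F : b x (\sum_(v <- xs) F v) = \sum_(v <- xs) b x (F v).
  by elim: xs => [|v xs IH]; rewrite ?big_nil // !big_cons bDr IH.
have bsl m (I : eqType) (xs : seq I) F : b (\sum_(v <- xs) F v) m = \sum_(v <- xs) b (F v) m.
  by elim: xs => [|v xs IH]; rewrite ?big_nil // !big_cons bDl IH.
(* As b vanishes on the chart ideal, t.2 may be replaced by its homogenization and then, up to
   denominators, by the combination of monomials outside T given by its coordinates. *)
have [s1 s10 hs1] : exists2 s1, phi s1 != 0 & forall t, t \in s -> s1 * sD D *: b t.1 t.2 =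
    s1 *: \sum_(v <- cs) b (co D v (h D t.2) *: t.1) (act iota g 'X_[v]).
  apply: common_multiple => [t x y e|t ts].
    by rewrite -mulrA -scalerA e scalerA.
  have hom : h D t.2 \is (r + D).-homog by apply: act_homog; apply: homogenize_homog; exact: msz.
  have [s1 s10 Ws1] := hred _ hom; exists s1 => //.
  have eqb m : subscheme_of r L i m -> b t.1 m = 0 by apply: b3.
  have -> : b t.1 t.2 = b t.1 (act iota g (h D t.2)).
    rewrite /h act_mul mulVmx // act1 -{1}(subrK (homogenize i (r + D) t.2) t.2) bDr.
    by rewrite eqb ?add0r //; apply: homogenize_mod.
  apply/eqP; rewrite -subr_eq0 -scalerA -scalerBr.
  have := eqb _ (subscheme_of_gen hL i Ws1).
  rewrite actZ actB actZ bZr => e; rewrite -[X in _ == X]e; apply/eqP; congr (_ *: _).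
  rewrite bDr bZr -[X in _ = _ + b _ X]scaleN1r bZr scaleN1r.
  by congr (_ - _); rewrite act_sum bsr; apply: eq_bigr => v _; rewrite actZ bZr bZl.
exists (c * (s1 * sD D)); last by rewrite !rmorphM !mulf_neq0.
rewrite -scalerA scaler_sumr (eq_big_seq _ hs1) -scaler_sumr exchange_big /=.
rewrite scalerA mulrC -scalerA scaler_sumr big_seq big1 ?scaler0 // => v vc.
by rewrite -bsl -bZl hc // b0l.
Qed.

Lemma good_hilb P : (forall d, (r <= d)%N -> P.[d%:R] = (gbinom a r d)%:R) ->
  in_Hilb P (subscheme_of r L).
Proof.
move=> hP; split; [exact: subscheme_of_closed | exact: flat_subscheme_of |].
move=> K phi _; exists r => d rd; exists (gbinom a r d); split; first exact: hP.
have hL' : form_space r (image_span phi L) by apply: image_span_homog; case: hL.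
have gL' : good a r (phi \o iota) (image_span phi L) by apply: good_base_change gL.
have [g [T [ug cT gT]]] := @gL K K phi idfun (@field_local K).
move: rd => /subnKC <-; set j := (d - r)%N.
have hj := gen_form hL' j.
have q1 : quotient_dim (r + j) (pre (phi \o iota) g (gen (image_span phi L) j)) (gbinom a r (r + j)).
  by rewrite -cT; apply: graph_quotient_dim (gT j); apply: pre_form_space.
have ug' : invmx g \in unitmx by rewrite unitmx_inv.
apply: eq_quotient_dim (pre_quotient_dim (phi \o iota) ug' q1) => F.
have <- : sections (subscheme_of r (image_span phi L)) (r + j) F <->
    sections (base_change phi (subscheme_of r L)) (r + j) F.
  have e := base_change_subscheme_of phi hL.
  by split=> -[hF hi]; split=> // i; apply/(e i F); apply: hi.
rewrite (sections_subscheme_of j F hL' gL').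
by rewrite /pre act_mul mulVmx // act1.
Qed.

End GoodHilb.

(** * Points of the Grassmannian *)

Section Rows.
Variables (n r : nat).
Local Notation N := (Nmon n r).

Lemma monomialE (i : 'I_N) : monomial i = nth 0%MM (mons n r) i. Proof. by []. Qed.

Lemma monomial_lt (i : 'I_N) : (i < size (mons n r))%N.
Proof. by rewrite size_mons; exact: ltn_ord. Qed.

Lemma mdeg_monomial (i : 'I_N) : mdeg (monomial i) = r.
Proof. by apply/eqP; rewrite -mem_mons mem_nth // monomial_lt. Qed.

Lemma monomial_inj : injective (@monomial n r).
Proof.
move=> i j /eqP; rewrite !monomialE nth_uniq ?uniq_mons ?monomial_lt // => /eqP; exact: val_inj.
Qed.

Lemma monomialP m : mdeg m = r -> exists i : 'I_N, monomial i = m.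
Proof.
move=> dm; have mm : m \in mons n r by rewrite mem_mons dm.
have lt : (index m (mons n r) < N)%N by rewrite /Nmon -(size_mons n r) index_mem.
by exists (Ordinal lt); rewrite monomialE /= nth_index.
Qed.

Section Ring.
Variable A : comNzRingType.
Implicit Types (v w : 'rV[A]_N) (F : {mpoly A[n.+1]}) (L : 'rV[A]_N -> Prop).

Definition row_of_form F : 'rV[A]_N := \row_i F@_(monomial i).

Lemma form_of_rowE v i : (form_of_row v)@_(monomial i) = v 0 i.
Proof.
rewrite raddf_sum /= (bigD1 i) //= big1 => [|j ji].
  by rewrite addr0 mcoeffZ mcoeffX eqxx mulr1.
by rewrite mcoeffZ mcoeffX (inj_eq monomial_inj) (negPf ji) mulr0.
Qed.

Lemma form_of_rowK v : row_of_form (form_of_row v) = v.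
Proof. by apply/rowP => i; rewrite mxE form_of_rowE. Qed.

Lemma form_of_row_homog v : form_of_row v \is r.-homog.
Proof.
by apply: rpred_sum => i _; apply: rpredZ; rewrite dhomogX /=; apply/eqP; exact: mdeg_monomial.
Qed.

Lemma row_of_formK F : F \is r.-homog -> form_of_row (row_of_form F) = F.
Proof.
move=> hF; apply/mpolyP => m; have [/eqP/monomialP[i <-]|dm] := boolP (mdeg m == r).
  by rewrite form_of_rowE mxE.
by rewrite !(dhomog_nemf_coeff _ dm) //; exact: form_of_row_homog.
Qed.

Lemma form_of_row_lin a v w : form_of_row (a *: v + w) = a *: form_of_row v + form_of_row w.
Proof.
rewrite /form_of_row scaler_sumr -big_split; apply: eq_bigr => i _.
by rewrite !mxE scalerDl scalerA.
Qed.

Lemma row_of_form_lin a F G : row_of_form (a *: F + G) = a *: row_of_form F + row_of_form G.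
Proof. by apply/rowP => i; rewrite !mxE mcoeffD mcoeffZ. Qed.

Lemma form_of_row0 : form_of_row (0 : 'rV[A]_N) = 0.
Proof. by rewrite /form_of_row big1 // => i _; rewrite mxE scale0r. Qed.

Definition forms L F := exists2 v, L v & F = form_of_row v.

Lemma formsP L v : forms L (form_of_row v) <-> L v.
Proof.
split=> [[w Lw /(congr1 row_of_form)]|]; last by exists v.
by rewrite !form_of_rowK => ->.
Qed.

Lemma forms_space L : is_submodule L -> form_space r (forms L).
Proof.
move=> hL; split; last by move=> _ [v _ ->]; exact: form_of_row_homog.
split=> [|_ _ [v Lv ->] [w Lw ->]|a _ [v Lv ->]].
- by exists 0; [apply: submodule0 | rewrite form_of_row0].
- exists (v + w); first exact: submoduleD.
  by have := form_of_row_lin 1 v w; rewrite !scale1r.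
- exists (a *: v); first exact: submoduleZ.
  by have := form_of_row_lin a v 0; rewrite !addr0 form_of_row0 addr0.
Qed.

End Ring.

Lemma map_form_of_row (A B : comNzRingType) (phi : {rmorphism A -> B}) (v : 'rV[A]_N) :
  map_mpoly phi (form_of_row v) = form_of_row (map_mx phi v).
Proof.
by rewrite rmorph_sum /=; apply: eq_bigr => i _; rewrite map_mpolyZ /= map_mpolyX mxE.
Qed.

Lemma forms_base_change (A B : comNzRingType) (phi : {rmorphism A -> B})
    (L : 'rV[A]_N -> Prop) : 
  same (forms (base_change_submodule phi L)) (image_span phi (forms L)).
Proof.
have hb : is_submodule (base_change_submodule phi L) by apply: span_submodule.
move=> F; split; last first.
  apply: (span_min (forms_space hb).1) => _ [_ [v Lv ->] ->].
  by rewrite map_form_of_row; apply/formsP; apply: sub_span; exists v.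
move=> [v Lv ->]; have hs := span_submodule (fun G => exists2 F, forms L F & G = map_mpoly phi F).
have hp : is_submodule (fun v : 'rV[B]_N => image_span phi (forms L) (form_of_row v)).
  split=> [|u w hu hw|a w hw].
  - by rewrite form_of_row0; apply: submodule0.
  - by have := form_of_row_lin 1 u w; rewrite !scale1r => ->; apply: submoduleD.
  - have := form_of_row_lin a w 0; rewrite !addr0 form_of_row0 addr0 => ->; exact: submoduleZ.
apply: (span_min hp _ Lv) => _ [w Lw ->]; rewrite -map_form_of_row; apply: sub_span.
by exists (form_of_row w) => //; apply/formsP.
Qed.

End Rows.

Lemma unit_factor (A B : comNzRingType) (phi : {rmorphism A -> B}) x y :
  (exists g, phi (x * y) * g = 1) -> exists g, phi x * g = 1.
Proof. by move=> [g e]; exists (phi y * g); rewrite mulrA -rmorphM. Qed.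

Section InGr.
Variables (k : fieldType) (n : nat) (a : nat -> nat) (r : nat).
Variables (A : comNzRingType) (iota : {rmorphism k -> A}) (L : 'rV[A]_(Nmon n r) -> Prop).
Hypotheses (noeA : noetherian A) (hL : is_submodule L) (gL : good a r iota (forms L)).

(** Around each point the quotient by L is free on the monomials outside T in good coordinates. The
    matrix M of the coordinates [co v] does this once finitely many denominators are inverted, and
    the f that arise generate the unit ideal. *)
Lemma good_in_Gr : in_Gr (gbinom a r r) L.
Proof.
split=> //; set p := gbinom a r r.
pose free f := exists (B : comNzRingType) (phi : {rmorphism A -> B}) (M : 'M[B]_(Nmon n r, p)),
  is_localization phi f /\ trivializes phi L M.
suff [s [hs e]] : ideal_gen free 1.
  exists [seq t.2 | t <- s]; split.
    by exists s; split=> // t ts; apply: map_f.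
  by move=> _ /mapP[t /hs h ->].
apply: locally_unit; first exact: ideal_gen_ideal.
move=> K phi hphi; have [R [psi [chi loc]]] := localize_at phi.
have loc' : local_to chi by case: loc.
have [g [T [ug cT gT]]] := @gL R K psi chi loc'.
have fL := forms_space hL.
pose W := pre iota g (forms L).
have hW : form_space r W by apply: pre_form_space.
have gW : graph_over r T (image_span psi W).
  have := gT 0%N; rewrite addn0; apply: eq_graph => F.
  by apply: iff_sym; apply: (pre_image (iota' := psi \o iota)) => //; exact: fL.1.
have [s [co [s0 lin red kill diag]]] := local_coordinates loc hW gW.
set cs := cols n r (predC T) in red kill diag.
have scs : size cs = p.
  by have := cT 0%N; rewrite addn0 -/p => <-; rewrite size_filter; exact: (count_mons n r T).
have lin0 v : co v 0 = 0 by have := lin v (-1) 0 0; rewrite scaler0 add0r mulN1r addNr.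
have linZ v c (F : {mpoly A[n.+1]}) : co v (c *: F) = c * co v F by have := lin v c F 0; rewrite lin0 !addr0.
have linD v (F G : {mpoly A[n.+1]}) : co v (F + G) = co v F + co v G by have := lin v 1 F G; rewrite scale1r mul1r.
have linS v (I : Type) (xs : seq I) (F : I -> {mpoly A[n.+1]}) : co v (\sum_(i <- xs) F i) = \sum_(i <- xs) co v (F i).
  by elim: xs => [|i xs IH]; rewrite ?big_nil ?lin0 // !big_cons linD IH.
pose X (i : 'I_(Nmon n r)) := act iota (invmx g) ('X_[monomial i]) : {mpoly A[n.+1]}.
have hX i : X i \is r.-homog by apply: act_homog; rewrite dhomogX /= mdeg_monomial.
have gX i : act iota g (X i) = 'X_[monomial i] by rewrite /X act_mul mulVmx // act1.
pose red_at i c := W (c *: (s *: X i - \sum_(v <- cs) co v (X i) *: 'X_[v])).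
have [f1 f10 h1] : exists2 f, phi f != 0 & forall i, i \in enum 'I_(Nmon n r) -> red_at i f.
  apply: common_multiple => [i x t h|i _]; last exact: red.
  by rewrite /red_at -scalerA; apply: (submoduleZ hW.1).
(* Each value of [co v] on W is killed by a denominator of its own. The values form an ideal,
   finitely generated as A is noetherian, so one denominator serves for all of them. *)
have [f2 f20 h2] : exists2 f, phi f != 0 & forall v, v \in cs -> forall F, W F -> f * co v F = 0.
  apply: (common_multiple (Q := fun v f => forall F, W F -> f * co v F = 0)) => [v x t h F WF|v vc].
    by rewrite -mulrA h // mulr0.
  pose I x := exists2 F, W F & x = co v F.
  have hI : is_ideal I.
    split=> [|_ _ [F WF ->] [G WG ->]|c _ [F WF ->]].
    - by exists 0; [exact: submodule0 hW.1 | rewrite lin0].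
    - by exists (F + G); [apply: (submoduleD hW.1) | rewrite linD].
    - by exists (c *: F); [apply: (submoduleZ hW.1) | rewrite linZ].
  have [xs hxs] := noeA hI.
  have [f f0 hf] : exists2 f, phi f != 0 & forall x, x \in xs -> f * x = 0.
    apply: common_multiple => [x y t h|x xxs]; first by rewrite -mulrA h mulr0.
    have /hxs[F WF ->] : ideal_gen (fun x => x \in xs) x by apply: sub_ideal_gen.
    exact: kill.
  exists f => // F WF; have /hxs[t [ht ->]] : I (co v F) by exists F.
  rewrite mulr_sumr big_seq big1 // => u /ht ut; by rewrite mulrCA hf // mulr0.
have [f3 f30 h3] : exists2 f, phi f != 0 & forall vw, vw \in [seq (v, w) | v <- cs, w <- cs] ->
    f * (co vw.1 'X_[vw.2] - s * (vw.1 == vw.2)%:R) = 0.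
  apply: common_multiple => [vw x t h|_ /allpairsP[[v w] [/= vc wc ->]]]; last exact: diag.
  by rewrite -mulrA h mulr0.
pose f := s * (f1 * (f2 * f3)); have f0 : phi f != 0 by rewrite !rmorphM !mulf_neq0.
exists f => //; apply: sub_ideal_gen.
have [B [psiB locB]] := localize_elt f0; exists B, psiB.
have [[gf hgf] _ _] := locB.
have [u hu] : exists u, psiB s * u = 1 by apply: (@unit_factor _ _ psiB s (f1 * (f2 * f3))); exists gf.
have [u1 hu1] : exists u, psiB f1 * u = 1.
  by apply: (@unit_factor _ _ psiB f1 (s * (f2 * f3))); exists gf; rewrite -hgf /f; congr (psiB _ * _); ring.
have [u2 hu2] : exists u, psiB f2 * u = 1.
  by apply: (@unit_factor _ _ psiB f2 (s * (f1 * f3))); exists gf; rewrite -hgf /f; congr (psiB _ * _); ring.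
have [u3 hu3] : exists u, psiB f3 * u = 1.
  by apply: (@unit_factor _ _ psiB f3 (s * (f1 * f2))); exists gf; rewrite -hgf /f; congr (psiB _ * _); ring.
have cancel (x y : A) t : psiB x * t = 1 -> x * y = 0 -> psiB y = 0.
  move=> hx e; have := congr1 psiB e; rewrite rmorphM rmorph0 => e'.
  by rewrite -[psiB y]mul1r -hx mulrAC e' mul0r.
pose M : 'M[B]_(Nmon n r, p) := \matrix_(i, j) psiB (co (nth 0%MM cs j) (X i)).
have csj (j : 'I_p) : nth 0%MM cs j \in cs by rewrite mem_nth // scs.
have ME (v : 'rV[A]_(Nmon n r)) j :
    (map_mx psiB v *m M) 0 j = psiB (co (nth 0%MM cs j) (act iota (invmx g) (form_of_row v))).
  rewrite mxE /form_of_row act_sum.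
  rewrite -(big_map (fun i => i) xpredT (fun i => act iota (invmx g) (v 0 i *: 'X_[monomial i]))) map_id linS rmorph_sum /=.
  by apply: eq_bigr => i _; rewrite !mxE actZ linZ rmorphM.
have coE (v w : 'X_{1..n.+1}) : v \in cs -> w \in cs -> psiB (co v 'X_[w]) = psiB s * (v == w)%:R.
  move=> vc wc; have := cancel _ _ _ hu3 (h3 (v, w) (allpairs_f _ vc wc)).
  by rewrite rmorphB rmorphM rmorph_nat /= => /eqP; rewrite subr_eq0 => /eqP.
have actB_ F : map_mpoly psiB (act iota g F) = act (psiB \o iota) g (map_mpoly psiB F).
  exact: act_map.
have hLB : is_submodule (image_span psiB (forms L)) by apply: span_submodule.
exists M; split=> //; split=> [w|v]; last split.
- pose v : 'rV[B]_(Nmon n r) := \sum_j (w 0 j * u) *: map_mx psiB (row_of_form r (act iota g 'X_[nth 0%MM cs j])).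
  exists v; apply/rowP => j; rewrite /v mulmx_suml summxE.
  have E l : ((w 0 l * u) *: map_mx psiB (row_of_form r (act iota g 'X_[nth 0%MM cs l])) *m M) 0 j =
      w 0 l * (j == l)%:R.
    rewrite -scalemxAl mxE ME row_of_formK; last first.
      by apply: act_homog; rewrite dhomogX /= -mem_mons; have := csj l; rewrite mem_cols mem_mons => /andP[].
    rewrite act_mul mulmxV // act1 coE // nth_uniq ?uniq_cols ?scs // (inj_eq val_inj).
    by rewrite mulrA -(mulrA (w 0 l)) [u * _]mulrC hu mulr1.
  under eq_bigr do rewrite E.
  rewrite (bigD1 j) //= eqxx mulr1 big1 ?addr0 // => l lj.
  by rewrite eq_sym (negPf lj) mulr0.
- move=> vM; apply/formsP; apply/forms_base_change.
  suff h : image_span psiB (forms L) (psiB s *: form_of_row v).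
    by rewrite -[form_of_row v]scale1r -hu mulrC -scalerA; apply: (submoduleZ hLB).
  have redB i : image_span psiB (forms L) (psiB s *: 'X_[monomial i] -
      \sum_(j < p) psiB (co (nth 0%MM cs j) (X i)) *: map_mpoly psiB (act iota g 'X_[nth 0%MM cs j])).
    have := h1 i (mem_enum _ _); rewrite /red_at /W /pre actZ actB actZ gX act_sum => h.
    rewrite -[X in image_span _ _ X]scale1r -hu1 mulrC -scalerA; apply: (submoduleZ hLB).
    apply: sub_span; eexists; first exact: h.
    rewrite map_mpolyZ /= rmorphB /= map_mpolyZ /= map_mpolyX rmorph_sum /=; congr (_ *: (_ - _)).
    rewrite (big_nth 0%MM) big_mkord scs; apply: eq_bigr => j _.
    by rewrite actZ map_mpolyZ.
  have -> : psiB s *: form_of_row v = \sum_i v 0 i *: (psiB s *: 'X_[monomial i] -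
      \sum_(j < p) psiB (co (nth 0%MM cs j) (X i)) *: map_mpoly psiB (act iota g 'X_[nth 0%MM cs j])).
    under [RHS]eq_bigr do rewrite scalerBr; rewrite sumrB.
    rewrite [X in _ - X](_ : _ = 0) ?subr0.
      by rewrite scaler_sumr; apply: eq_bigr => i _; rewrite !scalerA mulrC.
    under eq_bigr do rewrite scaler_sumr; rewrite exchange_big big1 //= => j _.
    under eq_bigr do rewrite scalerA; rewrite -scaler_suml.
    have := congr1 (fun m : 'rV[B]_p => m 0 j) vM; rewrite !mxE => e.
    by rewrite [X in X *: _](_ : _ = 0) ?scale0r // -[RHS]e; apply: eq_bigr => i _; rewrite mxE.
  by apply: (submodule_sum hLB) => i _; apply: (submoduleZ hLB).
have hk0 : is_submodule (fun v : 'rV[B]_(Nmon n r) => v *m M = 0).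
  split=> [|x y hx hy|c x hx]; first exact: mul0mx.
    by rewrite mulmxDl hx hy addr0.
  by rewrite -scalemxAl hx scaler0.
apply: (span_min hk0) => _ [w Lw ->]; apply/rowP => j; rewrite ME mxE.
apply: (cancel _ _ _ hu2); apply: h2 => //.
by rewrite /W /pre act_mul mulVmx // act1; apply/formsP.
Qed.

End InGr.

(** * Minors and Plücker relations *)

Section RowMinors.
Variables (N q : nat) (B : comNzRingType) (M : 'M[B]_(N, q)) (x0 : 'I_N).

Definition seq_minor (s : seq 'I_N) : B := \det (\matrix_(i < q, j < q) M (nth x0 s i) j).

Lemma seq_minor_swap t x y l : size (t ++ [:: x, y & l]) = q ->
  seq_minor (t ++ [:: x, y & l]) = - seq_minor (t ++ [:: y, x & l]).
Proof.
rewrite size_cat /= => sz.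
have i1q : (size t < q)%N by rewrite -sz; lia.
have i2q : ((size t).+1 < q)%N by rewrite -sz; lia.
pose i1 := Ordinal i1q; pose i2 := Ordinal i2q.
have ne : i1 != i2 by rewrite -val_eqE /=; lia.
set M1 := \matrix_(i < q, j < q) M (nth x0 (t ++ [:: x, y & l]) i) j.
rewrite /seq_minor -/M1.
have -> : \matrix_(i < q, j < q) M (nth x0 (t ++ [:: y, x & l]) i) j = row_perm (tperm i1 i2) M1.
  apply/matrixP => i j; rewrite !mxE; congr (M _ j); case: tpermP => [->|->|/eqP n1 /eqP n2] /=.
  - by rewrite !nth_cat ltnn subnn ltnNge leqnSn /= subSnn.
  - by rewrite !nth_cat ltnn subnn ltnNge leqnSn /= subSnn.
  rewrite !nth_cat; case: ltnP => // ti.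
  move: n1 n2; rewrite -!val_eqE /=; case E : (i - size t)%N => [|[|m]] //=.
    by lia.
  by lia.
by rewrite row_permE det_mulmx det_perm odd_tperm ne expr1 mulN1r opprK.
Qed.

Definition insert_ord (x : 'I_N) (l : seq 'I_N) := merge (fun a b : 'I_N => (a <= b)%N) [:: x] l.

(** Insertion sort follows the recursion of [inversions]: inserting x makes one transposition for
    each smaller entry after it. *)
Fixpoint isort (s : seq 'I_N) := if s is x :: s' then insert_ord x (isort s') else [::].

Lemma insert_ord_cons x y l : insert_ord x (y :: l) =
  if (x <= y)%N then [:: x, y & l] else y :: insert_ord x l.
Proof. by rewrite /insert_ord /=; case: ifP; case: l. Qed.

Lemma perm_isort s : perm_eq (isort s) s.
Proof.
elim: s => //= x s IH; rewrite /insert_ord perm_merge /=.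
by rewrite perm_cons.
Qed.

Lemma isort_sorted s : sorted (fun a b : 'I_N => (a <= b)%N) (isort s).
Proof.
elim: s => //= x s IH; apply: merge_sorted => // a b; exact: leq_total.
Qed.

Lemma seq_minor_insert t x l : size (t ++ x :: l) = q ->
  sorted (fun a b : 'I_N => (a <= b)%N) l ->
  seq_minor (t ++ x :: l) = (-1) ^+ count (fun y : 'I_N => (y < x)%N) l * seq_minor (t ++ insert_ord x l).
Proof.
elim: l t => [|y l IH] t sz sl; first by rewrite mul1r.
rewrite insert_ord_cons; case: leqP => [xy|yx] /=.
  rewrite ltnNge xy /= (_ : count _ l = 0%N) ?mul1r //; apply/eqP; rewrite -leqn0 leqNgt -has_count.
  apply/hasPn => z zl; rewrite -leqNgt; apply: leq_trans xy _.
  have /allP := order_path_min (fun a b c : 'I_N => @leq_trans a b c) sl; exact.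
rewrite yx seq_minor_swap // -cat_rcons IH.
- by rewrite cat_rcons exprD expr1 mulN1r mulNr.
- by move: sz; rewrite cat_rcons !size_cat /=.
- exact: path_sorted sl.
Qed.

Lemma seq_minor_isort t s : size (t ++ s) = q ->
  seq_minor (t ++ s) = (-1) ^+ inversions s * seq_minor (t ++ isort s).
Proof.
elim: s t => [|x s IH] t sz /=; first by rewrite mul1r.
rewrite -cat_rcons IH; last by rewrite cat_rcons.
rewrite cat_rcons seq_minor_insert ?isort_sorted //; last first.
  by move: sz; rewrite !size_cat /= (perm_size (perm_isort s)).
by rewrite mulrA -exprD addnC (seq.permP (perm_isort s)).
Qed.

Lemma seq_minor_eq0 s : size s = q -> ~~ uniq s -> seq_minor s = 0.
Proof.
move=> sz /(uniqPn x0)[i [j [ij js e]]]; rewrite sz in js.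
have iq := ltn_trans ij js.
apply: (@determinant_alternate _ _ _ (Ordinal iq) (Ordinal js)).
  by rewrite -val_eqE /= ltn_eqF.
by move=> l; rewrite !mxE /= e.
Qed.

Lemma seq_minor_minor s (S : psubset N q) : size s = q -> uniq s ->
  val S = [set x in s] -> seq_minor (isort s) = minor M S.
Proof.
move=> sz us eS; rewrite /seq_minor /minor; congr (\det _); apply/matrixP => i j; rewrite !mxE.
congr (M _ j).
have -> : isort s = enum (val S).
  apply: (@irr_sorted_eq _ (fun a b : 'I_N => (a < b)%N)).
  - by move=> a b c; apply: ltn_trans.
  - by move=> a; rewrite /= ltnn.
  - have := isort_sorted s; have : uniq (isort s) by rewrite (perm_uniq (perm_isort s)).
    elim: (isort s) => //= a l IH /andP[al ul] sl; have := IH ul (path_sorted sl).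
    case: l al sl {IH ul} => //= b l; rewrite inE negb_or => /andP[ab _] /andP[le _] ->.
    by rewrite andbT ltn_neqAle le andbT.
  - have h : sorted (fun a b : 'I_N => (a < b)%N) (enum 'I_N).
      by have := iota_ltn_sorted 0 N; rewrite -val_enum_ord sorted_map.
    rewrite /enum_mem -enumT; apply: sorted_filter h; by move=> a b c; apply: ltn_trans.
  - move=> a; rewrite (perm_mem (perm_isort s)) mem_enum eS inE //.
rewrite (enum_val_nth x0); congr (nth _ _ _).
Qed.

End RowMinors.

Section Evaluation.
Variables (k : fieldType) (N q : nat).

Definition ev (B : comNzRingType) (iB : {rmorphism k -> B}) (M : 'M[B]_(N, q))
    (F : plucker_ring k N q) : B :=
  mmap iB (fun i => minor M (enum_val i)) F.

Lemma ev_plucker_var (B : comNzRingType) (iB : {rmorphism k -> B}) (M : 'M[B]_(N, q)) x0 s :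
  size s = q -> ev iB M (plucker_var k q s) = seq_minor M x0 s.
Proof.
move=> sz; rewrite /plucker_var; case: insubP => [S hS eS|hS].
  have us : uniq s by apply/card_uniqP; move: hS; rewrite cardsE sz => /eqP.
  rewrite /ev rmorphM rmorphXn rmorphN1 /= mmapX mmap1U enum_rankK.
  by rewrite -[s in RHS]cat0s seq_minor_isort // cat0s (seq_minor_minor M x0 sz us eS).
rewrite /ev mmap0 seq_minor_eq0 //; apply: contra hS => us; rewrite cardsE; apply/eqP.
by rewrite -sz; apply/card_uniqP.
Qed.

(** Expanding the first minor along its last row, the relation becomes a combination over j of
    determinants expanded along their first column: the rows w of M, with column j repeated in
    front. These determinants have two equal columns. *)
Lemma ev_relation (B : comNzRingType) (iB : {rmorphism k -> B}) (M : 'M[B]_(N, q)) F :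
  plucker_relation F -> ev iB M F = 0.
Proof.
move=> [u [w [su ->]]]; pose x0 := tnth w ord0.
have suw l : size (rcons u (tnth w l)) = q by rewrite size_rcons.
have sw (l : 'I_q.+1) : size (take l w ++ drop l.+1 w) = q.
  by rewrite size_cat size_take size_drop size_tuple ltn_ord; have := ltn_ord l; lia.
have q0 : (q.-1 < q)%N by rewrite -su.
(* The cofactors of the last row do not depend on that row, so x0 may stand for any [tnth w l]. *)
pose c j := cofactor (\matrix_(i < q, j < q) M (nth x0 (rcons u x0) i) j) (Ordinal q0) j.
pose X j := \matrix_(i < q.+1, l < q.+1) M (tnth w i) (if unlift ord0 l is Some l' then l' else j).
have X0 j : \det (X j) = 0.
  rewrite -det_tr; apply: (@determinant_alternate _ _ _ ord0 (lift ord0 j)) => [|l].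
    exact: neq_lift.
  by rewrite !mxE unlift_none liftK.
transitivity (\sum_(j < q) c j * \det (X j)); last by rewrite big1 // => j _; rewrite X0 mulr0.
rewrite /ev rmorph_sum /=.
under [RHS]eq_bigr => j _.
  rewrite (expand_det_col _ ord0) mulr_sumr; over.
rewrite exchange_big; apply: eq_bigr => l _ /=.
rewrite !rmorphM rmorphXn rmorphN1 /= -![mmap _ _ _]/(ev iB M _) !(ev_plucker_var _ _ x0) //.
have -> : seq_minor M x0 (rcons u (tnth w l)) = \sum_(j < q) M (tnth w l) j * c j.
  rewrite /seq_minor (expand_det_row _ (Ordinal q0)); apply: eq_bigr => j _; rewrite !mxE /=.
  rewrite nth_rcons; have -> : size u = q.-1 by rewrite -su.
  rewrite ltnn eqxx; congr (_ * _); rewrite /c /cofactor; congr (_ * \det _).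
  apply/matrixP => i j'; rewrite !mxE !nth_rcons /=; congr (M _ _).
  case: ltnP => //; have := ltn_ord i; rewrite /bump; lia.
rewrite -mulrA mulrCA mulr_suml; apply: eq_bigr => j _.
rewrite !mxE unlift_none /cofactor addn0 [RHS]mulrCA -mulrA.
congr (_ * (_ * (_ * \det _))); apply/matrixP => i j'; rewrite !mxE liftK.
congr (M _ _); rewrite nth_cat size_take size_tuple ltn_ord (tnth_nth x0) /= /bump.
case: ltnP => il; first by rewrite nth_take // leqNgt il.
by rewrite nth_drop; congr (nth _ _ _); lia.
Qed.

End Evaluation.

(** * Forms in the maximal minors *)

Section Expansions.
Variable B : comNzRingType.

(** The Cauchy-Binet formula by multilinearity in the rows of the product: the sum runs over all
    maps instead of the increasing ones, which dispenses with signs and orderings. *)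
Lemma det_mul_rows p N (U : 'M[B]_(p, N)) (V : 'M[B]_(N, p)) :
  \det (U *m V) = \sum_(f : {ffun 'I_p -> 'I_N}) (\prod_i U i (f i)) * \det (rowsub f V).
Proof.
transitivity (\sum_(s : 'S_p) \sum_(f : {ffun 'I_p -> 'I_N})
    (-1) ^+ s * \prod_i (U i (f i) * V (f i) (s i))).
  apply: eq_bigr => s _; rewrite -mulr_sumr; congr (_ * _).
  rewrite -(bigA_distr_bigA (fun i l => U i l * V l (s i))).
  by apply: eq_bigr => i _; rewrite mxE.
rewrite exchange_big; apply: eq_bigr => f _ /=; rewrite mulr_sumr; apply: eq_bigr => s _.
rewrite big_split /= mulrCA; congr (_ * (_ * _)).
by apply: eq_bigr => i _; rewrite mxE.
Qed.

Section Columns.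
Variables (p m : nat) (io : 'I_p -> 'I_m) (X : 'M[B]_m).
Hypothesis io_inj : injective io.

Lemma pick_io j : [pick j' | io j' == io j] = Some j.
Proof.
case: pickP => [j' /eqP/io_inj->//|/(_ j)]; by rewrite eqxx.
Qed.

Definition unit_cols (f : 'I_p -> 'I_m) : 'M[B]_m :=
  \matrix_(h, c) if [pick j | io j == c] is Some j then (h == f j)%:R else X h c.

Lemma det_cols : \det X = \sum_(f : {ffun 'I_p -> 'I_m})
  (\prod_j X (f j) (io j)) * \det (unit_cols f).
Proof.
rewrite -det_tr; under [RHS]eq_bigr => f _ do rewrite -det_tr /determinant mulr_sumr.
rewrite exchange_big; apply: eq_bigr => s _ /=.
rewrite (bigD1 [ffun j => s (io j)]) //= [X in _ + X]big1 ?addr0 => [|f ne].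
  rewrite mulrCA; congr (_ * _).
  have -> : \prod_j X ([ffun j0 => s (io j0)] j) (io j) =
      \prod_c (if [pick j | io j == c] is Some j then X (s c) c else 1).
    rewrite [RHS](bigID (mem (codom io))) /= [X in _ * X]big1 ?mulr1 => [|c cio].
      rewrite -[RHS]big_uniq; last by rewrite map_inj_uniq ?enum_uniq.
      by rewrite big_map big_enum; apply: eq_bigr => j _; rewrite pick_io ffunE.
    by case: pickP => // j /eqP e; rewrite -e codom_f in cio.
  rewrite -big_split; apply: eq_bigr => c _ /=; rewrite !mxE.
  by case: pickP => [j /eqP e|_]; rewrite ?mul1r // ffunE e eqxx mulr1.
have [j nj] : exists j, f j != s (io j).
  apply/existsP; rewrite -[[exists _, _]]negbK negb_exists; apply/negP => /forallP h.
  case/eqP: ne; apply/ffunP => j; rewrite ffunE; have := h j; by rewrite negbK => /eqP.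
rewrite (bigD1 (io j)) //= !mxE pick_io eq_sym (negPf nj) mul0r !mulr0 //.
Qed.

Let lift_fun (s : 'S_p) c := if [pick j | io j == c] is Some j then io (s j) else c.

Let lift_fun_io s j : lift_fun s (io j) = io (s j).
Proof. by rewrite /lift_fun pick_io. Qed.

Let lift_funN s c : (forall j, io j != c) -> lift_fun s c = c.
Proof. by move=> h; rewrite /lift_fun; case: pickP => // j; rewrite (negPf (h j)). Qed.

Let lift_funP c : (exists j, c = io j) \/ forall j, io j != c.
Proof.
have [/existsP[j /eqP e]|/existsPn h] := boolP [exists j, io j == c]; first by left; exists j.
by right.
Qed.

Let lift_fun_inj s : injective (lift_fun s).
Proof.
move=> c d; case: (lift_funP c) => [[j ->]|hc]; case: (lift_funP d) => [[i ->]|hd];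
  rewrite ?lift_fun_io ?lift_funN //.
- by move/io_inj/perm_inj->.
- by move=> e; case/eqP: (hd (s j)).
- by move=> e; case/eqP: (hc (s i)).
Qed.

Let liftp s : 'S_m := perm (@lift_fun_inj s).

Let liftpM s t : liftp (s * t)%g = (liftp s * liftp t)%g.
Proof.
apply/perm.permP => c; rewrite permM !permE; case: (lift_funP c) => [[j ->]|hc].
  by rewrite !lift_fun_io permM.
by rewrite !lift_funN.
Qed.

(** Transpositions lift to transpositions, and every permutation is a product of them. *)
Let odd_liftp s : odd_perm (liftp s) = odd_perm s.
Proof.
have [ts -> hts] := prod_tpermP s; elim: ts hts => [_|t ts IH /= /andP[t0 hts]].
  rewrite big_nil odd_perm1; have -> : liftp 1 = 1%g; last by rewrite odd_perm1.
  apply/perm.permP => c; rewrite permE perm1; case: (lift_funP c) => [[j ->]|/lift_funN->//].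
  by rewrite lift_fun_io perm1.
rewrite big_cons liftpM !odd_permM IH //; congr (_ (+) _); rewrite odd_tperm t0.
have -> : liftp (tperm t.1 t.2) = tperm (io t.1) (io t.2).
  apply/perm.permP => c; rewrite permE; case: (lift_funP c) => [[j ->]|hc].
    rewrite lift_fun_io; case: tpermP => [->|->|/eqP n1 /eqP n2]; rewrite ?tpermL ?tpermR //.
    by rewrite tpermD // (inj_eq io_inj) eq_sym.
  by rewrite lift_funN // tpermD.
by rewrite odd_tperm (inj_eq io_inj) t0.
Qed.

Lemma det_unit_cols_perm f (s : 'S_p) :
  \det (unit_cols (f \o s)) = (-1) ^+ s * \det (unit_cols f).
Proof.
have -> : unit_cols (f \o s) = col_perm (liftp s) (unit_cols f).
  apply/matrixP => h c; rewrite !mxE permE; case: (lift_funP c) => [[j ->]|hc].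
    by rewrite lift_fun_io !pick_io.
  by rewrite lift_funN //; case: pickP => // j; rewrite (negPf (hc j)).
by rewrite col_permE det_mulmx det_perm odd_permV odd_liftp mulrC.
Qed.

(** Laplace expansion along the columns [io]. Adding up the multilinear expansion over all
    permutations of these columns turns the products of entries into minors; the factor p! is the
    number of permutations. *)
Lemma det_cols_rows : p`!%:R * \det X = \sum_(f : {ffun 'I_p -> 'I_m})
  \det (unit_cols f) * \det (\matrix_(i, j) X (f i) (io j)).
Proof.
have E (s : 'S_p) : \det X = \sum_(f : {ffun 'I_p -> 'I_m})
    (-1) ^+ s * (\prod_j X (f (s j)) (io j)) * \det (unit_cols f).
  pose h (f : {ffun 'I_p -> 'I_m}) : {ffun 'I_p -> 'I_m} := [ffun j => f (s j)].
  have hb : bijective h.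
    exists (fun f : {ffun 'I_p -> 'I_m} => [ffun j => f ((s^-1)%g j)]) => f; apply/ffunP => j; rewrite !ffunE.
      by rewrite permKV.
    by rewrite permK.
  rewrite det_cols (reindex h) /=; last by case: hb => h' ? ?; exists h' => f _.
  apply: eq_bigr => f _; rewrite -mulrA mulrCA; congr (_ * _); first by apply: eq_bigr => j _; rewrite ffunE.
  rewrite -det_unit_cols_perm; congr (\det _); apply/matrixP => a c; rewrite !mxE.
  by case: pickP => // j _; rewrite ffunE.
transitivity (\sum_(s : 'S_p) \det X).
  by rewrite sumr_const card_Sn mulr_natl.
rewrite (eq_bigr _ (fun s _ => E s)) exchange_big; apply: eq_bigr => f _ /=.
rewrite -mulr_suml mulrC; congr (_ * _); rewrite -det_tr; apply: eq_bigr => s _.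
by congr (_ * _); apply: eq_bigr => j _; rewrite !mxE.
Qed.

End Columns.
End Expansions.

Section Representable.
Variables (k : fieldType) (N q : nat).

(** A single form over k has to compute [Phi] over all k-algebras B, since it will serve as an
    equation for points with values in any of them. *)
Definition minor_form d (Phi : forall B : comNzRingType, {rmorphism k -> B} -> 'M[B]_(N, q) -> B) :=
  exists2 F : plucker_ring k N q, F \is d.-homog & forall (B : comNzRingType) (iB : {rmorphism k -> B}) M, ev iB M F = Phi B iB M.

Lemma minor_form_ext d Phi Phi' : (forall (B : comNzRingType) iB M, Phi B iB M = Phi' B iB M) -> minor_form d Phi -> minor_form d Phi'.
Proof. by move=> e [F hF eF]; exists F => // B iB M; rewrite eF. Qed.

Lemma minor_form_const c : minor_form 0 (fun (B : comNzRingType) iB _ => iB c).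
Proof.
exists c%:MP => [|B iB M]; last by rewrite /ev mmapC.
by rewrite -alg_mpolyC; apply: rpredZ; exact: dhomog1.
Qed.

Lemma minor_form_mul d1 d2 P1 P2 : minor_form d1 P1 -> minor_form d2 P2 -> minor_form (d1 + d2) (fun (B : comNzRingType) iB M => P1 B iB M * P2 B iB M).
Proof.
move=> [F1 h1 e1] [F2 h2 e2]; exists (F1 * F2) => [|B iB M]; first exact: dhomogM.
by rewrite -e1 -e2 /ev rmorphM.
Qed.

Lemma minor_form_sum d (I : finType) (Phi : I -> forall B : comNzRingType, {rmorphism k -> B} -> 'M[B]_(N, q) -> B) :
  (forall i, minor_form d (Phi i)) -> minor_form d (fun (B : comNzRingType) iB M => \sum_i Phi i B iB M).
Proof.
move=> /(_ _)/cid2 h; exists (\sum_i s2val (h i)) => [|B iB M].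
  by apply: rpred_sum => i _; case: (h i).
by rewrite /ev rmorph_sum; apply: eq_bigr => i _ /=; case: (h i) => F ? /= <-.
Qed.

Lemma minor_form_scale d c Phi : minor_form d Phi -> minor_form d (fun (B : comNzRingType) iB M => iB c * Phi B iB M).
Proof. by move=> h; have := minor_form_mul (minor_form_const c) h. Qed.

End Representable.

Lemma plucker_var_homog (k : fieldType) N q (s : seq 'I_N) : plucker_var k q s \is 1.-homog.
Proof.
rewrite /plucker_var; case: insub => [S|]; last exact: rpred0.
have -> : (-1) ^+ inversions s * 'X_(enum_rank S) = ((-1) ^+ inversions s) *: 'X_(enum_rank S) :> plucker_ring k N q.
  by rewrite -mul_mpolyC rmorphXn rmorphN1.
by apply: rpredZ; rewrite dhomogX /= mdeg1.
Qed.

Lemma minor_form_rows (k : fieldType) N q (f : 'I_q -> 'I_N) :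
  minor_form (k := k) 1 (fun (B : comNzRingType) _ (M : 'M[B]_(N, q)) => \det (rowsub f M)).
Proof.
case: q f => [|q] f.
  have S0 : #|@set0 'I_N| == 0%N by rewrite cards0.
  exists 'X_(enum_rank (Sub set0 S0 : psubset N 0)) => [|B iB M]; first by rewrite dhomogX /= mdeg1.
  by rewrite /ev mmapX mmap1U enum_rankK /minor !det_mx00.
exists (plucker_var k q.+1 [seq f i | i <- enum 'I_q.+1]) => [|B iB M]; first exact: plucker_var_homog.
rewrite (ev_plucker_var _ _ (f ord0)); last by rewrite size_map size_enum_ord.
congr (\det _); apply/matrixP => i j; rewrite !mxE.
by rewrite (nth_map ord0) ?size_enum_ord // nth_ord_enum.
Qed.

Section BayerRep.
Variables (k : fieldType) (hk : [pchar k] =i pred0) (N q m : nat) (g : nat).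
Variables (io : 'I_g * 'I_q -> 'I_m) (io_inj : injective io) (Y : 'I_g -> 'M[k]_(m, N)).

Definition group_cols (S : {set 'I_g}) (E : 'M[k]_m) (B : comNzRingType)
    (iB : {rmorphism k -> B}) (M : 'M[B]_(N, q)) : 'M[B]_m :=
  \matrix_(h, c) if [pick lj | (lj.1 \in S) && (io lj == c)] is Some lj
    then (map_mx iB (Y lj.1) *m M) h lj.2 else iB (E h c).

Lemma pick_group (S : {set 'I_g}) lj : lj.1 \in S -> [pick lj' | (lj'.1 \in S) && (io lj' == io lj)] = Some lj.
Proof.
move=> lS; case: pickP => [lj' /andP[_ /eqP/io_inj->]//|/(_ lj)]; by rewrite lS eqxx.
Qed.

(** Laplace expansion along one group of columns splits off the maximal minors of Y l M, which are
    linear in those of M by Cauchy-Binet. In the complementary factors this group consists of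
    constant unit vectors, so one group less depends on M. The factor q! is inverted in k. *)
Lemma minor_form_group_cols d (S : {set 'I_g}) (E : 'M[k]_m) : #|S| = d ->
  minor_form d (fun (B : comNzRingType) (iB : {rmorphism k -> B}) (M : 'M[B]_(N, q)) => \det (group_cols S E iB M)).
Proof.
elim: d S E => [|d IH] S E.
  move=> /cards0_eq ->; apply: minor_form_ext (minor_form_const _ _ (\det E)) => B iB M.
  rewrite -det_map_mx; congr (\det _); apply/matrixP => h c; rewrite !mxE.
  by case: pickP => // lj; rewrite inE.
move=> cS; have [l lS] : exists l, l \in S by apply/card_gt0P; rewrite cS.
have cS' : #|S :\ l| = d by have := cardsD1 l S; rewrite lS cS => -[->].
pose iol j := io (l, j); have iol_inj : injective iol by move=> i j /io_inj[].
have f0 : (q`!%:R : k) != 0.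
  by move/pcharf0P: hk => ->; rewrite -lt0n fact_gt0.
pose E' (f : 'I_q -> 'I_m) : 'M[k]_m :=
  \matrix_(h, c) if [pick j | iol j == c] is Some j then (h == f j)%:R else E h c.
apply: (@minor_form_ext _ _ _ _ (fun (B : comNzRingType) (iB : {rmorphism k -> B}) (M : 'M[B]_(N, q)) => iB (q`!%:R)^-1 * \sum_(f : {ffun 'I_q -> 'I_m})
   \det (group_cols (S :\ l) (E' f) iB M) *
   \sum_(rho : {ffun 'I_q -> 'I_N}) iB (\prod_i Y l (f i) (rho i)) * \det (rowsub rho M))).
  move=> B iB M; set X := group_cols S E iB M.
  have -> : \det X = iB (q`!%:R)^-1 * (q`!%:R * \det X).
    by rewrite -(rmorph_nat iB) mulrA -rmorphM mulVf // rmorph1 mul1r.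
  rewrite (det_cols_rows _ iol_inj); congr (_ * _); apply: eq_bigr => f _; congr (_ * _).
    congr (\det _); apply/matrixP => h c; rewrite !mxE; case: (pickP (fun j => iol j == c)) => [j /eqP <-|nj].
      rewrite rmorph_nat; case: pickP => // lj /andP[] /[swap] /eqP/io_inj ->.
      by rewrite !inE eqxx.
    case: pickP => [lj /andP[ljS /eqP <-]|nS].
      by rewrite pick_group //; move: ljS; rewrite inE => /andP[].
    case: pickP => // lj /andP[ljS /eqP e]; have := nS lj; rewrite !inE ljS e eqxx andbT andbT => /negbFE/eqP el.
    by have := nj lj.2; rewrite /iol -el -e -surjective_pairing eqxx.
  have -> : \matrix_(i, j) X (f i) (iol j) = (\matrix_(i, l') iB (Y l (f i) l')) *m M.
    apply/matrixP => i j; rewrite !mxE pick_group //= !mxE; apply: eq_bigr => l' _; by rewrite !mxE.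
  rewrite det_mul_rows; apply: eq_bigr => rho _; congr (_ * _).
  by rewrite rmorph_prod; apply: eq_bigr => i _; rewrite mxE.
apply: minor_form_scale; apply: minor_form_sum => f; rewrite -addn1; apply: minor_form_mul; first exact: IH.
by apply: minor_form_sum => rho; apply: minor_form_scale; apply: minor_form_rows.
Qed.

End BayerRep.

(** * The equations *)

Lemma det_mul_small (B : comNzRingType) m m' (U : 'M[B]_(m, m')) (V : 'M[B]_(m', m)) :
  (m' < m)%N -> \det (U *m V) = 0.
Proof.
move=> lt; rewrite det_mul_rows big1 // => f _.
have [i [j [ij e]]] : exists i j, i != j /\ f i = f j.
  have [inj|] := boolP (injectiveb f).
    by move/injectiveP/leq_card: inj; rewrite !card_ord leqNgt lt.
  by move/injectivePn => [i [j ij e]]; exists i, j.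
by rewrite (determinant_alternate ij) ?mulr0 // => l; rewrite !mxE e.
Qed.

Lemma sum_mxvec (V : nmodType) g N (F : 'I_(g * N) -> V) :
  \sum_t F t = \sum_l \sum_i F (mxvec_index l i).
Proof. by rewrite (reindex _ (curry_mxvec_bij _ _)) /= pair_bigA; apply: eq_bigr => -[]. Qed.

Section Kronecker.
Variables (B : comNzRingType) (g : nat).

(** The Kronecker product of the identity of size g with M; the nested [mxvec] serve to index rows
    and columns by pairs. *)
Definition kron1 a b (M : 'M[B]_(a, b)) : 'M[B]_(g * a, g * b) :=
  \matrix_(t, d) mxvec (\matrix_(l, i) mxvec (\matrix_(l', j) ((l == l')%:R * M i j)) 0 d) 0 t.

Lemma kron1E a b (M : 'M[B]_(a, b)) l i l' j :
  kron1 M (mxvec_index l i) (mxvec_index l' j) = (l == l')%:R * M i j.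
Proof. by rewrite mxE mxvecE mxE mxvecE mxE. Qed.

Lemma kron1_mul a b c (M : 'M[B]_(a, b)) (M' : 'M[B]_(b, c)) :
  kron1 M *m kron1 M' = kron1 (M *m M').
Proof.
apply/matrixP => t d; case/mxvec_indexP: t => l i; case/mxvec_indexP: d => l' j.
rewrite mxE sum_mxvec kron1E (bigD1 l) //= [X in _ + X]big1 ?addr0 => [|l1 l1l]; last first.
  by rewrite big1 // => i1 _; rewrite kron1E eq_sym (negPf l1l) !mul0r.
by rewrite mxE mulr_sumr; apply: eq_bigr => i1 _; rewrite !kron1E eqxx mul1r mulrCA.
Qed.

Lemma kron1_1 a : kron1 (1%:M : 'M[B]_a) = 1%:M.
Proof.
apply/matrixP => t d; case/mxvec_indexP: t => l i; case/mxvec_indexP: d => l' j.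
rewrite kron1E !mxE -natrM mulnb; congr (_%:R); congr nat_of_bool.
apply/andP/eqP => [[/eqP-> /eqP->]//|e].
have inj : injective (uncurry (@mxvec_index g a)) by apply: bij_inj; apply: onT_bij; exact: curry_mxvec_bij.
by have [-> ->] := inj (l, i) (l', j) e.
Qed.

End Kronecker.

Section BayerMatrix.
Variables (k : fieldType) (n r q Q : nat).
Local Notation N := (Nmon n r).
Local Notation N' := (Nmon n r.+1).
Variables (lam : 'M[k]_(N', Q)).

Section Ring.
Variables (B : comNzRingType) (iB : {rmorphism k -> B}) (M : 'M[B]_(N, q)).

Definition functional (F : {mpoly B[n.+1]}) : 'rV[B]_Q := row_of_form r.+1 F *m map_mx iB lam.

Lemma functional_lin a F G : functional (a *: F + G) = a *: functional F + functional G.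
Proof. by rewrite /functional row_of_form_lin mulmxDl scalemxAl. Qed.

Lemma functional0 : functional 0 = 0.
Proof. by have := functional_lin (-1) 0 0; rewrite scaler0 add0r scaleN1r addNr. Qed.

Lemma functional_sum (I : Type) (s : seq I) (c : I -> B) F :
  functional (\sum_(i <- s) c i *: F i) = \sum_(i <- s) c i *: functional (F i).
Proof.
elim: s => [|i s IH]; first by rewrite !big_nil functional0.
by rewrite !big_cons functional_lin IH.
Qed.

Definition mul_cols : 'M[B]_(n.+1 * N, Q) :=
  \matrix_(t, a) mxvec (\matrix_(l, i) functional ('X_l * 'X_[monomial i]) 0 a) 0 t.

(* The rows represent the forms x_l m, m a monomial of degree r, in R^Q
   (through the functionals lam) and m in the l-th copy of R^N/L. *)
Definition bayer_mx : 'M[B]_(n.+1 * N, Q + n.+1 * q) := row_mx mul_cols (kron1 n.+1 M).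

Lemma mul_colsE l i a : mul_cols (mxvec_index l i) a = functional ('X_l * 'X_[monomial i]) 0 a.
Proof. by rewrite mxE mxvecE mxE. Qed.

Lemma mul_cols_row m (u : 'I_m -> 'I_n.+1 -> 'rV[B]_N) h a :
  ((\matrix_(h < m) mxvec (\matrix_l u h l)) *m mul_cols) h a =
  functional (\sum_l 'X_l * form_of_row (u h l)) 0 a.
Proof.
rewrite mxE sum_mxvec.
rewrite -[\sum_l 'X_l * _](eq_bigr _ (fun l _ => scale1r ('X_l * form_of_row (u h l)))).
rewrite functional_sum summxE; apply: eq_bigr => l _; rewrite scale1r.
have -> : 'X_l * form_of_row (u h l) = \sum_i (u h l) 0 i *: ('X_l * 'X_[monomial i]).
  by rewrite mulr_sumr; apply: eq_bigr => i _; rewrite -scalerAr.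
rewrite functional_sum summxE; apply: eq_bigr => i _; rewrite mul_colsE !mxE.
by congr (_ * _); rewrite mxvecE !mxE.
Qed.

End Ring.

(** The columns given by the functionals are constants of k, and the l-th of the n + 1 remaining
    groups is Y l M, with Y l selecting the rows of the form x_l m. *)
Lemma minor_form_bayer (hk : [pchar k] =i pred0) (f : 'I_(Q + n.+1 * q) -> 'I_(n.+1 * N)) :
  minor_form n.+1 (fun (B : comNzRingType) (iB : {rmorphism k -> B}) (M : 'M[B]_(N, q)) =>
    \det (rowsub f (bayer_mx iB M))).
Proof.
pose io (lj : 'I_n.+1 * 'I_q) : 'I_(Q + n.+1 * q) := rshift Q (mxvec_index lj.1 lj.2).
have io_inj : injective io.
  move=> lj lj' /rshift_inj e; have inj : injective (uncurry (@mxvec_index n.+1 q)).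
    by apply: bij_inj; apply: onT_bij; exact: curry_mxvec_bij.
  by apply: inj; case: lj lj' e => [? ?] [? ?].
pose Y l : 'M[k]_(Q + n.+1 * q, N) := \matrix_(h, i) (f h == mxvec_index l i)%:R.
(* The zero block is a placeholder: all the groups belong to [setT], so their columns are read from
   M. *)
pose E : 'M[k]_(Q + n.+1 * q) := rowsub f (row_mx (mul_cols idfun) 0).
have := minor_form_group_cols hk io_inj Y E (cardsT 'I_n.+1); rewrite card_ord.
apply: minor_form_ext => B iB M; congr (\det _); apply/matrixP => h c.
rewrite [RHS]mxE [LHS]mxE; case: (split_ordP c) => [a ->|d ->].
  case: pickP => [lj /andP[_ /eqP e]|_]; first by have := congr1 val e; rewrite /=; have := ltn_ord a; lia.
  rewrite mxE /bayer_mx !row_mxEl; case/mxvec_indexP: (f h) => l i; rewrite !mul_colsE.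
  rewrite /functional !mxE rmorph_sum; apply: eq_bigr => t _; rewrite !mxE rmorphM; congr (_ * _).
  by rewrite -!mpolyXD !mcoeffX rmorph_nat.
case/mxvec_indexP: d => l j.
have := @pick_group _ _ _ io io_inj setT (l, j) (in_setT _); rewrite /io /= => ->.
rewrite /bayer_mx row_mxEr mxE.
have inj : injective (uncurry (@mxvec_index n.+1 N)) by apply: bij_inj; apply: onT_bij; exact: curry_mxvec_bij.
have [l' [i e]] : exists l' i, f h = mxvec_index l' i by case/mxvec_indexP: (f h) => l' i; exists l', i.
rewrite e kron1E (bigD1 i) //= big1 => [|i' i'i]; rewrite !mxE e.
  rewrite addr0; congr (_ * _); rewrite rmorph_nat; congr (_%:R); congr nat_of_bool.
  by apply/eqP/eqP => [/(inj (l', i) (l, i))[]|->].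
rewrite [_ == _](_ : _ = false) ?rmorph0 ?mul0r //; apply/negP => /eqP/(inj (l', i) (l, i'))[_ ei].
by rewrite ei eqxx in i'i.
Qed.

End BayerMatrix.

Section BayerMinors.
Variables (k : fieldType) (n r q Q : nat) (lam : 'M[k]_(Nmon n r.+1, Q)).
Variables (R : comNzRingType) (iR : {rmorphism k -> R}).
Variables (M : 'M[R]_(Nmon n r, q)) (Z : 'M[R]_(q, Nmon n r)).
Hypothesis ZM : Z *m M = 1%:M.

(* Subtracting from each monomial its representative in the span of Z leaves a
   form of L; so the Bayer matrix factors through a free module of rank
   |T'| + (n + 1) q. *)
Lemma bayer_minors_eq0 (L : {mpoly R[n.+1]} -> Prop) (g : 'M[k]_n.+1) T' f :
  form_space r L -> g \in unitmx -> graph_over r.+1 T' (pre iR g (gen L 1)) ->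
  (forall i, L (form_of_row (delta_mx 0 i - row i M *m Z))) ->
  (size (cols n r.+1 T') < Q)%N -> \det (rowsub f (bayer_mx lam iR M)) = 0.
Proof.
move=> hL ug gT hZ lt; set cs := cols n r.+1 T'.
have fs := gen_form hL 1; rewrite addn1 in fs.
have [E hE] := graph_basis gT.
pose y l i : {mpoly R[n.+1]} := 'X_l * form_of_row (delta_mx 0 i - row i M *m Z).
have yL l i : gen L 1 (y l i) by apply: (gen_mul hL (j := 0)); apply: hZ.
have yE l i : y l i = \sum_(a < size cs) (act iR (invmx g) (y l i))@_(nth 0%MM cs a) *: act iR g (E (nth 0%MM cs a)).
  have h : pre iR g (gen L 1) (act iR (invmx g) (y l i)).
    by rewrite /pre act_mul mulVmx // act1.
  rewrite -[LHS](@act1 k n R iR) -(mulVmx ug) -act_mul {1}(graph_expand (pre_submodule iR g fs.1) gT hE h).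
  by rewrite act_sum (big_nth 0%MM) big_mkord; apply: eq_bigr => a _; rewrite actZ.
pose H : 'M[R]_(n.+1 * Nmon n r, size cs) :=
  \matrix_(t, a) mxvec (\matrix_(l, i) (act iR (invmx g) (y l i))@_(nth 0%MM cs a)) 0 t.
pose W1 : 'M[R]_(size cs, Q) := \matrix_(a, b) functional lam iR (act iR g (E (nth 0%MM cs a))) 0 b.
pose W2 : 'M[R]_(n.+1 * q, Q) :=
  \matrix_(d, b) mxvec (\matrix_(l, j) functional lam iR ('X_l * form_of_row (row j Z)) 0 b) 0 d.
have -> : bayer_mx lam iR M = row_mx H (kron1 n.+1 M) *m block_mx W1 0 W2 1%:M.
  rewrite mul_row_block mulmx0 add0r mulmx1; congr row_mx.
  apply/matrixP => t b; case/mxvec_indexP: t => l i; rewrite mul_colsE [RHS]mxE.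
  have -> : 'X_l * 'X_[monomial i] = 1 *: y l i + \sum_j M i j *: ('X_l * form_of_row (row j Z)) :> {mpoly R[n.+1]}.
    have e1 : 'X_[monomial i] = form_of_row (delta_mx 0 i) :> {mpoly R[n.+1]}.
      rewrite /form_of_row (bigD1 i) //= big1 => [|i' i'i]; rewrite mxE eqxx /=.
        by rewrite eqxx scale1r addr0.
      by rewrite (negPf i'i) scale0r.
    have e2 : \sum_j M i j *: form_of_row (row j Z) = form_of_row (row i M *m Z).
      rewrite /form_of_row; under eq_bigr do rewrite scaler_sumr; rewrite exchange_big; apply: eq_bigr => i' _ /=.
      rewrite mxE scaler_suml; apply: eq_bigr => j _; by rewrite scalerA !mxE.
    rewrite scale1r; under eq_bigr do rewrite scalerAr; rewrite -mulr_sumr e2 -mulrDr; congr (_ * _).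
    rewrite e1 -[form_of_row (_ - _)]scale1r -form_of_row_lin scale1r.
    by rewrite subrK.
  rewrite functional_lin scale1r [LHS]mxE; congr (_ + _).
    rewrite yE functional_sum summxE [RHS]mxE; apply: eq_bigr => a _.
    by rewrite [LHS]mxE [in RHS]mxE [W1 _ _]mxE mxvecE mxE.
  rewrite functional_sum summxE [RHS]mxE sum_mxvec (bigD1 l) //= [X in _ + X]big1 ?addr0 => [|l' l'l]; last first.
    by rewrite big1 // => j _; rewrite kron1E eq_sym (negPf l'l) !mul0r.
  by apply: eq_bigr => j _; rewrite kron1E eqxx mul1r [LHS]mxE [W2 _ _]mxE mxvecE mxE.
have -> : rowsub f (row_mx H (kron1 n.+1 M) *m block_mx W1 0 W2 1%:M) =
    rowsub f (row_mx H (kron1 n.+1 M)) *m block_mx W1 0 W2 1%:M.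
  by apply/matrixP => h c; rewrite !mxE; apply: eq_bigr => l _; rewrite !mxE.
by apply: det_mul_small; rewrite ltn_add2r.
Qed.

(** The Bayer matrix is multiplied on the left by rows that represent the sums of the x_l F a l,
    killed by M, and by rows made of Z. The product is block triangular with an identity block, and
    by Cauchy-Binet its determinant is a combination of the maximal minors. *)
Lemma bayer_minors_multiples (F : 'I_Q -> 'I_n.+1 -> {mpoly R[n.+1]}) :
  (forall f, \det (rowsub f (bayer_mx lam iR M)) = 0) ->
  (forall a l, F a l \is r.-homog) -> (forall a l, row_of_form r (F a l) *m M = 0) ->
  \det (\matrix_(a < Q, b < Q) functional lam iR (\sum_l 'X_l * F a l) 0 b) = 0.
Proof.
move=> h hF FM.
pose u a l : 'rV[R]_(Nmon n r) := row_of_form r (F a l).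
pose U : 'M[R]_(Q, n.+1 * Nmon n r) := \matrix_a mxvec (\matrix_l u a l).
have : \det (col_mx U (kron1 n.+1 Z) *m bayer_mx lam iR M) = 0.
  by rewrite det_mul_rows big1 // => f _; rewrite h mulr0.
rewrite /bayer_mx mul_col_row kron1_mul ZM kron1_1.
have -> : U *m kron1 n.+1 M = 0.
  apply/matrixP => a d; case/mxvec_indexP: d => l' j.
  rewrite mxE sum_mxvec mxE (bigD1 l') //= [X in _ + X]big1 ?addr0 => [|l1 l1l]; last first.
    by rewrite big1 // => i _; rewrite kron1E (negPf l1l) mul0r mulr0.
  have -> : \sum_i U a (mxvec_index l' i) * kron1 n.+1 M (mxvec_index l' i) (mxvec_index l' j) = (u a l' *m M) 0 j.
    by rewrite mxE; apply: eq_bigr => i _; rewrite kron1E eqxx mul1r !mxE mxvecE !mxE.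
  by rewrite FM mxE.
rewrite det_lblock det1 mulr1 => <-; congr (\det _); apply/matrixP => a b.
rewrite mul_cols_row mxE; congr (functional _ _ _ 0 b).
by apply: eq_bigr => l _; rewrite row_of_formK.
Qed.

End BayerMinors.

(** * Points satisfying the equations *)

Section Stable.
Variables (n r : nat) (R : comNzRingType) (T : pred (seq nat)) (F : 'X_{1..n.+1} -> {mpoly R[n.+1]}).
Hypothesis hF : forall i u, mdeg u = r -> T u -> multiples r T F 1 ('X_i * F u).

(* A product x_i x_b F with b < i is rewritten by the relations in degree r + 1;
   the relation brings in x_c with b <= c, or with c < b and then b decreases. *)
Lemma multiples_mulX j i G : multiples r T F j G -> multiples r T F j.+1 ('X_i * G).
Proof.
have sub j1 i1 : is_submodule (fun G => multiples r T F j1 ('X_i1 * G)).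
  have hs := multiples_submodule r T F j1.
  split=> [|G1 G2|c G1]; [rewrite mulr0; exact: submodule0 | rewrite mulrDr; exact: submoduleD |].
  by rewrite -scalerAr; apply: submoduleZ.
elim: j i G => [|j IH] i G; first by apply: (multiples_min (sub 1%N i)) => w; rewrite addn0 => dw Tw; exact: hF.
have step b : forall i w, mdeg w = (r + j)%N -> iter j shift T w ->
    (forall l : 'I_n.+1, (l < b)%N -> w l = 0%N) -> forall (bn : (b < n.+1)%N),
    multiples r T F j.+2 ('X_i * ('X_(Ordinal bn) * multiple F j w)).
  elim/ltn_ind: b => b IHb i1 w dw Tw wb bn; set ob := Ordinal bn.
  have canon (c i2 : 'I_n.+1) v : (i2 <= c)%N -> mdeg v = (r + j)%N -> iter j shift T v ->
      (forall l : 'I_n.+1, (l < c)%N -> v l = 0%N) ->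
      multiples r T F j.+2 ('X_i2 * ('X_c * multiple F j v)).
    move=> ic dv Tv vc; rewrite -multipleS // -multipleS; last first.
      by move=> l li; rewrite mnmDE mnm1E vc ?(leq_trans li) // addn0; case: eqP => // e; rewrite -e ltnNge ic in li.
    apply: multiple_multiples.
      by rewrite !mdegD !mdeg1 dv; lia.
    rewrite !iterS shift_addU ?shift_addU // => l li.
    by rewrite mnmDE mnm1E vc ?(leq_trans li) // addn0; case: eqP => // e; rewrite -e ltnNge ic in li.
  have [ib|bi] := leqP i1 b; first exact: canon.
  rewrite mulrCA; have := IH i1 _ (multiple_multiples F dw Tw).
  apply: (multiples_min (sub j.+2 ob)) => w'; rewrite addnS => dw'.
  rewrite iterS => /shift_mnmP[c [v [e Tv vc]]]; rewrite {}e in dw' *.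
  have dv : mdeg v = (r + j)%N by move: dw'; rewrite mdegD mdeg1; lia.
  rewrite multipleS //; have [bc|cb] := leqP b c; first exact: canon.
  have := IHb c cb ob v dv Tv vc (ltn_ord c).
  by have -> : Ordinal (ltn_ord c) = c by apply: val_inj.
apply: (multiples_min (sub j.+2 i)) => w; rewrite addnS => dw.
rewrite iterS => /shift_mnmP[c [v [e Tv vc]]]; rewrite {}e in dw *.
have dv : mdeg v = (r + j)%N by move: dw; rewrite mdegD mdeg1; lia.
rewrite multipleS //; have := step c i v dv Tv vc (ltn_ord c).
by have -> : Ordinal (ltn_ord c) = c by apply: val_inj.
Qed.

End Stable.

(** As g has entries in k, reading coefficients in the new coordinates is a functional defined over
    k, hence among those for which the equations are imposed. *)
Lemma functional_act (k : fieldType) n r Q (R : comNzRingType) (iR : {rmorphism k -> R})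
    (g : 'M[k]_n.+1) (w : 'I_Q -> 'X_{1..n.+1}) :
  exists lam : 'M[k]_(Nmon n r, Q), forall F : {mpoly R[n.+1]}, F \is r.-homog -> forall b,
    (row_of_form r F *m map_mx iR lam) 0 b = (act iR g F)@_(w b).
Proof.
exists (\matrix_(i, b) (act idfun g 'X_[monomial i])@_(w b)) => F hF b.
rewrite -[in RHS](row_of_formK hF) /form_of_row act_sum raddf_sum mxE; apply: eq_bigr => i _ /=.
rewrite actZ mcoeffZ [(map_mx _ _) _ _]mxE [X in iR X]mxE; congr (_ * _).
have <- : map_mpoly iR (act idfun g 'X_[monomial i]) = act iR g 'X_[monomial i].
  by rewrite (act_map (iS := iR)) // map_mpolyX.
by rewrite mcoeff_map_mpoly.
Qed.

Section LocalConverse.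
Variables (k : fieldType) (hk : [pchar k] =i pred0) (n r : nat) (a : nat -> nat).
Hypotheses (na : noninc a) (le1 : (gbinom a r r.+1 <= 'C(n + r.+1, n))%N).
Variables (R : comNzRingType) (K : fieldType) (chi : {rmorphism R -> K}) (loc : local_to chi).
Variables (iR : {rmorphism k -> R}) (L : {mpoly R[n.+1]} -> Prop).
Hypothesis hL : form_space r L.
Variables (p : nat) (ep : p = gbinom a r r).
Variables (M : 'M[R]_(Nmon n r, p)) (Z : 'M[R]_(p, Nmon n r)).
Hypotheses (ZM : Z *m M = 1%:M)
  (ML : forall F, F \is r.-homog -> row_of_form r F *m M = 0 <-> L F).

(** The expected rank of the space of multiples in degree r + 1; by [le1] the subtraction is not
    truncated. The equations bound the rank by it, hence the Q + 1 functionals. *)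
Let Q := ('C(n + r.+1, n) - gbinom a r r.+1)%N.
Hypothesis minors : forall (lam : 'M[k]_(Nmon n r.+1, Q + 1)) f,
  \det (rowsub f (bayer_mx lam iR M)) = 0.

Let row_act (S : comNzRingType) (iS : {rmorphism k -> S}) (g : 'M[k]_n.+1) (F : {mpoly S[n.+1]}) :=
  row_of_form r (act iS g F).

(** Generic coordinates are taken for the kernel of M over K. Its codimension is p, so p monomials
    lie outside T, and M restricted to them is invertible over K, hence over the local ring R; this
    makes L itself a graph over T. *)
Lemma bayer_generic_coordinates : exists (g : 'M[k]_n.+1) (T : pred (seq nat))
    (F : 'X_{1..n.+1} -> {mpoly R[n.+1]}),
  [/\ g \in unitmx, borel n.+1 r T, colen n.+1 r T = gbinom a r r, graph_over r T (pre iR g L) &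
     [/\ forall u, mdeg u = r -> T u -> pre iR g L (F u) /\
                   forall v, mdeg v = r -> T v -> (F u)@_v = (v == u)%:R,
      forall u, mdeg u = r -> T u -> chi (F u)@_u = 1 &
      forall u v, mdeg u = r -> T u -> chi (F u)@_v <> 0 -> v = u \/ (u < v)%O]].
Proof.
pose iK : {rmorphism k -> K} := chi \o iR; pose MK := map_mx chi M; pose ZK := map_mx chi Z.
have ZMK : ZK *m MK = 1%:M by rewrite -map_mxM ZM map_mx1.
pose LK (F : {mpoly K[n.+1]}) := F \is r.-homog /\ row_of_form r F *m MK = 0.
have hLK : form_space r LK.
  split=> [|F []//]; split=> [|F G [hF eF] [hG eG]|c F [hF eF]]; split.
  - exact: rpred0.
  - by apply/rowP => i; rewrite mxE big1 ?mxE // => j _; rewrite mxE mcoeff0 mul0r.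
  - exact: rpredD.
  - have := row_of_form_lin r 1 F G; rewrite !scale1r => ->.
    by rewrite mulmxDl eF eG addr0.
  - exact: rpredZ.
  - have := row_of_form_lin r c F 0; rewrite addr0 => ->.
    rewrite mulmxDl -scalemxAl eF scaler0 add0r.
    by apply/rowP => i; rewrite mxE big1 ?mxE // => j _; rewrite mxE mcoeff0 mul0r.
have [g [T [ug gK tri bf]]] := gin iK hk hLK.
have qd : quotient_dim r (pre iK g LK) p.
  apply: pre_quotient_dim => //; exists (fun j => form_of_row (row j ZK)); split.
    by move=> j; exact: form_of_row_homog.
  move=> F hF; have E (c : 'rV[K]_p) : row_of_form r (F - \sum_j c 0 j *: form_of_row (row j ZK)) *m MK =
      row_of_form r F *m MK - c.
    have -> : row_of_form r (F - \sum_j c 0 j *: form_of_row (row j ZK)) = row_of_form r F - c *m ZK.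
      apply/rowP => i; rewrite !mxE mcoeffB raddf_sum /=; congr (_ - _); apply: eq_bigr => j _.
      by rewrite mcoeffZ form_of_rowE mxE.
    by rewrite mulmxBl -mulmxA ZMK mulmx1.
  have hom (c : 'rV[K]_p) : F - \sum_j c 0 j *: form_of_row (row j ZK) \is r.-homog.
    by apply: rpredB => //; apply: rpred_sum => j _; apply: rpredZ; exact: form_of_row_homog.
  exists (row_of_form r F *m MK); split=> [|c [_]]; first by split; rewrite ?hom // E subrr.
  by rewrite E => /eqP; rewrite subr_eq0 => /eqP.
have fgK := pre_form_space iK ug hLK.
have cT : colen n.+1 r T = p.
  apply: (@addnI (size (cols n r T))).
  by rewrite size_cols (quotient_dim_graph fgK gK qd).
set cs := cols n r (predC T).
have scs : size cs = p by rewrite -cT size_filter; exact: (count_mons n r T).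
have csj (j : 'I_p) : nth 0%MM cs j \in cs by rewrite mem_nth // scs.
pose x (S : comNzRingType) (j : 'I_p) : {mpoly S[n.+1]} := 'X_[nth 0%MM cs j].
have xh (S : comNzRingType) j : x S j \is r.-homog.
  by rewrite dhomogX /= -mem_mons; have := csj j; rewrite mem_cols mem_mons => /andP[].
pose M' : 'M[R]_p := \matrix_j (row_act iR g (x R j) *m M).
have [e he] : exists e, \det M' * e = 1.
  apply: loc; rewrite -det_map_mx; apply/negP => /det0P[c c0 hc]; case/eqP: c0.
  pose F : {mpoly K[n.+1]} := \sum_j c 0 j *: x K j.
  have rF : row_act iK g F *m MK = c *m map_mx chi M'.
    have -> : row_act iK g F = \sum_j c 0 j *: row_act iK g (x K j).
      apply/rowP => i; rewrite mxE act_sum raddf_sum summxE; apply: eq_bigr => j _ /=.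
      by rewrite !mxE actZ mcoeffZ.
    rewrite mulmx_suml; apply/rowP => i; rewrite summxE [RHS]mxE; apply: eq_bigr => j _.
    rewrite -scalemxAl mxE; congr (_ * _); rewrite [RHS]mxE [M' _ _]mxE [LHS]mxE [X in chi X]mxE rmorph_sum.
    apply: eq_bigr => i' _; rewrite rmorphM !mxE; congr (_ * _).
    by rewrite -[x K j](map_mpolyX chi) -(act_map (iR := iR)) // mcoeff_map_mpoly.
  have F0 : F = 0.
    apply: gK.2.
      rewrite /pre; split; first by apply: act_homog; apply: rpred_sum => j _; apply: rpredZ; exact: xh.
      by rewrite -/(row_act iK g F) rF hc.
    move=> v dv Tv; rewrite raddf_sum big1 // => j _; rewrite /= mcoeffZ mcoeffX.
    case: eqP => [ev|]; last by rewrite mulr0.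
    by have := csj j; rewrite mem_cols ev /= Tv andbF.
  apply/rowP => j; rewrite mxE; have := congr1 (mcoeff (nth 0%MM cs j)) F0.
  rewrite mcoeff0 raddf_sum /= (bigD1 j) //= big1 => [|i ij].
    by rewrite addr0 mcoeffZ mcoeffX eqxx mulr1.
  by rewrite mcoeffZ mcoeffX nth_uniq ?uniq_cols ?scs // (inj_eq val_inj) (negPf ij) mulr0.
pose V := e *: \adj M'; have M'V : M' *m V = 1%:M.
  by rewrite -scalemxAr mul_mx_adj scale_scalar_mx mulrC he.
have VM' : V *m M' = 1%:M by rewrite -scalemxAl mul_adj_mx scale_scalar_mx mulrC he.
(* The coordinates of F, modulo L, on the monomials outside T; V is the inverse of the matrix M' of
   these monomials. *)
pose co (F : {mpoly R[n.+1]}) := row_act iR g F *m M *m V.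
have co_lin c F G : co (c *: F + G) = c *: co F + co G.
  by rewrite /co /row_act actD actZ row_of_form_lin !mulmxDl -!scalemxAl.
have co_x j : co (x R j) = delta_mx 0 j.
  by rewrite /co -[row_act iR g (x R j) *m M](rowK (fun j => row_act iR g (x R j) *m M)) -row_mul M'V row1.
have co_sum (c : 'rV[R]_p) : co (\sum_j c 0 j *: x R j) = c.
  have co0 : co 0 = 0 by have := co_lin (-1) 0 0; rewrite scaler0 add0r scaleN1r addNr.
  have -> : co (\sum_j c 0 j *: x R j) = \sum_j c 0 j *: co (x R j).
    by elim/big_rec2: _ => // j y1 y2 _ <-; rewrite co_lin.
  rewrite [RHS]row_sum_delta; by apply: eq_bigr => j _; rewrite co_x.
have coP F : F \is r.-homog -> co F = 0 <-> pre iR g L F.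
  move=> hF; rewrite /pre -(ML (act_homog iR g hF)) /co; split=> [h|->]; last by rewrite mul0mx.
  by rewrite -[LHS]mulmx1 -VM' mulmxA h mul0mx.
pose F u : {mpoly R[n.+1]} := 'X_[u] - \sum_j (co 'X_[u]) 0 j *: x R j.
have hF u : mdeg u = r -> F u \is r.-homog.
  move=> du; apply: rpredB; first by rewrite dhomogX /= du.
  by apply: rpred_sum => j _; apply: rpredZ; exact: xh.
have FL u : mdeg u = r -> pre iR g L (F u).
  move=> du; apply/(coP _ (hF u du)).
  have -> : F u = (-1) *: (\sum_j (co 'X_[u]) 0 j *: x R j) + 'X_[u] by rewrite scaleN1r addrC.
  by rewrite co_lin co_sum scaleN1r addNr.
have Fc (u v : 'X_{1..n.+1}) : T v -> (F u)@_v = (v == u)%:R.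
  move=> Tv; rewrite mcoeffB mcoeffX raddf_sum big1 ?subr0 1?eq_sym // => j _.
  rewrite /= mcoeffZ mcoeffX; case: eqP => [ev|]; last by rewrite mulr0.
  by have := csj j; rewrite mem_cols ev /= Tv andbF.
have fgR := pre_form_space iR ug hL.
exists g, T, F; split=> //.
- exact: borel_fixedP.
- by rewrite cT.
- split=> [u du Tu|G LG G0]; first by exists (F u) => [|v _ Tv]; [exact: FL | exact: Fc].
  have hG := fgR.2 _ LG.
  have e1 : G = \sum_j (\row_j G@_(nth 0%MM cs j)) 0 j *: x R j.
    rewrite {1}(homog_cols hG G0) (big_nth 0%MM) big_mkord scs; apply: eq_bigr => j _.
    by rewrite mxE.
  have /(coP _ hG) := LG; rewrite {1}e1 co_sum => /rowP z; rewrite e1 big1 // => j _.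
  by rewrite z mxE scale0r.
split=> [u du Tu|u du Tu|u v du Tu nz].
- by split=> [|v _ Tv]; [exact: FL | exact: Fc].
- by rewrite Fc // eqxx rmorph1.
apply: (tri u (map_mpoly chi (F u)) du Tu).
- rewrite /pre -(act_map (iR := iR)) //.
  have hom := act_homog iR g (hF u du).
  have h0 := (ML hom).2 (FL u du); split.
    apply/dhomogP_coeff => w; rewrite mcoeff_map_mpoly /= => h; apply: ((dhomogP_coeff r _).1 hom).
    by apply: contraNneq h => ->; rewrite rmorph0.
  have -> : row_of_form r (map_mpoly chi (act iR g (F u))) = map_mx chi (row_of_form r (act iR g (F u))).
    by apply/rowP => i; rewrite !mxE mcoeff_map_mpoly.
  by rewrite -map_mxM h0 map_mx0.
- by move=> w dw Tw; rewrite mcoeff_map_mpoly /= Fc // rmorph_nat.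
- by rewrite mcoeff_map_mpoly /=; apply/eqP.
Qed.

(** The meaning of the equations: the multiples of degree r + 1 have rank at most Q, in any
    coordinates over k. *)
Lemma bayer_gen_minors (g : 'M[k]_n.+1) (G : 'I_(Q + 1) -> {mpoly R[n.+1]}) (w : 'I_(Q + 1) -> 'X_{1..n.+1}) :
  g \in unitmx -> (forall b, pre iR g (gen L 1) (G b)) ->
  \det (\matrix_(b, c) (G b)@_(w c)) = 0.
Proof.
move=> ug GL; have [lam hlam] := functional_act r.+1 iR (invmx g) w.
have /choice[f hf] : forall b, exists f : 'I_n.+1 -> {mpoly R[n.+1]},
    (forall l, L (f l)) /\ act iR g (G b) = \sum_l 'X_l * f l by move=> b; exact: GL.
have fh b l : f b l \is r.-homog by apply: hL.2; apply: (hf b).1.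
rewrite -[RHS](@bayer_minors_multiples _ _ _ _ _ lam _ iR M Z ZM f (minors lam) fh).
  congr (\det _); apply/matrixP => b c; rewrite !mxE -(hf b).2.
  have hom : act iR g (G b) \is r.+1.-homog.
    by have := (gen_form hL 1).2 _ (GL b); rewrite addn1.
  by have := hlam _ hom c; rewrite mxE => ->; rewrite act_mul mulmxV // act1.
by move=> b l; apply/(ML (fh b l)); apply: (hf b).1.
Qed.

(** Macaulay's bound provides at least Q products with independent initial monomials, and the
    equations allow no more. So these products span all multiples of degree r + 1; this is the
    rewriting rule needed for higher degrees, where the colengths persist. *)
Lemma bayer_good_at : good_at a r iR L.
Proof.
have [g [T [F [ug bT cT gT [hF F1 Ft]]]]] := bayer_generic_coordinates.
have hs j := pre_submodule iR g (gen_form hL j).1.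
have gm j := graph_multiples F1 Ft j loc.
have sub j G : multiples r T F j G -> pre iR g (gen L j) G.
  apply: multiples_min => // w dw Tw; have [al [u [dal du Tu ->]]] := multiple_factor F dw Tw.
  by apply: (pre_gen_mulX hL dal); case: (hF u du Tu).
have gm1 : graph_over r.+1 (shift T) (multiples r T F 1) by have := gm 1%N; rewrite addn1.
set T' := shift T in gm1; set cs := cols n r.+1 T'.
have [E hE] := graph_basis gm1.
have EL u : mdeg u = r.+1 -> T' u -> pre iR g (gen L 1) (E u).
  by move=> du Tu; apply: sub; case: (hE u du Tu).
have Ec u v : mdeg u = r.+1 -> T' u -> mdeg v = r.+1 -> T' v -> (E u)@_v = (v == u)%:R.
  by move=> du Tu; apply: (hE u du Tu).2.
have csE i : (i < size cs)%N -> mdeg (nth 0%MM cs i) = r.+1 /\ T' (nth 0%MM cs i).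
  by move=> lt; apply: nth_cols (Ordinal lt).
have le_cs : (Q <= size cs)%N.
  have := macaulay na (leqnn r) bT; rewrite cT => /(_ (leqnn _)).
  by have := size_cols n r.+1 T'; rewrite /Q -/cs -/T'; lia.
(* Otherwise Q + 1 elements of the basis E, read on their own initial monomials, would give a
   vanishing minor equal to 1. *)
have ge_cs : (size cs <= Q)%N.
  rewrite leqNgt; apply/negP => lt.
  have lt' (i : 'I_(Q + 1)) : (i < size cs)%N by apply: leq_trans (ltn_ord i) _; rewrite addn1.
  have := bayer_gen_minors (fun i => nth 0%MM cs i) ug
    (fun i : 'I_(Q + 1) => EL _ (csE i (lt' i)).1 (csE i (lt' i)).2).
  set X := \matrix_(b, c) _; have -> : X = 1%:M.
    apply/matrixP => b c; have [hb1 hb2] := csE _ (lt' b); have [hc1 hc2] := csE _ (lt' c).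
    by rewrite !mxE Ec // nth_uniq ?uniq_cols ?lt' // eq_sym.
  by rewrite det1 => /eqP; rewrite oner_eq0.
have szcs : size cs = Q by apply/eqP; rewrite eqn_leq ge_cs le_cs.
have cT1 : colen n.+1 r.+1 T' = gbinom a r r.+1.
  by have := size_cols n r.+1 T'; rewrite -/cs szcs /Q; move: le1; lia.
have gen1 G : pre iR g (gen L 1) G -> multiples r T F 1 G.
  move=> LG; have [G1 mG1 h0] := graph_reduce G (multiples_submodule r T F 1) gm1.
  suff : G - G1 = 0 by move/eqP; rewrite subr_eq0 => /eqP->.
  have LG' : pre iR g (gen L 1) (G - G1) by apply: (submoduleB (hs 1%N)) => //; apply: sub.
  have hom : G - G1 \is r.+1.-homog by have := (pre_form_space iR ug (gen_form hL 1)).2 _ LG'; rewrite addn1.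
  apply/mpolyP => v; rewrite mcoeff0; have [/eqP dv|dv] := boolP (mdeg v == r.+1); last exact: dhomog_nemf_coeff hom dv.
  (* The identity matrix of E on the columns is bordered by the remainder G - G1 and by an arbitrary
     monomial v; the minor equals the coefficient of the remainder at v. *)
  pose rows (b : 'I_(Q + 1)) := if split b is inl b' then E (nth 0%MM cs b') else G - G1.
  pose w (c : 'I_(Q + 1)) := if split c is inl c' then nth 0%MM cs c' else v.
  have csQ (i : 'I_Q) := csE i (leq_trans (ltn_ord i) le_cs).
  have hr b : pre iR g (gen L 1) (rows b).
    by rewrite /rows; case: (split b) => // b'; apply: EL; case: (csQ b').
  have := bayer_gen_minors w ug hr.
  have -> : \matrix_(b, c) (rows b)@_(w c) =
      block_mx (1%:M : 'M_Q) (\matrix_(b, c) (E (nth 0%MM cs b))@_v) 0 (const_mx (G - G1)@_v : 'M_1).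
    apply/matrixP => b c; rewrite [LHS]mxE /rows /w; case: (split_ordP b) => b' ->; case: (split_ordP c) => c' ->.
    - have [hb1 hb2] := csQ b'; have [hc1 hc2] := csQ c'.
      by rewrite block_mxEul mxE Ec // nth_uniq ?uniq_cols ?szcs // eq_sym.
    - by rewrite block_mxEur mxE.
    - by rewrite block_mxEdl mxE h0 //; case: (csQ c').
    - by rewrite block_mxEdr mxE.
  by rewrite det_ublock det1 mul1r det_mx11 mxE.
have mul j i G : multiples r T F j G -> multiples r T F j.+1 ('X_i * G).
  apply: multiples_mulX => {}i u du Tu; apply: gen1.
  rewrite /pre actM actX mulr_suml; apply: (submodule_sum (gen_form hL 1).1) => l _.
  rewrite -scalerAl; apply: (submoduleZ (gen_form hL 1).1); apply: (gen_mul hL (j := 0)).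
  by case: (hF u du Tu).
have genj j G : gen L j G -> multiples r T F j (act iR (invmx g) G).
  elim: j G => [|j IH] G.
    move=> LG; have LG' : pre iR g L (act iR (invmx g) G) by rewrite /pre act_mul mulVmx // act1.
    rewrite (graph_expand (pre_submodule iR g hL.1) gT hF LG') big_seq.
    apply: (submodule_sum (multiples_submodule r T F 0)) => u; rewrite mem_cols => /andP[/eqP du Tu].
    apply: (submoduleZ (multiples_submodule r T F 0)).
    by have := @multiple_multiples n r R T F 0 u; rewrite addn0; apply.
  move=> [f [fL ->]]; rewrite act_sum; apply: (submodule_sum (multiples_submodule r T F j.+1)) => i _.
  rewrite actM actX mulr_suml; apply: (submodule_sum (multiples_submodule r T F j.+1)) => l _.
  rewrite -scalerAl; apply: (submoduleZ (multiples_submodule r T F j.+1)); apply: mul; exact: IH (fL i).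
exists g, T; split=> // [|j]; first exact: colen_persist.
apply: eq_graph (gm j) => G; split; first exact: sub.
by move/genj; rewrite act_mul mulmxV // act1.
Qed.

End LocalConverse.

(** * The Hilbert functor as a subfunctor *)

Section Trivializations.
Variables (A B : comNzRingType) (phi : {rmorphism A -> B}) (N q : nat).
Variables (L : 'rV[A]_N -> Prop) (M : 'M[B]_(N, q)).
Hypothesis hM : trivializes phi L M.

Lemma trivializes_section : exists2 Z : 'M[B]_(q, N), Z *m M = 1%:M &
  forall i, base_change_submodule phi L (delta_mx 0 i - row i M *m Z).
Proof.
have /choice[z hz] := fun j : 'I_q => hM.1 (delta_mx 0 j).
have ZM : (\matrix_j z j) *m M = 1%:M by apply/row_matrixP => j; rewrite row_mul rowK hz row1.
exists (\matrix_j z j) => // i; apply/hM.2.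
by rewrite mulmxBl -rowE -mulmxA ZM mulmx1 subrr.
Qed.

(** The section Z splits the sequence: the kernel is generated by the differences of the unit
    vectors and their representatives, and it remains so over every B-algebra. *)
Lemma trivializes_base_change (R : comNzRingType) (h : {rmorphism B -> R}) (psi : {rmorphism A -> R}) :
  (forall x, h (phi x) = psi x) -> trivializes psi L (map_mx h M).
Proof.
move=> e; have [Z ZM hZ] := trivializes_section; split=> [w|v].
  by exists (w *m map_mx h Z); rewrite -mulmxA -map_mxM ZM map_mx1 mulmx1.
have hs : is_submodule (base_change_submodule psi L) := span_submodule _.
have hs' : is_submodule (fun v : 'rV[R]_N => v *m map_mx h M = 0).
  split=> [|u1 u2 h1 h2|c u1 h1]; first by rewrite mul0mx.
    by rewrite mulmxDl h1 h2 addr0.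
  by rewrite -scalemxAl h1 scaler0.
have eM (u : 'rV[A]_N) : map_mx h (map_mx phi u) = map_mx psi u.
  by apply/rowP => i; rewrite !mxE e.
split=> [vM|]; last first.
  apply: (span_min hs') => _ [u Lu ->]; rewrite -eM -map_mxM.
  have -> : map_mx phi u *m M = 0 by apply/hM.2; apply: sub_span; exists u.
  by rewrite map_mx0.
have -> : v = \sum_i v 0 i *: map_mx h (delta_mx 0 i - row i M *m Z).
  transitivity (v *m (1%:M - map_mx h (M *m Z))).
    by rewrite mulmxBr mulmx1 map_mxM mulmxA vM mul0mx subr0.
  rewrite [LHS]mulmx_sum_row; apply: eq_bigr => i _; congr (_ *: _).
  by rewrite linearB /= row1 map_mxB map_delta_mx -map_row row_mul.
apply: (submodule_sum hs) => i _; apply: (submoduleZ hs).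
have hp : is_submodule (fun u : 'rV[B]_N => base_change_submodule psi L (map_mx h u)).
  split=> [|u1 u2 h1 h2|c u1 h1].
  - by rewrite map_mx0; apply: submodule0 hs.
  - by rewrite map_mxD; apply: (submoduleD hs).
  - by rewrite map_mxZ; apply: (submoduleZ hs).
by apply: (span_min hp) (hZ i) => _ [u Lu ->]; rewrite eM; apply: sub_span; exists u.
Qed.

End Trivializations.

Lemma map_bayer_mx (k : fieldType) n r q Q (lam : 'M[k]_(Nmon n r.+1, Q)) (B R : comNzRingType)
    (h : {rmorphism B -> R}) (iB : {rmorphism k -> B}) (M : 'M[B]_(Nmon n r, q)) :
  map_mx h (bayer_mx lam iB M) = bayer_mx lam (h \o iB) (map_mx h M).
Proof.
rewrite /bayer_mx map_row_mx; congr row_mx; apply/matrixP => t c; rewrite mxE.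
  case/mxvec_indexP: t => l i; rewrite !mul_colsE /functional !mxE rmorph_sum; apply: eq_bigr => j _.
  by rewrite rmorphM !mxE -!mpolyXD !mcoeffX rmorph_nat.
case/mxvec_indexP: t => l i; case/mxvec_indexP: c => l' j.
by rewrite !kron1E rmorphM rmorph_nat mxE.
Qed.

Lemma eq_bayer_mx (k : fieldType) n r q Q (lam : 'M[k]_(Nmon n r.+1, Q)) (B : comNzRingType)
    (iB iB' : {rmorphism k -> B}) (M : 'M[B]_(Nmon n r, q)) :
  iB =1 iB' -> bayer_mx lam iB M = bayer_mx lam iB' M.
Proof.
move=> e; rewrite /bayer_mx; congr row_mx; apply/matrixP => t c.
case/mxvec_indexP: t => l i; rewrite !mul_colsE /functional !mxE; apply: eq_bigr => j _.
by rewrite !mxE e.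
Qed.

Lemma forms_kernel n r (A R : comNzRingType) (psi : {rmorphism A -> R}) q
    (L : 'rV[A]_(Nmon n r) -> Prop) (M : 'M[R]_(Nmon n r, q)) F :
  trivializes psi L M -> F \is r.-homog ->
  row_of_form r F *m M = 0 <-> image_span psi (forms L) F.
Proof.
move=> hM hF; rewrite (hM.2 (row_of_form r F)) -{2}(row_of_formK hF).
by rewrite -(forms_base_change psi L (form_of_row _)) formsP.
Qed.

Section Equations.
Variables (k : fieldType) (hk : [pchar k] =i pred0) (n r : nat) (a : nat -> nat).
Hypotheses (na : noninc a) (le1 : (gbinom a r r.+1 <= 'C(n + r.+1, n))%N).
Let Q := ('C(n + r.+1, n) - gbinom a r r.+1)%N.
Let p := gbinom a r r.

Definition bayer_equation (F : plucker_ring k (Nmon n r) (gbinom a r r)) : Prop :=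
  F \is n.+1.-homog /\ exists (lam : 'M[k]_(Nmon n r.+1, Q + 1)) f,
    forall (B : comNzRingType) (iB : {rmorphism k -> B}) M,
      ev iB M F = \det (rowsub f (bayer_mx lam iB M)).

Lemma bayer_minor_equation (lam : 'M[k]_(Nmon n r.+1, Q + 1)) f : exists2 F, bayer_equation F &
  forall (B : comNzRingType) (iB : {rmorphism k -> B}) M,
    ev iB M F = \det (rowsub f (bayer_mx lam iB M)).
Proof.
by have [F hF eF] := minor_form_bayer lam hk f; exists F => //; split=> //; exists lam, f.
Qed.

Variables (A : comNzRingType) (iA : {rmorphism k -> A}) (L : 'rV[A]_(Nmon n r) -> Prop).
Hypothesis hL : is_submodule L.

(** An element of B is zero if it is killed by an element outside each prime. In the localizations
    the multiples of degree r + 1 are a graph over Q columns, fewer than the Q + 1 functionals. *)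
Lemma good_equations (B : comNzRingType) (phi : {rmorphism A -> B}) M F :
  good a r iA (forms L) -> trivializes phi L M -> bayer_equation F -> ev (phi \o iA) M F = 0.
Proof.
move=> gL hM [_ [lam [f eF]]]; rewrite eF; set d := \det _.
rewrite -[d]mul1r; apply: (@locally_unit B (fun c => c * d = 0)).
  split=> [|x y h1 h2|c x h1]; first exact: mul0r.
    by rewrite mulrDl h1 h2 addr0.
  by rewrite -mulrA h1 mulr0.
move=> K ph hph; have [R [psi [chi loc]]] := localize_at ph.
have loc' : local_to chi by case: loc.
suff e : psi d = 0 by case: loc => _ _ _ /(_ d)[/(_ e)[s s0 hs] _]; exists s.
pose psi' : {rmorphism A -> R} := psi \o phi.
have hM' := trivializes_base_change hM (h := psi) (psi := psi') (fun x => erefl).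
have [Z ZM hZ] := trivializes_section hM'.
have [g [T [ug cT gT]]] := gL R K psi' chi loc'.
have hL' : form_space r (image_span psi' (forms L)).
  by apply: image_span_homog; case: (forms_space hL).
rewrite /d -det_map_mx map_mxsub map_bayer_mx (@eq_bayer_mx _ _ _ _ _ _ _ _ (psi' \o iA)) //.
have gT1 := gT 1%N; rewrite addn1 in gT1.
refine (bayer_minors_eq0 lam (Z := Z) f hL' ug gT1 _ _).
  by move=> i; apply/forms_base_change; apply/formsP.
have := size_cols n r.+1 (shift T); have := cT 1%N; rewrite addn1 /= => ->.
by rewrite /Q; lia.
Qed.

(** The f over which the quotient is free generate the unit ideal, so one of them is invertible in
    the local ring R. The map from A then factors through A_f, where M and its vanishing minors
    live. *)
Lemma equations_good :
  in_Gr p L ->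
  (forall f (B : comNzRingType) (phi : {rmorphism A -> B}) M, is_localization phi f ->
     trivializes phi L M -> forall F, bayer_equation F -> ev (phi \o iA) M F = 0) ->
  good a r iA (forms L).
Proof.
move=> [_ [s [s1 hs]]] h R K psi chi loc.
have [f fs f0] : exists2 f, f \in s & chi (psi f) != 0.
  apply/hasP; apply/negPn/negP => /hasPn no.
  have : chi (psi 1) = 0.
    have := s1; apply: (image_gen_ideal_gen (f := chi \o psi) (I := fun x => x = 0)).
      by split=> [//|x y -> ->|c x ->]; rewrite ?addr0 ?mulr0.
    by move=> x /no /negPn/eqP.
  by rewrite !rmorph1 => /eqP; rewrite oner_eq0.
have [B [phi [M [lB hM]]]] := hs f fs; have [[fi hfi] lB2 lB3] := lB.
have [t ht] := loc _ f0.
have ut m : psi (f ^+ m) * t ^+ m = 1 by rewrite rmorphXn -exprMn ht expr1n.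
have [g hg] : exists g : {rmorphism B -> R}, forall x, g (phi x) = psi x.
  apply: ring_lift => [b|x /lB3[m e]].
    by have [x [m e]] := lB2 b; exists x, (f ^+ m), (t ^+ m).
  by rewrite -[psi x]mul1r -(ut m) mulrAC -rmorphM e rmorph0 mul0r.
have hM' := trivializes_base_change hM hg; have [Z ZM _] := trivializes_section hM'.
have hL' : form_space r (image_span psi (forms L)).
  by apply: image_span_homog; case: (forms_space hL).
have eI : (g \o (phi \o iA) : {rmorphism k -> R}) =1 psi \o iA by move=> c; rewrite /= hg.
apply: (eq_good_at eI (fun F => iff_refl _)).
apply: (bayer_good_at hk na le1 loc hL' (erefl p) ZM).
  by move=> F hF; apply: forms_kernel.
move=> lam f'; have [F GF eF] := bayer_minor_equation lam f'.
by have := congr1 g (h f B phi M lB hM F GF); rewrite eF rmorph0 -det_map_mx map_mxsub map_bayer_mx.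
Qed.

End Equations.

Lemma to_Gr_forms n r (A : comNzRingType) (J : chart_ideals A n) :
  same (forms (to_Gr (r := r) J)) (sections J r).
Proof.
move=> F; split=> [[v Jv ->]//|JF]; exists (row_of_form r F).
  by rewrite /to_Gr row_of_formK //; case: JF.
by rewrite row_of_formK //; case: JF.
Qed.

Lemma submodule_of_forms n r (A : comNzRingType) (L : 'rV[A]_(Nmon n r) -> Prop) :
  is_submodule (forms L) -> is_submodule L.
Proof.
move=> hs; split=> [|u v /formsP hu /formsP hv|c v /formsP hv]; apply/formsP.
- by rewrite form_of_row0; apply: submodule0 hs.
- by have := form_of_row_lin 1 u v; rewrite !scale1r => ->; apply: (submoduleD hs).
- by have := form_of_row_lin c v 0; rewrite form_of_row0 !addr0 => ->; apply: (submoduleZ hs).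
Qed.

(** The existence of a subscheme with Hilbert polynomial P enters through regularity: in degree r +
    1 the expected codimension is that of an actual space of forms. *)
Lemma gbinom_le_forms (k : fieldType) n (Z : chart_ideals k n) P r (a : nat -> nat) :
  [pchar k] =i pred0 -> noninc a -> (forall d, (r <= d)%N -> P.[d%:R] = (gbinom a r d)%:R) ->
  is_closed_subscheme Z -> hilbert_polynomial Z P ->
  (gbinom a r r.+1 <= 'C(n + r.+1, n))%N.
Proof.
move=> hk na hP hZ hilb; have [d1 codim] := hilbert_gbinom hP hilb.
have sat := sections_saturated (chart_is_ideal hZ) (chart_dehomog hZ).
have [g [T [_ _ cT _ _]]] := field_regular idfun hk na sat codim.
have := cT 1%N; rewrite addn1 => <-; rewrite -(size_cols n r.+1 (shift T)); exact: leq_addl.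
Qed.

Lemma kDelta_vanish (k : fieldType) N q (G : plucker_ring k N q -> Prop) (B : comNzRingType)
    (iB : {rmorphism k -> B}) (M : 'M[B]_(N, q)) F :
  (forall F, G F -> ev iB M F = 0) -> ideal_of_kDelta G F -> ev iB M F = 0.
Proof.
move=> hG; rewrite /ev; apply: (image_gen_ideal_gen (I := fun x => x = 0)).
  by split=> [//|x y -> ->|c x ->]; rewrite ?addr0 ?mulr0.
by move=> F' [/(ev_relation iB M)|/hG].
Qed.

Theorem theorem6p7 (k : fieldType) (hk : [pchar k] =i pred0)
    (n : nat) (P : {poly rat})
    (hP : exists2 Z : chart_ideals k n,
            is_closed_subscheme Z & hilbert_polynomial Z P)
    (r : nat) (hr : gotzmann_number P r)
    (p : nat) (hp : P.[r%:R] = p%:R) :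
  exists G : plucker_ring k (Nmon n r) p -> Prop,
    (forall F, G F -> exists2 d : nat, (d <= n.+1)%N & F \is d.-homog) /\
    represents_Hilb P (ideal_of_kDelta G).
Proof.
have [a [na hPa]] := gotzmann_gbinom hr; have [Z hZ hilb] := hP.
have le1 := gbinom_le_forms hk na hPa hZ hilb.
have ep : p = gbinom a r r by apply/eqP; move: hp; rewrite hPa // => /eqP; rewrite eqr_nat eq_sym.
subst p; exists (@bayer_equation k n r a); split; first by move=> F [hF _]; exists n.+1.
have good_of (A : comAlgType k) (J : chart_ideals A n) : in_Hilb P J ->
    good a r (in_alg A) (forms (to_Gr (r := r) J)).
  move=> hJ; apply: (good_ext _ (hilb_good (in_alg A) hk na hPa hJ)).
  by move=> F; apply: iff_sym; exact: to_Gr_forms.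
have sub_of (A : comAlgType k) (J : chart_ideals A n) : in_Hilb P J -> is_submodule (to_Gr (r := r) J).
  case=> hJ _ _; apply: submodule_of_forms.
  have := (fam_form (sections_saturated (chart_is_ideal hJ) (chart_dehomog hJ)) r).1.
  by move=> [h0 hD hc]; split=> [|F G /to_Gr_forms hF /to_Gr_forms hG|c F /to_Gr_forms hF]; apply/to_Gr_forms; auto.
(* A point of the Hilbert functor is recovered from its forms of degree r; both injectivity and
   naturality rest on this. *)
have eqJ (A : comAlgType k) (J : chart_ideals A n) : in_Hilb P J ->
    same_subscheme J (subscheme_of r (sections J r)).
  move=> hJ; have [closed _ _] := hJ; apply: subscheme_of_sections => // j F.
  exact: (sections_gen (in_alg A) hk na hPa hJ).
split.
- move=> A J noeA hJ; split; first by apply: (good_in_Gr noeA (sub_of A J hJ) (good_of A J hJ)).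
  move=> f B phi M _ hM F hF; apply: (@kDelta_vanish _ _ _ _ _ (phi \o in_alg A) M F _ hF) => F' GF'.
  exact: (good_equations le1 (sub_of A J hJ) (good_of A J hJ) hM GF').
- move=> A J J' noeA hJ hJ' e i f.
  have es : same (sections J r) (sections J' r).
    move=> F; split=> /to_Gr_forms[v Jv ->]; apply/to_Gr_forms/formsP; exact/e.
  by rewrite (eqJ A J hJ i f) (eqJ A J' hJ' i f); apply: subscheme_of_ext.
- move=> A L noeA [grL vanL]; have hL : is_submodule L by case: grL.
  have gL : good a r (in_alg A) (forms L).
    apply: (equations_good hk na le1 hL grL) => f B phi M lB hM F GF.
    by apply: (vanL f B phi M lB hM); apply: sub_ideal_gen; right.
  exists (subscheme_of r (forms L)); first exact: (good_hilb (forms_space hL) gL hPa).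
  move=> v; rewrite /to_Gr -(formsP L v).
  by have := sections_subscheme_of 0 (form_of_row v) (forms_space hL) gL; rewrite addn0.
move=> A B phi J noeA noeB hJ v; have hL := sub_of A J hJ; have fL := forms_space hL.
have gL := good_of A J hJ.
(* [subscheme_of] commutes with base change, and the condition passes to B, so the forms of degree r
   of the new subscheme are exactly the image of the old ones. *)
have gB : good a r (in_alg B) (image_span phi (forms (to_Gr (r := r) J))).
  by apply: good_base_change gL => c; rewrite /= linearZ rmorph1.
have fB : form_space r (image_span phi (forms (to_Gr (r := r) J))).
  by apply: image_span_homog; case: fL.
have e1 i F : J i F <-> subscheme_of r (forms (to_Gr (r := r) J)) i F.
  rewrite (eqJ A J hJ i F); apply: subscheme_of_ext => G; apply: iff_sym; exact: to_Gr_forms.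
have e2 i F : base_change phi J i F <-> subscheme_of r (image_span phi (forms (to_Gr (r := r) J))) i F.
  rewrite -(base_change_subscheme_of phi fL i F).
  by split; apply: ideal_gen_min; try exact: ideal_gen_ideal; move=> _ [G JG ->]; apply: sub_ideal_gen; exists G => //; apply/e1.
rewrite -(formsP (base_change_submodule _ _)) (forms_base_change phi _ _).
rewrite -[image_span _ _ _]/(gen (image_span phi (forms (to_Gr (r := r) J))) 0 (form_of_row v)).
rewrite -(sections_subscheme_of 0 (form_of_row v) fB gB) addn0 /to_Gr.
by split=> -[hF hi]; split=> // i; apply/e2; apply: hi.
Qed.
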